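(* Let $\Omega\subset\mathbb{R}^3$ be a bounded domain, $0<T<+\infty$, $Q_T=\Omega\times]0,T[$, and assume that the space $V$ is separable. Suppose that the entries of the $3\times3$ matrices $\varepsilon=\varepsilon(x)$, $\mu=\mu(x)$ are bounded measurable real functions in $\Omega$, that $\varepsilon(x)$, $\mu(x)$ are symmetric non-negative matrices for all $x\in\Omega$, and that there exist constants $\varepsilon_*>0$, $\mu_*>0$ such that $$(\varepsilon(x)\xi)\cdot\xi\ge\varepsilon_*|\xi|^2,\qquad(\mu(x)\xi)\cdot\xi\ge\mu_*|\xi|^2\qquad\forall x\in\Omega,\ \forall\xi\in\mathbb{R}^3.$$ Let $\sigma=\{\sigma_{kl}(x)\}_{k,l=1,2,3}$ be a matrix whose entries are bounded measurable real functions in $\Omega$. Let $\{e,h\}\in L^2(Q_T)^3\times L^2(Q_T)^3$ be a weak solution of the initial-boundary value problem for the Maxwell equations with coefficients $\varepsilon,\mu$, with current density given by the Ohm law $j=\sigma e$, and with initial data $e_0=h_0=0$ a.e. in $\Omega$. Then $$e=h=0\quad\text{a.e. in }Q_T.$$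
   Context: Spaces: $V:=\{u\in L^2(\Omega)^3:\operatorname{curl}u\in L^2(\Omega)^3\}$ (distributional curl), a Hilbert space with scalar product $(u,v)_V=\int_\Omega(u\cdot v+\operatorname{curl}u\cdot\operatorname{curl}v)\,dx$; $V_0:=\{u\in V:\int_\Omega(\operatorname{curl}u)\cdot z\,dx=\int_\Omega u\cdot(\operatorname{curl}z)\,dx\ \ \forall z\in V\}$, with the norm of $V$. For a matrix $a=\{a_{kl}\}$ and a vector $\xi$, $a\xi=\{\sum_l a_{kl}\xi_l\}_k$. $L^2(Q_T)$ is identified with $L^2(0,T;L^2(\Omega))$ via $u\mapsto(t\mapsto u(\cdot,t))$. Weak solution: the formal problem is $\varepsilon\partial_te+j=\operatorname{curl}h$, $\mu\partial_th=-\operatorname{curl}e$ in $Q_T$, $n\times e=0$ on $\partial\Omega\times[0,T]$, $e=e_0$, $h=h_0$ in $\Omega\times\{0\}$. A pair $\{e,h\}\in L^2(Q_T)^3\times L^2(Q_T)^3$ is called a weak solution of this problem (with data $\varepsilon,\mu$, $j\in L^2(Q_T)^3$, $e_0,h_0\in L^2(\Omega)^3$) if $$-\int_{Q_T}\big((\varepsilon e)\cdot\partial_t\phi+(\mu h)\cdot\partial_t\psi\big)\,dx\,dt+\int_{Q_T}\big(-h\cdot\operatorname{curl}\phi+e\cdot\operatorname{curl}\psi\big)\,dx\,dt+\int_{Q_T}j\cdot\phi\,dx\,dt$$ $$=\int_\Omega\big[(\varepsilon(x)e_0(x))\cdot\phi(x,0)+(\mu(x)h_0(x))\cdot\psi(x,0)\big]\,dx$$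 for all $\{\phi,\psi\}\in L^2(0,T;V_0)\times L^2(0,T;V)$ such that $\partial_t\phi,\partial_t\psi\in L^2(Q_T)^3$ and $\phi(\cdot,T)=\psi(\cdot,T)=0$ a.e. in $\Omega$. In the present theorem this is used with $j=\sigma e$, where $e$ is the first component of the weak solution itself. *)

(* Defs.v *)
From HB Require Import structures.
From mathcomp Require Import all_boot all_order all_algebra.
From mathcomp Require Import all_classical all_reals all_analysis.
From mathcomp Require Import measurable_realfun.
Set Implicit Arguments.
Unset Strict Implicit.
Unset Printing Implicit Defensive.
Import Order.TTheory GRing.Theory Num.Theory numFieldNormedType.Exports.
Local Open Scope classical_set_scope.
Local Open Scope ring_scope.

Section Maxwell.
Context {R : realType}.

Local Notation space := (R * R * R)%type.
(* The sigma-algebra on which the product Lebesgue measure is defined. *)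
Local Notation spacetime := (measurableTypeR R * measurableTypeR R
  * measurableTypeR R * measurableTypeR R)%type.
Local Notation vec := 'cV[R]_3.

Definition leb3 := (@lebesgue_measure R \x @lebesgue_measure R
                                        \x @lebesgue_measure R)%E.
HB.instance Definition _ := Measure.on leb3.
Definition leb4 := (leb3 \x @lebesgue_measure R)%E.
HB.instance Definition _ := Measure.on leb4.

Definition dot (u v : vec) : R := \sum_i u i 0 * v i 0.

Definition is_domain (Om : set space) : Prop :=
  [/\ open Om, connected Om & Om !=set0].

Definition QT (Om : set space) (T : R) : set (space * R) :=
  Om `*` [set` `]0, T[].

(* Measurability in the sense of Lebesgue: the completed sigma-algebra.
   Coefficients satisfy pointwise bounds, so, unlike elements of L^2, they are
   not taken up to null sets and are not assumed to be Borel. The library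
   integral is also defined for integrands that are only Lebesgue measurable,
   where it has the value obtained from any Borel function equal to them a.e. *)
Definition lebesgue_measurable_fun (Om : set space) (f : space -> R) : Prop :=
  forall Y : set R, measurable Y ->
    completed_algebra_gen leb3 (Om `&` f @^-1` Y).

Definition bounded_measurable_mx (Om : set space) (a : space -> 'M[R]_3) :
    Prop :=
  forall k l : 'I_3, lebesgue_measurable_fun Om (fun x => a x k l) /\
    exists M : R, forall x, Om x -> `|a x k l| <= M.

Definition measurable_field d (S : measurableType d) (D : set S)
    (u : S -> vec) : Prop :=
  forall i, measurable_fun D (fun x => u x i 0).

(* A class in L^2 is given by a Borel representative. *)
Definition L2 d (S : measurableType d) (m : set S -> \bar R) (D : set S)
    (u : S -> vec) : Prop :=
  measurable_field D u /\
  (\int[m]_(x in D) (dot (u x) (u x))%:E < +oo)%E.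

Definition dist2 (Om : set space) (u v : space -> vec) : \bar R :=
  (\int[leb3]_(x in Om) (dot (u x - v x)%R (u x - v x)%R)%:E)%E.

Definition smooth (E : normedModType R) (f : E -> R) : Prop :=
  forall s : seq E, let g := foldr (fun v g => 'D_v g : E -> R) f s in
    continuous g /\ forall x v, derivable g x v.

Definition test_function (E : normedModType R) (U : set E) (f : E -> R) :
    Prop :=
  smooth f /\ exists K : set E,
    [/\ compact K, K `<=` U & forall x, ~ K x -> f x = 0].

Definition unit_vec (k : 'I_3) : space :=
  ((k == 0)%:R, (k == 1)%:R, (k == 2%:R)%:R).

(* Indices in 'I_3 are added modulo 3. *)
Definition classical_curl (z : space -> vec) (x : space) : vec :=
  \col_i ('D_(unit_vec (i + 1)) (fun y => z y (i + 2%:R) 0) x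
        - 'D_(unit_vec (i + 2%:R)) (fun y => z y (i + 1) 0) x).

Definition is_curl (Om : set space) (u w : space -> vec) : Prop :=
  forall z : space -> vec, (forall i, test_function Om (fun x => z x i 0)) ->
    \int[leb3]_(x in Om) dot (u x) (classical_curl z x) =
    \int[leb3]_(x in Om) dot (w x) (z x).

Definition is_dt (Om : set space) (T : R) (f d : space * R -> vec) : Prop :=
  forall (z : space * R -> R) (i : 'I_3), test_function (QT Om T) z ->
    \int[leb4]_(p in QT Om T) (f p i 0 * 'D_((0, 1) : space * R) z p) =
    - (\int[leb4]_(p in QT Om T) (d p i 0 * z p)).

(* An element u of V is carried together with its distributional curl (which
   is unique a.e.), i.e. V is the graph of the curl operator in
   L^2(Om)^3 x L^2(Om)^3 and its norm is the graph norm. *)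
Definition V (Om : set space) : set ((space -> vec) * (space -> vec)) :=
  [set p | [/\ L2 leb3 Om p.1, L2 leb3 Om p.2 & is_curl Om p.1 p.2]].

Definition Vnorm2 (Om : set space) (p : (space -> vec) * (space -> vec)) :
    \bar R :=
  (\int[leb3]_(x in Om) (dot (p.1 x) (p.1 x) + dot (p.2 x) (p.2 x))%R%:E)%E.

Definition V0 (Om : set space) : set ((space -> vec) * (space -> vec)) :=
  [set p | V Om p /\ forall z, V Om z ->
    \int[leb3]_(x in Om) dot (p.2 x) (z.1 x) =
    \int[leb3]_(x in Om) dot (p.1 x) (z.2 x)].

Definition V_separable (Om : set space) : Prop :=
  exists S : set ((space -> vec) * (space -> vec)),
    [/\ countable S, S `<=` V Om &
        forall p, V Om p -> forall r : R, 0 < r ->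
          exists2 q, S q & (Vnorm2 Om (p - q)%R < (r ^+ 2)%:E)%E].

Definition slice (f : space * R -> vec) (t : R) : space -> vec :=
  fun x => f (x, t).

Definition simple_fun (W : set ((space -> vec) * (space -> vec)))
    (s : R -> (space -> vec) * (space -> vec)) : Prop :=
  exists (n : nat) (A : 'I_n -> set R)
         (v : 'I_n -> (space -> vec) * (space -> vec)),
    [/\ forall i, measurable (A i), forall i, W (v i) &
        forall t, s t = \sum_i (\1_(A i) t : R) *: v i].

(* (f, c) represents an element of L^2(0, T; W), where W is V or V_0, through
   the identification of L^2(QT) with L^2(0, T; L^2(Om)): f is the function
   and c is its curl with respect to x. Measurability with values in W is
   strong (Bochner) measurability. *)
Definition L2_time (W : set ((space -> vec) * (space -> vec)))
    (Om : set space) (T : R) (f c : space * R -> vec) : Prop :=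
  [/\ measurable_field (QT Om T : set spacetime) f /\
      measurable_field (QT Om T : set spacetime) c,
      {ae @lebesgue_measure R, forall t, t \in `]0, T[ ->
        W (slice f t, slice c t)},
      exists s : nat -> R -> (space -> vec) * (space -> vec),
        (forall n, simple_fun W (s n)) /\
        {ae @lebesgue_measure R, forall t, t \in `]0, T[ ->
          Vnorm2 Om ((slice f t, slice c t) - s n t) @[n --> \oo] --> 0%E} &
      (\int[@lebesgue_measure R]_(t in `]0%R, T[)
        Vnorm2 Om (slice f t, slice c t) < +oo)%E].

(* g is the representative of f in C([0, T]; L^2(Om)^3); it exists as soon as
   f and its time derivative are in L^2(QT)^3, and gives the meaning of
   f(., 0) := g 0 and f(., T) := g T. *)
Definition continuous_rep (Om : set space) (T : R) (f : space * R -> vec)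
    (g : R -> space -> vec) : Prop :=
  [/\ forall t, t \in `[0, T] -> L2 leb3 Om (g t),
      forall t, t \in `[0, T] ->
        dist2 Om (g s) (g t) @[s --> within [set` `[0, T]] (nbhs t)] --> 0%E &
      {ae @lebesgue_measure R, forall t, t \in `]0, T[ ->
        {ae leb3, forall x, Om x -> g t x = slice f t x}}].

(* Here f is the test function, c its curl, d its time derivative and g its
   continuous representative. *)
Definition admissible (W : set ((space -> vec) * (space -> vec)))
    (Om : set space) (T : R) (f c d : space * R -> vec)
    (g : R -> space -> vec) : Prop :=
  [/\ L2_time W Om T f c,
      L2 leb4 (QT Om T) d,
      is_dt Om T f d,
      continuous_rep Om T f g &
      {ae leb3, forall x, Om x -> g T x = 0}].

Definition weak_solution (Om : set space) (T : R)
    (eps mu : space -> 'M[R]_3) (j : space * R -> vec) (e0 h0 : space -> vec)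
    (e h : space * R -> vec) : Prop :=
  [/\ L2 leb4 (QT Om T) e, L2 leb4 (QT Om T) h &
    forall (phi cphi dphi : space * R -> vec) (gphi : R -> space -> vec)
           (psi cpsi dpsi : space * R -> vec) (gpsi : R -> space -> vec),
      admissible (V0 Om) Om T phi cphi dphi gphi ->
      admissible (V Om) Om T psi cpsi dpsi gpsi ->
      - (\int[leb4]_(p in QT Om T) (dot (eps p.1 *m e p) (dphi p)
                                    + dot (mu p.1 *m h p) (dpsi p)))
      + (\int[leb4]_(p in QT Om T) (- dot (h p) (cphi p)
                                    + dot (e p) (cpsi p)))
      + (\int[leb4]_(p in QT Om T) dot (j p) (phi p))
      = \int[leb3]_(x in Om) (dot (eps x *m e0 x) (gphi 0 x)
                              + dot (mu x *m h0 x) (gpsi 0 x))].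

End Maxwell.

(* Main.v *)
Require Import Defs.
From HB Require Import structures.
From mathcomp Require Import all_boot all_order all_algebra.
From mathcomp Require Import all_classical all_reals all_analysis.
From mathcomp Require Import measurable_realfun ring lra.
Set Implicit Arguments.
Unset Strict Implicit.
Unset Printing Implicit Defensive.
Import Order.TTheory GRing.Theory Num.Theory numFieldNormedType.Exports.
Local Open Scope classical_set_scope.
Local Open Scope ring_scope.

(** Uniqueness follows from an energy estimate for time primitives of the
fields. For a function f on Q_T write J f (x, t) for the integral of f (x, .)
over [0, t], and set E = J e, H = J h. Testing the weak formulation with
phi (x, s) = max(0, t - s) v(x) and psi (x, s) = max(0, t - s) w(x), where
v is in V0 and w in V, turns the equation, by Fubini, into an identity at the
single time t that contains no time derivative:
  (eps E, v) + (mu H, w) - (J H, curl v) + (J E, curl w) + (sigma J E, v) = 0;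
the right-hand side vanishes because the initial data do ([tested_equation]).

This identity contains the regularity that a weak solution lacks. With v = 0
it says exactly that J E(t) is in V0 with curl - mu H(t)
([V0_electric_primitive]); with w = 0 and v a test field it says that J H(t)
is in V with curl eps E(t) + sigma J E(t) ([V_magnetic_primitive]). Hence
v = J E(t) and w = J H(t) may be inserted in the identity; the two curl terms
contribute copies of the other ones and the outcome is the balance
  (eps E, J E) + (mu H, J H) + (sigma J E, J E) = 0   at every time t
([energy_balance]). As E and H are the time derivatives of J E and J H, the
first two terms are half the derivative of the energy
G(t) = (eps J E, J E) + (mu J H, J H), and the third one is at most a constant
times G because eps is coercive. So G = 0 by the Gronwall inequality,
J E and J H vanish, and differentiating them twice in time (everywhere for the
outer primitive, at Lebesgue points for the inner one) gives e = h = 0 almost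
everywhere ([energy_eq0]).

Two facts about measurability underlie the computation. The coefficients are
only Lebesgue measurable, so they are replaced by Borel coefficients that
agree with them almost everywhere, keep the bounds, and are symmetric and
coercive at every point ([borel_version_mx]). And e, h are replaced by Borel
representatives all of whose sections in time are square integrable
([time_field]), so that the primitives above are defined at every point x and
their continuity in t can be used without exceptional sets. *)

(** * Open sets of the product are Borel *)

Section countable_base.

(** The sigma-algebra of R ^ 3 in play is the iterated product of the Borel
sigma-algebra of R, which is not by construction that of the product topology.
They agree because the topology has a countable base of measurable boxes. *)
Definition countable_base (T : topologicalType) (B : nat -> set T) : Prop :=
  forall x (U : set T), nbhs x U -> exists n, B n x /\ B n `<=` U.

(** Pairs of indices are coded by one natural number; a number that codes no
pair gets the empty set, harmless in a base. *)
Definition prod_base (T1 T2 : Type) (B1 : nat -> set T1) (B2 : nat -> set T2)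
    (n : nat) : set (T1 * T2) :=
  if unpickle n is Some p then B1 p.1 `*` B2 p.2 else set0.

Lemma countable_base_prod (T1 T2 : topologicalType) (B1 : nat -> set T1)
    (B2 : nat -> set T2) :
  countable_base B1 -> countable_base B2 -> countable_base (prod_base B1 B2).
Proof.
move=> b1 b2 [x y] U [[U1 U2] /= [/b1[n [n1 nU1]] /b2[m [m2 mU2]]] UU].
exists (pickle (n, m)); rewrite /prod_base pickleK /=; split => //.
by move=> z /= [/nU1 ? /mU2 ?]; apply: UU.
Qed.

Lemma open_countable_base (T : topologicalType) (B : nat -> set T) (A : set T) :
  countable_base B -> open A -> A = \bigcup_(n in [set n | B n `<=` A]) B n.
Proof.
move=> bB oA; apply/seteqP; split => [x Ax|x [n /= BA /BA//]].
have [|n [Bx BA]] := bB x A; first exact: open_nbhs_nbhs.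
by exists n.
Qed.

Lemma measurable_prod_base d1 d2 (T1 : measurableType d1) (T2 : measurableType d2)
    (B1 : nat -> set T1) (B2 : nat -> set T2) :
  (forall n, measurable (B1 n)) -> (forall n, measurable (B2 n)) ->
  forall n, measurable (prod_base B1 B2 n).
Proof.
move=> m1 m2 n; rewrite /prod_base; case: unpickle => // p.
exact: measurableX.
Qed.

End countable_base.

Section rational_base.
Context {R : realType}.
Local Notation mR := (measurableTypeR R).

Definition rat_base (n : nat) : set R :=
  if unpickle n is Some p then `]ratr (p : rat * rat).1, ratr p.2[%classic
  else set0.

Lemma countable_base_rat : countable_base rat_base.
Proof.
move=> x U /nbhs_ballP[e /= e0 eU].
have [p pe] : exists p : rat, ratr p \in `]x - e, x[.
  by apply: rat_in_itvoo; rewrite gtrBl.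
have [q qe] : exists q : rat, ratr q \in `]x, x + e[.
  by apply: rat_in_itvoo; rewrite ltrDl.
exists (pickle (p, q)); rewrite /rat_base pickleK /=.
move: pe qe; rewrite !in_itv /= => /andP[p1 p2] /andP[q1 q2].
split; first by rewrite p2 q1.
move=> y /=; rewrite in_itv /= => /andP[py yq]; apply: eU.
by rewrite /ball /= ltr_distl ltrBlDr; lra.
Qed.

Lemma measurable_rat_base n : measurable (rat_base n : set mR).
Proof. by rewrite /rat_base; case: unpickle. Qed.

Definition rat_base3 := prod_base (prod_base rat_base rat_base) rat_base.
Definition rat_base4 := prod_base rat_base3 rat_base.

Lemma measurable_rat_base3 n : measurable (rat_base3 n : set (mR * mR * mR)).
Proof.
exact: (measurable_prod_base
  (measurable_prod_base measurable_rat_base measurable_rat_base)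
  measurable_rat_base).
Qed.

Lemma countable_base_rat3 : countable_base rat_base3.
Proof.
exact: (countable_base_prod
  (countable_base_prod countable_base_rat countable_base_rat)
  countable_base_rat).
Qed.

(** An open set is the union of the countably many rational boxes inside it. *)
Lemma open_measurable3 (A : set (mR * mR * mR)) :
  open (A : set (R * R * R)) -> measurable A.
Proof.
move=> /(@open_countable_base (R * R * R)%type rat_base3) ->.
  apply: bigcup_measurable => n _.
  exact: measurable_rat_base3.
exact: countable_base_rat3.
Qed.

Lemma open_measurable4 (A : set (mR * mR * mR * mR)) :
  open (A : set (R * R * R * R)) -> measurable A.
Proof.
move=> /(@open_countable_base (R * R * R * R)%type rat_base4) ->.
  apply: bigcup_measurable => n _.
  exact: (measurable_prod_base measurable_rat_base3 measurable_rat_base).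
exact: (countable_base_prod countable_base_rat3 countable_base_rat).
Qed.

Lemma continuous_measurable3 (f : R * R * R -> R) :
  continuous f -> measurable_fun (setT : set (mR * mR * mR)) f.
Proof.
move=> /continuousP cf; apply: (measurability _ (RGenOpens.measurableE R)).
move=> _ [_ [a [b ->] <-]]; rewrite setTI; apply: open_measurable3.
exact/cf/interval_open.
Qed.

Lemma continuous_measurable4 (f : R * R * R * R -> R) :
  continuous f -> measurable_fun (setT : set (mR * mR * mR * mR)) f.
Proof.
move=> /continuousP cf; apply: (measurability _ (RGenOpens.measurableE R)).
move=> _ [_ [a [b ->] <-]]; rewrite setTI; apply: open_measurable4.
exact/cf/interval_open.
Qed.

End rational_base.

(** * Iterated integrals and square integrable functions *)

Section iterated_integrals.
Context d1 d2 (X : measurableType d1) (Y : measurableType d2) {R : realType}.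
Variables (m1 : {sigma_finite_measure set X -> \bar R})
          (m2 : {sigma_finite_measure set Y -> \bar R}).
Implicit Type f : X * Y -> R.

Lemma measurable_integral_snd (g : X * Y -> \bar R) : measurable_fun setT g ->
  measurable_fun setT (fun x => \int[m2]_y g (x, y))%E.
Proof.
move=> mg; rewrite [X in measurable_fun _ X](_ : _ =
    (fubini_F m2 (g^\+) \- fubini_F m2 (g^\-))%E); last first.
  apply/funext => x; rewrite integralE funepos_comp funeneg_comp.
  by [].
apply: emeasurable_funB; apply: measurable_fun_fubini_tonelli_F => //.
- exact: measurable_funepos.
- exact: measurable_funeneg.
Qed.

Lemma measurable_integral_fst (g : X * Y -> \bar R) : measurable_fun setT g ->
  measurable_fun setT (fun y => \int[m1]_x g (x, y))%E.
Proof.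
move=> mg; rewrite [X in measurable_fun _ X](_ : _ =
    (fubini_G m1 (g^\+) \- fubini_G m1 (g^\-))%E); last first.
  apply/funext => y; rewrite integralE (funepos_comp g (pair^~ y)).
  by rewrite (funeneg_comp g (pair^~ y)).
apply: emeasurable_funB; apply: measurable_fun_fubini_tonelli_G => //.
- exact: measurable_funepos.
- exact: measurable_funeneg.
Qed.

Lemma measurable_Rintegral_snd f : measurable_fun setT f ->
  measurable_fun setT (fun x => \int[m2]_y f (x, y)).
Proof.
move=> /measurable_EFinP/measurable_integral_snd.
exact: (measurableT_comp (@fine_measurable R setT measurableT)).
Qed.

Lemma measurable_Rintegral_fst f : measurable_fun setT f ->
  measurable_fun setT (fun y => \int[m1]_x f (x, y)).
Proof.
move=> /measurable_EFinP/measurable_integral_fst.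
exact: (measurableT_comp (@fine_measurable R setT measurableT)).
Qed.

Lemma Rintegral_snd_ae f : (m1 \x m2)%E.-integrable setT (EFin \o f) ->
  ae_eq m1 setT (fun x => \int[m2]_y (f (x, y))%:E)%E
    (fun x => (\int[m2]_y f (x, y))%:E).
Proof.
move=> fi; have := ae_integrable1 fi; apply: filterS => x ix _.
by rewrite /Rintegral fineK//; exact: integrable_fin_num ix.
Qed.

Lemma Rintegral_fst_ae f : (m1 \x m2)%E.-integrable setT (EFin \o f) ->
  ae_eq m2 setT (fun y => \int[m1]_x (f (x, y))%:E)%E
    (fun y => (\int[m1]_x f (x, y))%:E).
Proof.
move=> fi; have := ae_integrable2 fi; apply: filterS => x ix _.
by rewrite /Rintegral fineK//; exact: integrable_fin_num ix.
Qed.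

Lemma Rintegral_prod12 f : (m1 \x m2)%E.-integrable setT (EFin \o f) ->
  \int[(m1 \x m2)%E]_z f z = \int[m1]_x \int[m2]_y f (x, y).
Proof.
move=> fi; rewrite [LHS]/Rintegral -(integral12_prod_meas1 fi).
congr fine; apply: ae_eq_integral => //; last exact: Rintegral_snd_ae.
- exact: measurable_fubini_F fi.
- apply/measurable_EFinP/measurable_Rintegral_snd/measurable_EFinP.
  exact: measurable_int fi.
Qed.

Lemma Rintegral_prod21 f : (m1 \x m2)%E.-integrable setT (EFin \o f) ->
  \int[(m1 \x m2)%E]_z f z = \int[m2]_y \int[m1]_x f (x, y).
Proof.
move=> fi; rewrite [LHS]/Rintegral -(integral21_prod_meas1 fi).
congr fine; apply: ae_eq_integral => //; last exact: Rintegral_fst_ae.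
- exact: measurable_fubini_G fi.
- apply/measurable_EFinP/measurable_Rintegral_fst/measurable_EFinP.
  exact: measurable_int fi.
Qed.

Lemma fine_abse_le (z : \bar R) : (`|(fine z)%:E| <= `|z|)%E.
Proof. by case: z => [r||] /=; rewrite ?leey. Qed.

Lemma integrable_Rintegral_snd f : (m1 \x m2)%E.-integrable setT (EFin \o f) ->
  m1.-integrable setT (EFin \o (fun x => \int[m2]_y f (x, y))).
Proof.
move=> fi; have mEf := measurable_int _ fi.
have mf : measurable_fun setT f by exact/measurable_EFinP.
apply/integrableP; split; first exact/measurable_EFinP/measurable_Rintegral_snd.
apply: le_lt_trans ((integrable12ltyP m1 m2 mEf).1 fi).
apply: ge0_le_integral => //.
- apply: measurableT_comp => //.
  exact/measurable_EFinP/measurable_Rintegral_snd.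
- apply: (measurable_integral_snd (g := abse \o (EFin \o f))).
  exact: measurableT_comp.
- move=> x _; apply: le_trans (fine_abse_le _) _; apply: le_abse_integral => //.
  exact/measurable_EFinP/measurableT_comp.
Qed.

End iterated_integrals.

Section square_integrable.
Context d (X : measurableType d) {R : realType}.
Variable m : {measure set X -> \bar R}.
Implicit Types f g b : X -> R.

Definition square_integrable f : Prop :=
  measurable_fun setT f /\ m.-integrable setT (EFin \o (fun x => f x ^+ 2)).

Lemma le_integrableR f g : measurable_fun setT f ->
  (forall x, `|f x| <= g x) -> m.-integrable setT (EFin \o g) ->
  m.-integrable setT (EFin \o f).
Proof.
move=> mf fg; apply: le_integrable => //; first exact/measurable_EFinP.
by move=> x _ /=; rewrite lee_fin (le_trans (fg x))// ler_norm.
Qed.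

Lemma integrableDR f g : m.-integrable setT (EFin \o f) ->
  m.-integrable setT (EFin \o g) ->
  m.-integrable setT (EFin \o (fun x => f x + g x)).
Proof.
move=> fi gi; have := integrableD measurableT fi gi.
by apply: eq_integrable => // x _; rewrite /= EFinD.
Qed.

Lemma integrableNR f : m.-integrable setT (EFin \o f) ->
  m.-integrable setT (EFin \o (fun x => - f x)).
Proof.
move=> fi; have := integrableN fi.
by apply: eq_integrable => // x _; rewrite /= EFinN.
Qed.

Lemma integrableZR k f : m.-integrable setT (EFin \o f) ->
  m.-integrable setT (EFin \o (fun x => k * f x)).
Proof.
move=> fi; have := integrableZl measurableT k fi.
by apply: eq_integrable => // x _; rewrite /= EFinM.
Qed.

Lemma integrable_sumR (D : set X) (I : Type) (l : seq I) (F : I -> X -> R) :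
  measurable D -> (forall i, m.-integrable D (EFin \o F i)) ->
  m.-integrable D (EFin \o (fun x => \sum_(i <- l) F i x)).
Proof.
move=> mD Fi; have := integrable_sum (P := xpredT) mD l (fun i _ => Fi i).
by apply: eq_integrable => // x _; rewrite /= sumEFin.
Qed.

Lemma Rintegral_sum (D : set X) (I : Type) (l : seq I) (F : I -> X -> R) :
  measurable D -> (forall i, m.-integrable D (EFin \o F i)) ->
  \int[m]_(x in D) (\sum_(i <- l) F i x) = \sum_(i <- l) \int[m]_(x in D) F i x.
Proof.
move=> mD Fi; elim: l => [|i l IH].
  rewrite big_nil; under eq_Rintegral do rewrite big_nil.
  by rewrite /Rintegral integral0.
rewrite big_cons -IH; under eq_Rintegral do rewrite big_cons.
by rewrite RintegralD//; exact: integrable_sumR.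
Qed.

Lemma square_integrable_mul f g : square_integrable f -> square_integrable g ->
  m.-integrable setT (EFin \o (fun x => f x * g x)).
Proof.
move=> [mf fi] [mg gi].
apply: (le_integrableR _ _ (integrableDR fi gi)).
  exact: measurable_funM.
move=> x; rewrite ler_norml; apply/andP; split.
- by have := sqr_ge0 (f x + g x); nra.
- by have := sqr_ge0 (f x - g x); nra.
Qed.

Lemma square_integrable_le f g : measurable_fun setT f ->
  (forall x, `|f x| <= g x) -> square_integrable g -> square_integrable f.
Proof.
move=> mf fg [mg gi]; split => //; apply: (le_integrableR _ _ gi).
  exact: measurable_funX.
move=> x; rewrite ger0_norm ?sqr_ge0//.
by have := fg x; rewrite ler_norml => /andP[]; nra.
Qed.

Lemma square_integrable0 : square_integrable (fun=> 0).
Proof.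
split; first exact: measurable_cst.
by under eq_fun do rewrite expr0n; exact: integrable0.
Qed.

Lemma square_integrableZ k f : square_integrable f ->
  square_integrable (fun x => k * f x).
Proof.
move=> [mf fi]; split; first exact: measurable_funM.
have := integrableZR (k ^+ 2) fi; apply: eq_integrable => // x _ /=.
by rewrite exprMn.
Qed.

Lemma square_integrableD f g : square_integrable f -> square_integrable g ->
  square_integrable (fun x => f x + g x).
Proof.
move=> Lf Lg; split; first by apply: measurable_funD; [case: Lf|case: Lg].
have := integrableDR (integrableDR Lf.2 Lg.2)
  (integrableZR 2 (square_integrable_mul Lf Lg)).
by apply: eq_integrable => // x _ /=; congr EFin; ring.
Qed.

Lemma square_integrable_sum (I : Type) (l : seq I) (F : I -> X -> R) :
  (forall i, square_integrable (F i)) ->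
  square_integrable (fun x => \sum_(i <- l) F i x).
Proof.
move=> Fi; elim: l => [|i l IH].
  by under eq_fun do rewrite big_nil; exact: square_integrable0.
under eq_fun do rewrite big_cons.
exact: square_integrableD.
Qed.

Lemma square_integrable_bounded (M : R) b f : measurable_fun setT b ->
  (forall x, `|b x| <= M) -> square_integrable f ->
  square_integrable (fun x => b x * f x).
Proof.
move=> mb bM Lf; have [mf fi] := square_integrableZ M Lf.
split; first by apply: measurable_funM => //; case: Lf.
apply: (le_integrableR _ _ fi).
  by apply: measurable_funX; apply: measurable_funM => //; case: Lf.
move=> x; rewrite !exprMn normrM (ger0_norm (sqr_ge0 (f x))).
rewrite ler_wpM2r ?sqr_ge0// ger0_norm ?sqr_ge0//.
by have := bM x; rewrite ler_norml => /andP[]; nra.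
Qed.

End square_integrable.

(** * Primitives on the half line *)

Section primitive.
Context {R : realType}.
Local Notation lam := (@lebesgue_measure R).
Implicit Types (f g : R -> R) (t T : R).

(** For negative t this is the integral over the empty interval, that is 0. *)
Definition primitive f t : R := \int[lam]_(s in `[0, t]) f s.

Definition loc_integrable f : Prop :=
  forall t, lam.-integrable `[0, t] (EFin \o f).

Lemma integrable_loc f : lam.-integrable setT (EFin \o f) -> loc_integrable f.
Proof. by move=> fi t; apply: integrableS fi. Qed.

Lemma primitive0 f : primitive f 0 = 0.
Proof. by rewrite /primitive set_itv1 Rintegral_set1. Qed.

Lemma primitive_within f t : loc_integrable f -> 0 <= t ->
  {within `[0, t], continuous (primitive f)}.
Proof. by move=> fi t0; apply: parameterized_integral_continuous. Qed.

Lemma primitive_continuous f t : loc_integrable f -> 0 < t ->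
  {for t, continuous (primitive f)}.
Proof.
move=> fi t0; have t20 : 0 < t + 1 by rewrite addr_gt0.
have := primitive_within fi (ltW t20).
move=> /(continuous_within_itvP _ t20)[+ _ _]; apply.
by rewrite in_itv /= t0 ltrDl ltr01.
Qed.

Lemma within_loc_integrable f :
  (forall t, 0 <= t -> {within `[0, t], continuous f}) -> loc_integrable f.
Proof.
move=> fc t; have [t0|t0] := leP 0 t; last first.
  by rewrite set_itv_ge ?bnd_simp -?ltNge//; exact: integrable_set0.
apply: continuous_compact_integrable; first exact: segment_compact.
exact: fc.
Qed.

Lemma primitive_derive f t : loc_integrable f -> {for t, continuous f} ->
  0 < t -> derivable (primitive f) t 1 /\ (primitive f)^`()%classic t = f t.
Proof.
move=> fi fc t0; apply: (@continuous_FTC1_closed _ f 0 t (t + 1)) => //.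
by rewrite ltrDl ltr01.
Qed.

Lemma primitive_LRcontinuous f t :
  (forall t, 0 <= t -> {within `[0, t], continuous f}) ->
  0 < t -> derivable_oo_LRcontinuous (primitive f) 0 t.
Proof.
move=> fc t0; have fi := within_loc_integrable fc.
have := primitive_within fi (ltW t0).
move=> /(continuous_within_itvP _ t0)[_ cl cr]; split => // x.
rewrite in_itv /= => /andP[x0 xt]; apply: (primitive_derive fi _ x0).1.
have := fc t (ltW t0); move=> /(continuous_within_itvP _ t0)[+ _ _]; apply.
by rewrite in_itv /= x0.
Qed.

(** Integration by parts. It will be applied to the primitives E and J E of the
time fields, where f and g are continuous; the identity is the integrated form
of (F G)' = f G + F g for F, G the primitives of f, g. *)
Lemma primitive_mul f g t :
  (forall t, 0 <= t -> {within `[0, t], continuous f}) ->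
  (forall t, 0 <= t -> {within `[0, t], continuous g}) ->
  0 <= t ->
  primitive f t * primitive g t =
  primitive (fun s => f s * primitive g s) t
  + primitive (fun s => primitive f s * g s) t.
Proof.
move=> fc gc; rewrite le_eqVlt => /predU1P[<-|t0].
  by rewrite !primitive0 mul0r addr0.
have der h : (forall t, 0 <= t -> {within `[0, t], continuous h}) ->
    {in `]0, t[, (primitive h)^`()%classic =1 h}.
  move=> hc x; rewrite in_itv /= => /andP[x0 xt].
  apply: (primitive_derive (within_loc_integrable hc) _ x0).2.
  have := hc t (ltW t0); move=> /(continuous_within_itvP _ t0)[+ _ _]; apply.
  by rewrite in_itv /= x0.
have := Rintegration_by_parts t0 (fc t (ltW t0)) (primitive_LRcontinuous fc t0)
  (der f fc) (gc t (ltW t0)) (primitive_LRcontinuous gc t0) (der g gc).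
rewrite !primitive0 mul0r subr0 => /eqP; rewrite eq_sym subr_eq => /eqP ->.
by rewrite addrC.
Qed.

(** Where the integrand is continuous, it is the derivative of its primitive. *)
Lemma primitive_eq0_continuous f T : loc_integrable f ->
  (forall t, 0 < t -> {for t, continuous f}) ->
  (forall t, 0 < t < T -> primitive f t = 0) ->
  forall t, 0 < t < T -> f t = 0.
Proof.
move=> fi fc f0 t /andP[t0 tT].
have [_ <-] := primitive_derive fi (fc _ t0) t0.
rewrite derive1E (@near_eq_derive _ _ _ _ (cst 0)) ?derive_cst//.
near=> s; rewrite /= f0//; apply/andP; split; near: s.
- exact: lt_nbhsr.
- exact: lt_nbhsl.
Unshelve. all: by end_near. Qed.

(** The same for a merely integrable f, by Lebesgue differentiation: f is the
derivative of its primitive at every Lebesgue point. *)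
Lemma primitive_eq0_ae f T : lam.-integrable setT (EFin \o f) ->
  (forall t, 0 < t < T -> primitive f t = 0) ->
  {ae lam, forall t, 0 < t < T -> f t = 0}.
Proof.
move=> fi f0; have := lebesgue_differentiation (open_integrable_locally openT fi).
apply: filterS; first exact: (ae_filter_ringOfSetsType lam).
move=> t ft /andP[t0 tT].
have [|_ <-] := @FTC1_lebesgue_pt _ f (BLeft 0) t (t + 1) _ (integrable_loc fi _) t0 ft.
  by rewrite ltrDl ltr01.
rewrite derive1E (@near_eq_derive _ _ _ _ (cst 0)) ?derive_cst//.
near=> s; rewrite /= -/(primitive f s) f0//; apply/andP; split; near: s.
- exact: lt_nbhsr.
- exact: lt_nbhsl.
Unshelve. all: by end_near. Qed.

Lemma primitive_le f t : lam.-integrable setT (EFin \o f) ->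
  `|primitive f t| <= \int[lam]_s `|f s|.
Proof.
move=> fi; apply: le_trans (le_normr_Rintegral _ (integrable_loc fi t)) _ => //.
have ni := integrable_norm fi.
rewrite /Rintegral fine_le//; try exact: integrable_fin_num.
  apply: integrable_fin_num => //; exact: (integrable_loc ni).
apply: ge0_subset_integral => //; first exact: measurable_int ni.
Qed.

End primitive.

(** * Gronwall inequality *)

Section gronwall.
Context {R : realType}.
Local Notation lam := (@lebesgue_measure R).

Lemma Rintegral_expR_le (k t : R) : 0 < k -> 0 <= t ->
  \int[lam]_(s in `[0, t]) expR (k * s) <= expR (k * t) / k.
Proof.
move=> k0; rewrite le_eqVlt => /predU1P[<-|t0].
  by rewrite set_itv1 Rintegral_set1 divr_ge0 ?expR_ge0 ?ltW.
have dF (x : R) : is_derive x 1 (fun s => expR (k * s) / k) (expR (k * x)).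
  have -> : (fun s => expR (k * s) / k) = k^-1 *: (fun s => expR (k * s)).
    by apply/funext => s; rewrite mulrC.
  apply: is_derive_eq.
  by rewrite /GRing.scale /= mulr1 mulrCA mulVf ?mulr1// gt_eqF.
have cF (x : R) : {for x, continuous (fun s : R => expR (k * s) / k)}.
  by apply: differentiable_continuous; apply/derivable1_diffP; have [] := dF x.
rewrite /Rintegral (@continuous_FTC2 _ _ (fun s => expR (k * s) / k))//=.
- by rewrite gerBl divr_ge0 ?expR_ge0// ltW.
- apply: continuous_subspaceT => x; apply: (continuous_comp (g := expR)).
    exact: mulrl_continuous.
  exact: continuous_expR.
- split.
  + by move=> x _; have [] := dF x.
  + apply: cvg_at_right_filter; exact: (cF 0).
  + apply: cvg_at_left_filter; exact: (cF t).
- by move=> x _; rewrite derive1E; have [_ ->] := dF x.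
Qed.

(** Only boundedness and measurability of g are available here, so the proof
compares g with an exponential instead of differentiating. Let S be the
supremum of g t / exp (2 K t). The integral inequality bounds g t by
K S (exp (2 K t)) / (2 K), whence S <= S / 2, and S = 0. *)
Lemma gronwall_eq0 (g : R -> R) (T B K : R) : 0 < K -> measurable_fun setT g ->
  (forall t : R, 0 <= t <= T -> 0 <= g t <= B) ->
  (forall t : R, 0 <= t <= T -> g t <= K * \int[lam]_(s in `[0, t]) g s) ->
  forall t : R, 0 <= t <= T -> g t = 0.
Proof.
move=> K0 mg gB gK t0 t0T.
pose k := 2 * K; have k0 : 0 < k by rewrite mulr_gt0.
pose A := [set y | exists2 t : R, 0 <= t <= T & y = g t / expR (k * t)].
have A0 : A !=set0 by exists (g t0 / expR (k * t0)); exists t0.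
have Aub : has_ubound A.
  exists B => _ [t tT ->]; have /andP[gt0 gtB] := gB t tT.
  rewrite ler_pdivrMr ?expR_gt0// (le_trans gtB)// ler_peMr ?(le_trans gt0)//.
  by rewrite -[leLHS]expR0 ler_expR mulr_ge0 ?(ltW k0)//; case/andP: tT.
have gS t : 0 <= t <= T -> g t <= sup A * expR (k * t).
  move=> tT; rewrite -ler_pdivrMr ?expR_gt0//; apply: ub_le_sup => //.
  by exists t.
have S0 : 0 <= sup A.
  apply: le_trans (ub_le_sup Aub (_ : A (g t0 / expR (k * t0)))).
    by rewrite divr_ge0 ?expR_ge0//; case/andP: (gB t0 t0T).
  by exists t0.
have ie t : lam.-integrable `[0, t] (EFin \o (fun s => expR (k * s))).
  apply: continuous_compact_integrable; first exact: segment_compact.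
  apply: continuous_subspaceT => x; apply: (continuous_comp (g := expR)).
    exact: mulrl_continuous.
  exact: continuous_expR.
(* The exponent 2 K is chosen to gain the factor one half. *)
have SS : sup A <= sup A / 2.
  apply: ge_sup => // _ [t tT ->]; have /andP[t_ge0 tleT] := tT.
  rewrite ler_pdivrMr ?expR_gt0// (le_trans (gK t tT))//.
  rewrite mulrAC -mulrA -ler_pdivlMl//.
  have -> : K^-1 * (sup A * (expR (k * t) / 2)) = sup A * (expR (k * t) / k).
    by rewrite /k; field; rewrite gt_eqF.
  apply: le_trans (ler_wpM2l S0 (Rintegral_expR_le k0 t_ge0)).
  rewrite -RintegralZl//; apply: le_Rintegral => //.
  - apply: measurable_bounded_integrable => //.
    + by rewrite /= lebesgue_measure_itv /=; case: ifPn => // _; rewrite -EFinB ltry.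
    + exact: measurable_funTS.
    + exists B; split; first exact: num_real.
      move=> y By s /=; rewrite in_itv /= => /andP[s0 st].
      have /andP[gs0 gsB] : 0 <= g s <= B by apply: gB; rewrite s0 (le_trans st).
      by rewrite ger0_norm// (le_trans gsB)// ltW.
  - by apply: eq_integrable (integrableZl _ (sup A) (ie t)).
  - move=> s /=; rewrite in_itv /= => /andP[s0 st].
    by apply: gS; rewrite s0 (le_trans st).
apply/eqP; rewrite eq_le; have /andP[-> _] := gB t0 t0T; rewrite andbT.
have S_le0 : sup A <= 0 by lra.
by rewrite (le_trans (gS t0 t0T))// mulr_le0_ge0// expR_ge0.
Qed.

End gronwall.

(** * Primitives in time of fields on a cylinder *)

Lemma measurable_ge0_set d (Y : measurableType d) (R : realType) (g : Y -> R) :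
  measurable_fun setT g -> measurable [set y | 0 <= g y].
Proof.
move=> mg; rewrite [X in measurable X](_ : _ = setT `&` g @^-1` `[0, +oo[).
  by apply: mg => //; exact: measurable_itv.
by rewrite setTI; apply/seteqP; split => y /=; rewrite in_itv /= andbT.
Qed.

Section time_primitives.
Context d (X : measurableType d) {R : realType}.
Variable m : {sigma_finite_measure set X -> \bar R}.
Variable T : R.
Hypothesis T0 : 0 < T.
Local Notation lam := (@lebesgue_measure R).
Local Notation mlam := (m \x lam)%E.
Implicit Type f : X * measurableTypeR R -> R.

Definition time_primitive f : X * measurableTypeR R -> R :=
  fun p => primitive (fun s => f (p.1, s)) p.2.

(** The primitive is a partial integral of f times the indicator of the
measurable region 0 <= s <= t, so Tonelli's theorem gives its measurability in
(x, t) jointly. *)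
Lemma measurable_time_primitive f : measurable_fun setT f ->
  measurable_fun setT (time_primitive f).
Proof.
move=> mf; pose D := [set q : (X * measurableTypeR R) * measurableTypeR R |
  0 <= q.2] `&` [set q | 0 <= q.1.2 - q.2].
have mD : measurable D.
  have m1 : measurable_fun setT
      (fun q : (X * measurableTypeR R) * measurableTypeR R => q.2).
    exact: measurable_snd.
  have m2 : measurable_fun setT
      (fun q : (X * measurableTypeR R) * measurableTypeR R => q.1.2).
    exact: (measurableT_comp measurable_snd measurable_fst).
  apply: measurableI.
  - exact: measurable_ge0_set.
  - by apply: measurable_ge0_set; exact: measurable_funB.
have -> : time_primitive f = fun p => \int[lam]_s (f (p.1, s) * \1_D (p, s)).
  apply/funext => -[x t]; rewrite /time_primitive /primitive Rintegral_mkcond.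
  apply: eq_Rintegral => s _ /=; rewrite patchE indicE /D /=.
  case: ifPn => [/set_mem /=|/negP st].
    by rewrite in_itv /= => st; rewrite mem_set ?mulr1//= subr_ge0; apply/andP.
  rewrite memNset ?mulr0// => -[/= s0]; rewrite subr_ge0 => ts; apply: st.
  by apply/mem_set; rewrite /= in_itv /= s0.
apply: (@measurable_Rintegral_snd _ _ _ _ _ lam
  (fun q : (X * measurableTypeR R) * measurableTypeR R =>
     f (q.1.1, q.2) * \1_D q)).
apply: measurable_funM; last exact: measurable_indic.
apply: (measurableT_comp mf); apply: measurable_fun_pair => //=.
exact: (measurableT_comp measurable_fst measurable_fst).
Qed.

(** Square integrability of a section is required for every x and not only for
almost every x: primitives of such an f are then genuine primitives,
continuous in t, at each point x. *)
Definition time_field f : Prop :=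
  [/\ measurable_fun setT f,
      forall x (s : R), ~~ (0 < s < T) -> f (x, s) = 0,
      forall x, lam.-integrable setT (EFin \o (fun s => f (x, s) ^+ 2)) &
      mlam.-integrable setT (EFin \o (fun p => f p ^+ 2))].

Lemma measurable_time_section f x : measurable_fun setT f ->
  measurable_fun setT (fun s => f (x, s)).
Proof. by move=> mf; exact: (measurableT_comp mf). Qed.

Lemma integrable_indic_time : lam.-integrable setT (EFin \o \1_(`[0, T]%classic : set R)).
Proof. exact: (integrable_indic_itv 0 T true false). Qed.

Lemma Rintegral_indic_time : \int[lam]_s (\1_(`[0, T]%classic : set R) s) = T.
Proof.
rewrite /Rintegral integral_indic// setIT /= lebesgue_measure_itv /= lte_fin T0.
by rewrite -EFinB subr0.
Qed.

Lemma integrable_time_section f x : time_field f ->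
  lam.-integrable setT (EFin \o (fun s => f (x, s))).
Proof.
move=> [mf f0 f2 _]; have := integrableDR integrable_indic_time (f2 x).
apply: le_integrableR; first exact: measurable_time_section.
move=> s; rewrite indicE; have [sT|sT] := boolP (0 < s < T); last first.
  by rewrite f0// normr0 expr0n addr0.
rewrite mem_set /=; last by case/andP: sT => ? ?; rewrite in_itv /= !ltW.
rewrite ler_norml; have := sqr_ge0 (f (x, s) + 1); have := sqr_ge0 (f (x, s) - 1).
by move=> ? ?; apply/andP; split; nra.
Qed.

(** A majorant, uniform in t, of the primitive of f; by the Cauchy-Schwarz
inequality it is square integrable in x, which dominates all the integrals
that follow. *)
Definition time_mass f (x : X) : R := \int[lam]_s `|f (x, s)|.

Lemma time_mass_ge0 f x : 0 <= time_mass f x.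
Proof. by apply: Rintegral_ge0 => s _. Qed.

(** The Cauchy-Schwarz inequality on ]0, T[. *)
Lemma time_mass_sqr f x : time_field f ->
  time_mass f x ^+ 2 <= T * \int[lam]_s (f (x, s) ^+ 2).
Proof.
move=> tf; have [mf f0 f2 _] := tf; set N := time_mass f x; pose a := N / T.
have ni := integrable_norm (integrable_time_section x tf).
(* Integrate 2 a |f| <= a ^ 2 + f ^ 2; the best a is the mean N / T of |f|. *)
have : 2 * a * N <= a ^+ 2 * T + \int[lam]_s (f (x, s) ^+ 2).
  rewrite -Rintegral_indic_time -RintegralZl//; last exact: integrable_indic_time.
  rewrite -RintegralD//; last exact: integrableZR integrable_indic_time.
  rewrite /N /time_mass -RintegralZl//; apply: le_Rintegral => //.
  - exact: integrableZR.
  - by apply: integrableDR => //; exact: integrableZR integrable_indic_time.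
  - move=> s _; rewrite indicE; have [sT|sT] := boolP (0 < s < T); last first.
      by rewrite f0// normr0 expr0n mulr0 addr0 mulr_ge0 ?sqr_ge0.
    rewrite mem_set /=; last by case/andP: sT => ? ?; rewrite in_itv /= !ltW.
    rewrite -(@real_normK _ (f (x, s))) ?num_real//.
    by have := sqr_ge0 (a - `|f (x, s)|); nra.
have aT : a * T = N by rewrite /a divfK// gt_eqF.
rewrite -aT => h; have -> : (a * T) ^+ 2 = T * (a ^+ 2 * T) by ring.
by rewrite ler_wpM2l ?(ltW T0)//; lra.
Qed.

Lemma square_integrable_time_mass f : time_field f ->
  square_integrable m (time_mass f).
Proof.
move=> tf; have [mf f0 f2 fi] := tf; split.
  apply: (@measurable_Rintegral_snd _ _ _ _ _ lam (fun p => `|f p|)).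
  exact: measurableT_comp.
have mm : measurable_fun setT (time_mass f).
  apply: (@measurable_Rintegral_snd _ _ _ _ _ lam (fun p => `|f p|)).
  exact: measurableT_comp.
apply: (le_integrableR _ _ (integrableZR T (integrable_Rintegral_snd fi))).
  exact: measurable_funX.
by move=> x; rewrite ger0_norm ?sqr_ge0//; exact: time_mass_sqr.
Qed.

Lemma time_primitive_le f p : time_field f ->
  `|time_primitive f p| <= time_mass f p.1.
Proof. by move=> tf; apply: primitive_le; exact: integrable_time_section. Qed.

Lemma time_primitive_within f x (t : R) : time_field f -> 0 <= t ->
  {within `[0, t], continuous (fun s : R => time_primitive f (x, s))}.
Proof.
move=> tf t0; have fi := integrable_loc (integrable_time_section x tf).
exact: (primitive_within fi t0).
Qed.

Lemma time_primitive2_le f x (t : R) : time_field f -> 0 <= t <= T ->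
  `|time_primitive (time_primitive f) (x, t)| <= T * time_mass f x.
Proof.
move=> tf /andP[t0 tT].
have Ji : loc_integrable (fun s => time_primitive f (x, s)).
  by apply: within_loc_integrable => s; exact: time_primitive_within.
apply: le_trans (le_normr_Rintegral _ (Ji t)) _ => //=.
apply: (@le_trans _ _ (\int[lam]_(s in `[0, t]) time_mass f x)).
  apply: le_Rintegral => //.
  - exact: integrable_norm.
  - apply: measurable_bounded_integrable => //.
    + by rewrite /= lebesgue_measure_itv /=; case: ifPn => // _; rewrite -EFinB ltry.
    + exists (time_mass f x); split; first exact: num_real.
      move=> y xy s _; apply: le_trans (ltW xy).
      by rewrite ger0_norm// time_mass_ge0.
  - by move=> s _; exact: (@time_primitive_le f (x, s)).
rewrite Rintegral_cst//= lebesgue_measure_itv /= lte_fin.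
case: ifPn => _ /=; last by rewrite mulr0 mulr_ge0 ?time_mass_ge0// ltW.
by rewrite subr0 mulrC ler_wpM2r ?time_mass_ge0.
Qed.

Lemma square_integrable_primitive f (t : R) : time_field f ->
  square_integrable m (fun x => time_primitive f (x, t)).
Proof.
move=> tf; have [mf _ _ _] := tf.
apply: square_integrable_le (square_integrable_time_mass tf).
  exact: (measurableT_comp (measurable_time_primitive mf)).
by move=> x; exact: (@time_primitive_le f (x, t)).
Qed.

Lemma square_integrable_primitive2 f (t : R) : time_field f -> 0 <= t <= T ->
  square_integrable m (fun x => time_primitive (time_primitive f) (x, t)).
Proof.
move=> tf tT; have [mf _ _ _] := tf.
apply: square_integrable_le (square_integrableZ T (square_integrable_time_mass tf)).
  apply: (measurableT_comp (measurable_time_primitive _)) => //.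
  exact: measurable_time_primitive.
by move=> x; exact: time_primitive2_le.
Qed.

End time_primitives.

Section tensor.
Context d1 d2 (X : measurableType d1) (Y : measurableType d2) {R : realType}.
Variables (m1 : {sigma_finite_measure set X -> \bar R})
          (m2 : {sigma_finite_measure set Y -> \bar R}).

Lemma integrable_tensor (h : X -> R) (k : Y -> R) :
  m1.-integrable setT (EFin \o h) -> m2.-integrable setT (EFin \o k) ->
  (m1 \x m2)%E.-integrable setT (EFin \o (fun p => h p.1 * k p.2)).
Proof.
move=> hi ki; have mh := measurable_int _ hi; have mk := measurable_int _ ki.
have mhk : measurable_fun setT (EFin \o (fun p : X * Y => h p.1 * k p.2)).
  apply/measurable_EFinP; apply: measurable_funM.
  - by apply: (measurableT_comp (f := h)) => //; exact/measurable_EFinP.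
  - by apply: (measurableT_comp (f := k)) => //; exact/measurable_EFinP.
apply/integrable12ltyP => //=.
have -> : (fun x => \int[m2]_y `|(h x * k y)%:E|)%E =
    (fun x => (`|(h x)%:E| * \int[m2]_y `|(k y)%:E|)%E).
  apply/funext => x; rewrite -ge0_integralZl//.
  - by apply: eq_integral => y _; rewrite EFinM abseM.
  - exact: measurableT_comp.
have /integrableP[_ hoo] := hi; have /integrableP[_ koo] := ki.
rewrite ge0_integralZr//=; last 2 first.
- by apply/measurable_EFinP; apply: measurableT_comp => //; exact/measurable_EFinP.
- exact: integral_ge0.
apply: lte_mul_pinfty => //; first exact: integral_ge0.
by rewrite ge0_fin_numE// integral_ge0.
Qed.

End tensor.

Section vanishing.
Context d (X : measurableType d) {R : realType}.
Variable m : {sigma_finite_measure set X -> \bar R}.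
Variable T : R.
Hypothesis T0 : 0 < T.
Local Notation lam := (@lebesgue_measure R).
Local Notation mlam := (m \x lam)%E.

Lemma integrable_time_bound (F : X * measurableTypeR R -> R) (h : X -> R) :
  measurable_fun setT F -> m.-integrable setT (EFin \o h) ->
  (forall x (s : R), 0 <= s <= T -> `|F (x, s)| <= h x) ->
  forall t : R, 0 <= t <= T ->
  mlam.-integrable setT (EFin \o (fun p => F p * \1_(`[0, t]%classic : set R) p.2)).
Proof.
move=> mF hi Fh t /andP[t0 tT].
have ti : lam.-integrable setT (EFin \o \1_(`[0, t]%classic : set R)).
  exact: (integrable_indic_itv 0 t true false).
apply: le_integrableR (integrable_tensor hi ti).
  apply: measurable_funM => //.
  have mI : measurable_fun (setT : set (measurableTypeR R))
    (\1_(`[0, t]%classic : set (measurableTypeR R)) : _ -> R).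
    exact: measurable_indic.
  exact: (measurableT_comp mI measurable_snd).
move=> [x s] /=; rewrite indicE; case: (boolP (s \in _)) => [|_]; last first.
  by rewrite !mulr0 normr0.
by move=> /set_mem /=; rewrite in_itv /= !mulr1 => /andP[s0 st]; apply: Fh; rewrite s0 (le_trans st).
Qed.

Lemma Rintegral_indic_itv (g : R -> R) (t : R) :
  \int[lam]_s (g s * \1_(`[0, t]%classic : set R) s) = \int[lam]_(s in `[0, t]) g s.
Proof.
rewrite [RHS]Rintegral_mkcond; apply: eq_Rintegral => s _.
by rewrite patchE indicE; case: ifPn => _; rewrite ?mulr1 ?mulr0.
Qed.

(** Fubini's theorem on the strip [0, t], for an integrand dominated by a
function of x alone. *)
Lemma Rintegral_time_swap (F : X * measurableTypeR R -> R) (h : X -> R) :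
  measurable_fun setT F -> m.-integrable setT (EFin \o h) ->
  (forall x (s : R), 0 <= s <= T -> `|F (x, s)| <= h x) ->
  forall t : R, 0 <= t <= T ->
  \int[m]_x time_primitive F (x, t) =
  \int[lam]_(s in `[0, t]) \int[m]_x F (x, s).
Proof.
move=> mF hi Fh t tT; have Fi := integrable_time_bound mF hi Fh tT.
have := Rintegral_prod12 Fi; rewrite (Rintegral_prod21 Fi) /= => E.
transitivity (\int[m]_x \int[lam]_s (F (x, s) * \1_(`[0, t]%classic : set R) s)).
  by apply: eq_Rintegral => x _; rewrite Rintegral_indic_itv.
rewrite -E -Rintegral_indic_itv; apply: eq_Rintegral => s _.
rewrite indicE; case: (boolP (s \in _)) => _ /=.
  by rewrite mulr1; under eq_Rintegral do rewrite mulr1.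
by rewrite mulr0; under eq_Rintegral do rewrite mulr0; rewrite Rintegral_cst// mul0r.
Qed.

(** If the second primitive V of f vanishes in L^2 at each time, then the
integral of V(x, .) ^ 2 over [0, T] is 0 for almost every x. At such an x,
V(x, .) is continuous, hence zero, so is its derivative, the continuous first
primitive, and f(x, .) is zero almost everywhere. *)
Lemma time_field_eq0 (f : X * measurableTypeR R -> R) : time_field m T f ->
  (forall t : R, 0 <= t <= T ->
     \int[m]_x (time_primitive (time_primitive f) (x, t) ^+ 2) = 0) ->
  {ae mlam, forall p, f p = 0}.
Proof.
move=> tf V0; have [mf f0 f2 fi] := tf.
set U := time_primitive f; set V := time_primitive U.
have mU : measurable_fun setT U by exact: measurable_time_primitive.
have mV : measurable_fun setT V by exact: measurable_time_primitive.
have mV2 : measurable_fun setT (fun p => V p ^+ 2) by exact: measurable_funX.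
have Uc x (t : R) : 0 <= t -> {within `[0, t], continuous (fun s : R => U (x, s))}.
  by move=> t_ge0; exact: (time_primitive_within tf t_ge0).
have Ui x : loc_integrable (fun s : R => U (x, s)).
  by apply: within_loc_integrable => t t_ge0; exact: Uc.
have Ucont x (t : R) : 0 < t -> {for t, continuous (fun s : R => U (x, s))}.
  by move=> t_gt0; exact: (primitive_continuous (integrable_loc (integrable_time_section x tf)) t_gt0).
have Vcont x (t : R) : 0 < t -> {for t, continuous (fun s : R => V (x, s))}.
  by move=> t_gt0; exact: (primitive_continuous (Ui x) t_gt0).
have V2c x (t : R) : 0 < t -> {for t, continuous (fun s : R => V (x, s) ^+ 2)}.
  by move=> t_gt0; apply: continuousM; exact: Vcont.
have V2i x : loc_integrable (fun s : R => V (x, s) ^+ 2).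
  apply: within_loc_integrable => t t_ge0.
  have /subspace_continuousP Vw := primitive_within (Ui x) t_ge0.
  apply/subspace_continuousP => s st.
  exact: (cvgM (Vw s st) (Vw s st)).
have Vh x (s : R) : 0 <= s <= T -> `|V (x, s) ^+ 2| <= (T * time_mass f x) ^+ 2.
  move=> sT; have := time_primitive2_le T0 x tf sT; rewrite -/U -/V.
  by rewrite ler_norml ger0_norm ?sqr_ge0// => /andP[]; nra.
have hi : m.-integrable setT (EFin \o (fun x => (T * time_mass f x) ^+ 2)).
  by have [] := square_integrableZ T (square_integrable_time_mass T0 tf).
have TT : 0 <= T <= T by rewrite lexx ltW.
have W0 : \int[m]_x time_primitive (fun p => V p ^+ 2) (x, T) = 0.
  rewrite (Rintegral_time_swap mV2 hi Vh TT).
  rewrite (@eq_Rintegral _ _ _ _ _ (cst 0)).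
    by rewrite Rintegral_cst// mul0r.
  by move=> s /set_mem /=; rewrite in_itv /=; exact: V0.
have mW : measurable_fun setT (fun x => time_primitive (fun p => V p ^+ 2) (x, T)).
  exact: (measurableT_comp (measurable_time_primitive mV2)).
have W_ge0 x (t : R) : 0 <= time_primitive (fun p => V p ^+ 2) (x, t).
  by apply: Rintegral_ge0 => s _; exact: sqr_ge0.
have Wi : m.-integrable setT (EFin \o (fun x => time_primitive (fun p => V p ^+ 2) (x, T))).
  apply: le_integrableR (integrableZR T hi) => // x.
  rewrite ger0_norm//; apply: (@le_trans _ _ (\int[lam]_(s in `[0, T]) (T * time_mass f x) ^+ 2)).
    apply: le_Rintegral => //.
    - exact: (V2i x T).
    - apply: measurable_bounded_integrable => //.
      + by rewrite /= lebesgue_measure_itv /=; case: ifPn => // _; rewrite -EFinB ltry.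
      + exists ((T * time_mass f x) ^+ 2); split; first exact: num_real.
        by move=> y xy s _; apply: le_trans (ltW xy); rewrite ger0_norm// sqr_ge0.
    - move=> s; rewrite /= in_itv /= => sT; apply: le_trans (Vh x s sT).
      exact: ler_norm.
  by rewrite Rintegral_cst//= lebesgue_measure_itv /= lte_fin T0 /= subr0 mulrC.
have Wae : {ae m, forall x, time_primitive (fun p => V p ^+ 2) (x, T) = 0}.
  have : (\int[m]_x `|(time_primitive (fun p => V p ^+ 2) (x, T))%:E|)%E = 0%E.
    transitivity (\int[m]_x (time_primitive (fun p => V p ^+ 2) (x, T))%:E)%E.
      by apply: eq_integral => x _; rewrite gee0_abs// lee_fin.
    by rewrite -[LHS]fineK ?(integrable_fin_num _ Wi)//; congr EFin.
  move/ae_eq_integral_abs => -/(_ measurableT).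
  have mEW : measurable_fun setT (fun x => (time_primitive (fun p => V p ^+ 2) (x, T))%:E).
    exact/measurable_EFinP.
  move=> /(_ mEW); apply: filterS => x /= /(_ I) => E.
  by case: E.
have f_ae x : time_primitive (fun p => V p ^+ 2) (x, T) = 0 ->
    (\int[lam]_s ((f (x, s)) ^+ 2)%:E)%E = 0%E.
  move=> Wx.
  have W0t t : 0 < t < T -> primitive (fun s => V (x, s) ^+ 2) t = 0.
    move=> /andP[t0 tT]; apply/eqP; rewrite eq_le (W_ge0 x t) andbT.
    rewrite -Wx /time_primitive /primitive /=.
    rewrite /Rintegral fine_le ?integrable_fin_num//; try exact: V2i.
    apply: ge0_subset_integral => //=.
    - by have := measurable_int _ (V2i x T).
    - by move=> s _; rewrite lee_fin sqr_ge0.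
    - by apply: subset_itvl; rewrite bnd_simp ltW.
  have V2_0 := primitive_eq0_continuous (V2i x) (V2c x) W0t.
  have V_0 t : 0 < t < T -> primitive (fun s => U (x, s)) t = 0.
    by move=> /V2_0/eqP; rewrite sqrf_eq0 => /eqP.
  have U_0 := primitive_eq0_continuous (Ui x) (Ucont x) V_0.
  have := primitive_eq0_ae (integrable_time_section x tf) U_0.
  move=> f_0; rewrite -[RHS](@integral0 _ _ _ lam setT).
  apply: ae_eq_integral => //.
    apply/measurable_EFinP; apply: measurable_funX.
    exact: measurable_time_section.
  move: f_0; apply: filterS; first exact: (ae_filter_ringOfSetsType lam).
  move=> s fs _ /=; have [/fs->|/f0->] := boolP (0 < s < T).
    by rewrite expr0n.
  by rewrite expr0n.
have : (\int[mlam]_p ((f p) ^+ 2)%:E)%E = 0%E.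
  rewrite fubini_tonelli1//=; last 2 first.
  - exact/measurable_EFinP/measurable_funX.
  - by move=> p; rewrite lee_fin sqr_ge0.
  rewrite -[RHS](@integral0 _ _ _ m setT); apply: ae_eq_integral => //.
  - apply: (measurable_integral_snd lam (g := fun p => (f p ^+ 2)%:E)).
    exact/measurable_EFinP/measurable_funX.
  - by apply: filterS Wae => x /f_ae + _; exact.
move=> If; have : (\int[mlam]_p `|((f p) ^+ 2)%:E|)%E = 0%E.
  by rewrite -If; apply: eq_integral => p _; rewrite gee0_abs// lee_fin sqr_ge0.
move/ae_eq_integral_abs => -/(_ measurableT).
have mEf : measurable_fun setT (fun p => (f p ^+ 2)%:E).
  exact/measurable_EFinP/measurable_funX.
move=> /(_ mEf); apply: filterS => p /= /(_ I) [] /eqP.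
by rewrite sqrf_eq0 => /eqP.
Qed.

End vanishing.

(** * The energy argument *)

Section energy.
Context d (X : measurableType d) {R : realType}.
Variable m : {sigma_finite_measure set X -> \bar R}.
Variable T : R.
Hypothesis T0 : 0 < T.
Local Notation lam := (@lebesgue_measure R).
Local Notation mlam := (m \x lam)%E.
Variables (I : finType) (a b : I -> I -> X -> R) (u : I -> X * measurableTypeR R -> R).
Variables (M c : R).
Hypotheses (M0 : 0 <= M) (c0 : 0 < c).
Hypotheses (ma : forall i j, measurable_fun setT (a i j))
           (mb : forall i j, measurable_fun setT (b i j))
           (aM : forall i j x, `|a i j x| <= M)
           (bM : forall i j x, `|b i j x| <= M)
           (a_sym : forall i j x, a i j x = a j i x)
           (a_coercive : forall x (xi : I -> R),
              c * \sum_i xi i ^+ 2 <= \sum_i \sum_j a i j x * xi j * xi i)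
           (tu : forall i, time_field m T (u i)).
Let U i := time_primitive (u i).
Let V i := time_primitive (U i).
Hypothesis balance : forall t : R, 0 <= t <= T ->
  \int[m]_x (\sum_i \sum_j (a i j x * U j (x, t) * V i (x, t)
                           + b i j x * V j (x, t) * V i (x, t))) = 0.

(* Q is the density of the energy, q that of half its time derivative, r the
lower-order term, and h dominates all three uniformly in time. *)
Let Q p : R := \sum_i \sum_j a i j p.1 * V j p * V i p.
Let q p : R := \sum_i \sum_j a i j p.1 * U j p * V i p.
Let r p : R := \sum_i \sum_j b i j p.1 * V j p * V i p.
Let h x : R := \sum_i \sum_j M * (1 + T) ^+ 2 * (time_mass (u j) x * time_mass (u i) x).

Let mU i : measurable_fun setT (U i).
Proof. by apply: measurable_time_primitive; case: (tu i). Qed.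
Let mV i : measurable_fun setT (V i).
Proof. exact: measurable_time_primitive. Qed.

Let mquad (e : I -> I -> X -> R) (f g : I -> X * measurableTypeR R -> R) :
  (forall i j, measurable_fun setT (e i j)) ->
  (forall i, measurable_fun setT (f i)) -> (forall i, measurable_fun setT (g i)) ->
  measurable_fun setT (fun p => \sum_i \sum_j e i j p.1 * f j p * g i p).
Proof.
move=> me mf mg; apply: measurable_sum => i; apply: measurable_sum => j.
by apply: measurable_funM => //; apply: measurable_funM => //; exact: (measurableT_comp (me i j)).
Qed.

Let hi : m.-integrable setT (EFin \o h).
Proof.
apply: integrable_sumR => // i; apply: integrable_sumR => // j.
by apply: integrableZR; apply: square_integrable_mul; exact: (square_integrable_time_mass T0).
Qed.

Let quad_le (e : I -> I -> X -> R) (f g : I -> R) x : (forall i j, `|e i j x| <= M) ->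
  (forall i, `|f i| <= (1 + T) * time_mass (u i) x) ->
  (forall i, `|g i| <= (1 + T) * time_mass (u i) x) ->
  `|\sum_i \sum_j e i j x * f j * g i| <= h x.
Proof.
move=> eM fM gM; apply: le_trans (ler_norm_sum _ _ _) _; apply: ler_sum => i _.
apply: le_trans (ler_norm_sum _ _ _) _; apply: ler_sum => j _.
have -> : M * (1 + T) ^+ 2 * (time_mass (u j) x * time_mass (u i) x) =
  M * ((1 + T) * time_mass (u j) x) * ((1 + T) * time_mass (u i) x) by ring.
by rewrite !normrM !ler_pM ?mulr_ge0.
Qed.

Let U_le i x t : `|U i (x, t)| <= (1 + T) * time_mass (u i) x.
Proof.
apply: le_trans (time_primitive_le (x, t) (tu i)) _ => /=.
by rewrite ler_peMl ?time_mass_ge0// lerDl ltW.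
Qed.

Let V_le i x t : 0 <= t <= T -> `|V i (x, t)| <= (1 + T) * time_mass (u i) x.
Proof.
move=> tT; apply: le_trans (time_primitive2_le T0 x (tu i) tT) _ => /=.
by rewrite ler_wpM2r ?time_mass_ge0// lerDr.
Qed.

Let Ui i x : loc_integrable (fun s : R => U i (x, s)).
Proof.
apply: within_loc_integrable => t t_ge0; exact: (time_primitive_within (tu i) t_ge0).
Qed.

Let UV_loc i j x : loc_integrable (fun s : R => U j (x, s) * V i (x, s)).
Proof.
apply: within_loc_integrable => t t_ge0.
have /subspace_continuousP Vw := primitive_within (Ui i x) t_ge0.
have /subspace_continuousP Uw := time_primitive_within (x := x) (tu j) t_ge0.
by apply/subspace_continuousP => s st; exact: (cvgM (Uw s st) (Vw s st)).
Qed.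

Let primitive_scale (e : R) (f : R -> R) t : loc_integrable f ->
  primitive (fun s => e * f s) t = e * primitive f t.
Proof. by move=> fi; rewrite /primitive RintegralZl. Qed.

Let primitive_sum (f : I -> R -> R) t : (forall i, loc_integrable (f i)) ->
  primitive (fun s => \sum_i f i s) t = \sum_i primitive (f i) t.
Proof.
move=> fi; rewrite /primitive.
by rewrite Rintegral_sum// => i; exact: fi.
Qed.
Let loc_scale (e : R) (f : R -> R) : loc_integrable f -> loc_integrable (fun s => e * f s).
Proof. by move=> fi t; apply: eq_integrable (integrableZl _ e (fi t)). Qed.

Let loc_sum (f : I -> R -> R) : (forall i, loc_integrable (f i)) ->
  loc_integrable (fun s => \sum_i f i s).
Proof. by move=> fi t; apply: integrable_sumR => // i; exact: fi. Qed.

(* The derivative of a V V is 2 a U V because a is symmetric. *)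
Let Q_eq x (t : R) : 0 <= t -> Q (x, t) = 2 * time_primitive q (x, t).
Proof.
move=> t0; pose W i j := primitive (fun s : R => U j (x, s) * V i (x, s)) t.
have VV i j : V j (x, t) * V i (x, t) = W i j + W j i.
  have Uc k (s : R) : 0 <= s -> {within `[0, s], continuous (fun s : R => U k (x, s))}.
    by move=> s0; exact: (time_primitive_within (tu k) s0).
  have -> := primitive_mul (Uc j) (Uc i) t0.
  by congr (_ + _); apply: eq_Rintegral => s _; rewrite mulrC.
have -> : time_primitive q (x, t) = \sum_i \sum_j a i j x * W i j.
  rewrite /time_primitive /q /=.
  rewrite [LHS](_ : _ = primitive (fun s : R => \sum_i \sum_j a i j x * (U j (x, s) * V i (x, s))) t); last first.
    apply: eq_Rintegral => s _ /=; apply: eq_bigr => i _; apply: eq_bigr => j _.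
    by rewrite mulrA.
  have aUV i j : loc_integrable (fun s : R => a i j x * (U j (x, s) * V i (x, s))).
    by apply: loc_scale; exact: UV_loc.
  rewrite primitive_sum => [|i]; last exact: loc_sum.
  by apply: eq_bigr => i _; rewrite primitive_sum//; apply: eq_bigr => j _; rewrite primitive_scale.
rewrite mulr2n mulrDl mul1r {2}exchange_big -big_split /=.
apply: eq_bigr => i _; rewrite -big_split /=; apply: eq_bigr => j _.
by rewrite -mulrA VV mulrDr (a_sym j i).
Qed.

Let C := 2 * #|I|%:R * M / c.

(* Young's inequality, then coercivity. *)
Let r_le x (t : R) : `|r (x, t)| <= C * Q (x, t).
Proof.
have rle : `|r (x, t)| <= 2 * #|I|%:R * M * \sum_i V i (x, t) ^+ 2.
  apply: (@le_trans _ _ (\sum_i \sum_j M * (V i (x, t) ^+ 2 + V j (x, t) ^+ 2))).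
    apply: le_trans (ler_norm_sum _ _ _) _; apply: ler_sum => i _.
    apply: le_trans (ler_norm_sum _ _ _) _; apply: ler_sum => j _ /=.
    rewrite -mulrA normrM ler_pM// ler_norml.
    have := sqr_ge0 (V j (x, t) - V i (x, t)); have := sqr_ge0 (V j (x, t) + V i (x, t)).
    by move=> ? ?; apply/andP; split; nra.
  under eq_bigr => i _ do rewrite -mulr_sumr big_split /= sumr_const.
  rewrite -mulr_sumr big_split /= sumr_const -sumrMnl.
  rewrite le_eqVlt; apply/orP; left; apply/eqP.
  set S := \sum_i V i (x, t) ^+ 2.
  rewrite sumrMnl -/S -mulr_natl; ring.
apply: le_trans rle _.
have := a_coercive x (fun i => V i (x, t)); rewrite -/(Q (x, t)) => cQ.
rewrite /C -[leRHS]mulrA ler_wpM2l ?mulr_ge0//.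
by rewrite ler_pdivlMl.
Qed.

Let mq : measurable_fun setT q. Proof. exact: mquad. Qed.
Let mQ : measurable_fun setT Q. Proof. exact: mquad. Qed.
Let mr : measurable_fun setT r. Proof. exact: mquad. Qed.

Let q_h x (t : R) : 0 <= t <= T -> `|q (x, t)| <= h x.
Proof. by move=> tT; apply: quad_le => // i; exact: V_le. Qed.
Let Q_h x (t : R) : 0 <= t <= T -> `|Q (x, t)| <= h x.
Proof. by move=> tT; apply: quad_le => // i; exact: V_le. Qed.
Let r_h x (t : R) : 0 <= t <= T -> `|r (x, t)| <= h x.
Proof. by move=> tT; apply: quad_le => // i; exact: V_le. Qed.

Let Q_ge0 p : 0 <= Q p.
Proof.
apply: le_trans (a_coercive p.1 (fun i => V i p)).
by apply: mulr_ge0; [exact: ltW|apply: sumr_ge0 => i _; exact: sqr_ge0].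
Qed.

Let section_int (F : X * measurableTypeR R -> R) (t : R) : measurable_fun setT F ->
  (forall x, `|F (x, t)| <= h x) -> m.-integrable setT (EFin \o (fun x => F (x, t))).
Proof.
by move=> mF Fh; apply: le_integrableR hi => //; exact: (measurableT_comp mF).
Qed.

Let G (t : R) : R := \int[m]_x Q (x, t).

Let G_gronwall (t : R) : 0 <= t <= T -> G t <= (2 * C) * \int[lam]_(s in `[0, t]) G s.
Proof.
move=> tT; have /andP[t0 t1] := tT.
have sT (s : R) : `[0, t]%classic s -> 0 <= s <= T.
  by rewrite /= in_itv /= => /andP[-> st]; rewrite (le_trans st).
have -> : G t = 2 * \int[m]_x time_primitive q (x, t).
  rewrite /G (@eq_Rintegral _ _ _ m _ (fun x => 2 * time_primitive q (x, t))); last first.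
    by move=> x _; rewrite Q_eq.
  rewrite RintegralZl//.
  have -> : (fun x => time_primitive q (x, t)) = (fun x => 2^-1 * Q (x, t)).
    by apply/funext => x; rewrite Q_eq// mulrA mulVf ?mul1r// pnatr_eq0.
  by apply: integrableZR; apply: section_int => // x; exact: Q_h.
rewrite (Rintegral_time_swap mq hi q_h tT) -mulrA ler_wpM2l//.
have qi s : `[0, t]%classic s -> m.-integrable setT (EFin \o (fun x => q (x, s))).
  by move=> /sT s0T; apply: section_int => // x; exact: q_h.
have ri s : `[0, t]%classic s -> m.-integrable setT (EFin \o (fun x => r (x, s))).
  by move=> /sT s0T; apply: section_int => // x; exact: r_h.
have Qi s : `[0, t]%classic s -> m.-integrable setT (EFin \o (fun x => Q (x, s))).
  by move=> /sT s0T; apply: section_int => // x; exact: Q_h.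
have finint (F : X * measurableTypeR R -> R) : measurable_fun setT F ->
    (forall x (s : R), 0 <= s <= T -> `|F (x, s)| <= h x) ->
    lam.-integrable `[0, t] (EFin \o (fun s : R => \int[m]_x F (x, s))).
  move=> mF Fh; apply: measurable_bounded_integrable => //.
  - by rewrite /= lebesgue_measure_itv /=; case: ifPn => // _; rewrite -EFinB ltry.
  - by apply: measurable_funTS; exact: (measurable_Rintegral_fst m mF).
  - exists (\int[m]_x h x); split; first exact: num_real.
    move=> y hy s /= /sT s0T; apply: le_trans (ltW hy).
    have Fi : m.-integrable setT (EFin \o (fun x => F (x, s))).
      by apply: section_int => // x; exact: Fh.
    apply: le_trans (le_normr_Rintegral _ Fi) _ => //.
    by apply: le_Rintegral => //; [exact: integrable_norm|move=> x _; exact: Fh].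
rewrite -RintegralZl//; last exact: finint.
apply: le_Rintegral => //.
- exact: finint.
- by apply: eq_integrable (integrableZl _ C (finint _ mQ Q_h)).
- move=> s s0t; have s0T := sT s s0t.
  have := balance s0T.
  rewrite (@eq_Rintegral _ _ _ m _ (fun x => q (x, s) + r (x, s))); last first.
    move=> x _; rewrite /q /r -big_split /=; apply: eq_bigr => i _.
    by rewrite -big_split.
  rewrite RintegralD//; [|exact: qi|exact: ri].
  move=> /eqP; rewrite addr_eq0 => /eqP ->.
  rewrite /G -RintegralZl//; last exact: Qi.
  apply: le_trans (ler_norm _) _; rewrite normrN.
  apply: le_trans (le_normr_Rintegral _ (ri s s0t)) _ => //.
  apply: le_Rintegral => //.
  + exact: integrable_norm (ri s s0t).
  + exact: integrableZR (Qi s s0t).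
Qed.

(** Integrated over X, the identity Q = 2 J q and the balance q = - r (both in
the mean) give G(t) <= 2 C times the integral of G over [0, t], where G is the
energy. By Gronwall G = 0, and coercivity makes the second primitive of every
component of u vanish. *)
Lemma energy_eq0 i : {ae mlam, forall p, u i p = 0}.
Proof.
have C0 : 0 <= C by rewrite /C divr_ge0 ?mulr_ge0// ltW.
have mG : measurable_fun setT G by exact: (measurable_Rintegral_fst m mQ).
have Qi t : 0 <= t <= T -> m.-integrable setT (EFin \o (fun x => Q (x, t))).
  by move=> tT; apply: section_int => // x; exact: Q_h.
have GB t : 0 <= t <= T -> 0 <= G t <= \int[m]_x h x.
  move=> tT; apply/andP; split; first by apply: Rintegral_ge0 => x _.
  apply: le_Rintegral => //; first exact: Qi.
  by move=> x _; apply: le_trans (ler_norm _) _; exact: Q_h.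
have G0 t : 0 <= t <= T -> G t = 0.
  apply: (gronwall_eq0 (K := 2 * C + 1) _ mG GB) => //.
    by rewrite ltr_pwDr// mulr_ge0.
  move=> s sT; apply: le_trans (G_gronwall sT) _.
  rewrite ler_wpM2r ?lerDl//; apply: Rintegral_ge0 => s' /=.
  rewrite in_itv /= => /andP[s0 ss].
  have := GB s'; rewrite s0 (le_trans ss)/=; last by case/andP: sT.
  by move=> /(_ isT)/andP[].
apply: (time_field_eq0 T0 (tu i)) => t tT; rewrite -/(U i) -/(V i).
apply/eqP; rewrite eq_le; apply/andP; split; last first.
  by apply: Rintegral_ge0 => x _; exact: sqr_ge0.
rewrite -(mulr0 c^-1) -(G0 t tT) /G -RintegralZl//; last exact: Qi.
apply: le_Rintegral => //.
- exact: (square_integrable_primitive2 T0 (tu i) tT).2.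
- exact: integrableZR (Qi t tT).
- move=> x _; rewrite ler_pdivlMl//.
  apply: le_trans (a_coercive x (fun i => V i (x, t))).
  rewrite ler_wpM2l ?(ltW c0)// (bigD1 i)//= lerDl.
  by apply: sumr_ge0 => k _; exact: sqr_ge0.
Qed.

End energy.

(** * Lebesgue measurable coefficients *)

Section ae_integral.
Context d (X : measurableType d) {R : realType}.
Variable m : {measure set X -> \bar R}.
Import HBNNSimple.
Local Open Scope ereal_scope.

(** Integrands here may be only Lebesgue measurable. The integral of a
nonnegative function is a supremum over the simple functions below it, and a
simple function below f becomes one below g when it is cut off on the
exceptional null set, which does not change its integral. *)
Lemma ae_ge0_le_integralT (f g : X -> \bar R) : (forall x, 0 <= f x) ->
  (forall x, 0 <= g x) -> {ae m, forall x, f x <= g x} ->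
  \int[m]_x f x <= \int[m]_x g x.
Proof.
move=> f0 g0 [N [mN N0 fgN]]; rewrite !ge0_integralTE//.
apply: ge_ereal_sup => _ [h /= hf <-].
have mA : measurable (~` N) by exact: measurableC.
apply: le_ereal_sup_tmp; exists (sintegral m (proj_nnsfun h mA)).
  exists (proj_nnsfun h mA) => //= x; rewrite mindicE.
  have [/set_mem Nx|] := boolP (x \in ~` N); last by rewrite mulr0.
  rewrite mulr1; apply: le_trans (hf x) _.
  by apply: contrapT => nfg; apply: Nx; apply: fgN.
rewrite -!integralT_nnsfun le_eqVlt; apply/orP; left; apply/eqP.
apply: ae_eq_integral => //; try exact/measurable_EFinP.
exists N; split => // x /= /not_implyP[_ hx]; apply: contrapT => Nx; apply: hx.
by rewrite /= mindicE mem_set ?mulr1.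
Qed.

Lemma ae_eq_integralT (f g : X -> \bar R) : {ae m, forall x, f x = g x} ->
  \int[m]_x f x = \int[m]_x g x.
Proof.
move=> fg; have gf : {ae m, forall x, g x = f x} by apply: filterS fg.
rewrite integralE [RHS]integralE; congr (_ - _); apply/eqP; rewrite eq_le; apply/andP;
  split; apply: ae_ge0_le_integralT => //; [move: fg|move: gf|move: fg|move: gf];
  by apply: filterS => x E; rewrite ?funeposE ?funenegE E.
Qed.

Lemma ae_eq_integral_in (D : set X) (f g : X -> \bar R) :
  {ae m, forall x, D x -> f x = g x} ->
  \int[m]_(x in D) f x = \int[m]_(x in D) g x.
Proof.
move=> fg; rewrite integral_mkcond [RHS]integral_mkcond; apply: ae_eq_integralT.
by apply: filterS fg => x fg; rewrite !patchE; case: ifPn => // /set_mem.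
Qed.

End ae_integral.

Section ae_Rintegral.
Context d (X : measurableType d) {R : realType}.
Variable m : {measure set X -> \bar R}.

Lemma ae_eq_Rintegral_in (D : set X) (f g : X -> R) :
  {ae m, forall x, D x -> f x = g x} ->
  \int[m]_(x in D) f x = \int[m]_(x in D) g x.
Proof.
move=> fg; congr fine; apply: ae_eq_integral_in.
by apply: filterS fg => x fg Dx; rewrite fg.
Qed.

End ae_Rintegral.

Section borel_version.
Context d (X : measurableType d) {R : realType}.
Variable m : {measure set X -> \bar R}.

(** For each rational q the completed-measurable set where f < q agrees almost
everywhere with a measurable set A_q. The Borel function
g x = inf {q | A_q contains x} is equal to f off the countable union of the
exceptional null sets. *)
Lemma completed_measurable_ae_eq (D : set X) (f : X -> R) :
  (forall Y : set R, measurable Y -> completed_algebra_gen m (D `&` f @^-1` Y)) ->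
  exists2 g : X -> R, measurable_fun setT g &
    {ae m, forall x, D x -> f x = g x}.
Proof.
move=> cf.
have /choice[A] : forall n : nat, exists A : set X, measurable A /\
    if unpickle n is Some q then
      {ae m, forall x, D x -> A x <-> f x < ratr (q : rat)}
    else A = set0.
  move=> n; case: unpickle => [q|]; last by exists set0.
  have [A mA [N [N' [mN' N'0 NN']] AN]] := cf `]-oo, ratr q[%classic (measurable_itv _).
  exists A; split => //; exists N'; split => // x /= /not_implyP[Dx nA].
  apply: NN'; apply: contrapT => Nx; apply: nA.
  have := congr1 (fun S => S x) AN; rewrite /= in_itv /= => E; split => [Ax|fx].
    by have : D x /\ f x < ratr q; [rewrite -E; left|case].
  by have : A x \/ N x; [rewrite E|case].
move=> hA.
pose G n x : \bar R := if unpickle n is Some q then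
  (if x \in A n then (ratr (q : rat))%:E else +oo%E) else +oo%E.
have mG n : measurable_fun setT (G n).
  rewrite /G; case: unpickle => [q|]; last exact: measurable_cst.
  apply: measurable_fun_ifT => //; apply: (measurable_fun_bool true).
  rewrite [X in measurable X](_ : _ = A n); first by have [] := hA n.
  rewrite setTI; apply/seteqP; split => x /=; first exact: set_mem.
  exact: mem_set.
(* The rationals are enumerated, and [einfs _ 0] is the infimum over all of them;
indices coding no rational contribute +oo. *)
exists (fun x => fine (einfs (G ^~ x) 0%N)).
  apply: (measurableT_comp (@fine_measurable R setT measurableT)).
  exact: measurable_fun_einfs.
have : {ae m, forall x, forall n, D x -> if unpickle n is Some q then
   A n x <-> f x < ratr (q : rat) else True}.
  apply: ae_foralln => n; have [_] := hA n.
  by case: unpickle => [q//|_]; exact: aeW.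
apply: filterS => x hx Dx.
suff -> : einfs (G ^~ x) 0%N = (f x)%:E by [].
apply/eqP; rewrite eq_le; apply/andP; split.
  apply/lee_addgt0Pr => e e0.
  have [q] : exists q : rat, ratr q \in `]f x, f x + e[.
    by apply: rat_in_itvoo; rewrite ltrDl.
  rewrite in_itv /= => /andP[fq qe].
  apply: (@le_trans _ _ (G (pickle q) x)); first by apply: ereal_inf_lbound; exists (pickle q).
  have := hx (pickle q) Dx; rewrite /G pickleK => -[_ /(_ fq) Ax].
  by rewrite mem_set// -EFinD lee_fin ltW.
apply: le_ereal_inf_tmp => _ [n _ <-]; have := hx n Dx; rewrite /G.
case: unpickle => [q|_]; last by rewrite leey.
move=> [Aq _]; case: ifPn => [/set_mem/Aq/ltW|_]; last by rewrite leey.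
by rewrite lee_fin.
Qed.

End borel_version.

(** Equality almost everywhere would lose the pointwise bounds and the property
P. They are recovered by replacing a by a fixed matrix a0 outside a measurable
set B on which a coincides with its measurable version: at every x, b x is
either a0 or a value of a on D. *)
Lemma borel_version_mx d (X : measurableType d) (R : realType)
    (m : {measure set X -> \bar R}) (D : set X) n (a : X -> 'M[R]_n)
    (P : 'M[R]_n -> Prop) (a0 : 'M[R]_n) :
  measurable D ->
  (forall k l, (forall Y : set R, measurable Y ->
     completed_algebra_gen m (D `&` (fun x => a x k l) @^-1` Y)) /\
     exists M : R, forall x, D x -> `|a x k l| <= M) ->
  P a0 -> (forall x, D x -> P (a x)) ->
  exists b : X -> 'M[R]_n,
    [/\ forall k l, measurable_fun setT (fun x => b x k l),
        exists2 M : R, 0 <= M & forall k l x, `|b x k l| <= M,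
        forall x, P (b x) &
        {ae m, forall x, D x -> a x = b x}].
Proof.
move=> mD ha Pa0 Pa.
have /choice[g hg] : forall kl : 'I_n * 'I_n, exists g : X -> R,
    measurable_fun setT g /\ {ae m, forall x, D x -> a x kl.1 kl.2 = g x}.
  move=> [k l]; have [ck _] := ha k l.
  by have [g mg ag] := completed_measurable_ae_eq ck; exists g.
have /choice[K hK] : forall kl : 'I_n * 'I_n, exists M : R,
    forall x, D x -> `|a x kl.1 kl.2| <= M by move=> [k l]; case: (ha k l).
have : {ae m, forall x, forall kl : 'I_n * 'I_n, D x -> a x kl.1 kl.2 = g kl x}.
  by apply: filter_forall => kl; case: (hg kl).
move=> [N [mN N0 hN]]; pose B := D `\` N.
have mB : measurable B by exact: measurableD.
have gB x k l : B x -> a x k l = g (k, l) x.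
  move=> [Dx Nx]; have [//|/=] := pselect (a x k l = g (k, l) x) => nE.
  by exfalso; apply: Nx; apply: hN => /= /(_ (k, l) Dx).
pose b x := if x \in B then a x else a0.
have bB x : B x -> b x = a x by move=> Bx; rewrite /b mem_set.
pose M := \sum_kl (`|K kl| + `|a0 kl.1 kl.2|).
have KM (k l : 'I_n) : `|K (k, l)| + `|a0 k l| <= M.
  rewrite /M (bigD1 (k, l))//= lerDl; apply: sumr_ge0 => i _.
  by rewrite addr_ge0.
exists b; split.
- move=> k l; rewrite (_ : (fun x => b x k l) =
      (fun x => if x \in B then g (k, l) x else a0 k l)).
    apply: measurable_fun_ifT; last exact: measurable_cst.
      apply: (measurable_fun_bool true); rewrite [X in measurable X](_ : _ = B)//.
      rewrite setTI; apply/seteqP; split => x /=; first exact: set_mem.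
      exact: mem_set.
    by case: (hg (k, l)).
  apply/funext => x; rewrite /b; case: ifPn => // /set_mem Bx.
  exact: gB.
- exists M; first by apply: sumr_ge0 => i _; rewrite addr_ge0.
  move=> k l x; apply: le_trans (KM k l); rewrite /b; case: ifPn => [|_].
    move=> /set_mem[Dx _]; apply: (le_trans (hK (k, l) x Dx)).
    by apply: (le_trans (ler_norm _)); rewrite lerDl.
  by rewrite lerDr.
- by move=> x; rewrite /b; case: ifPn => [/set_mem[Dx _]|//]; exact: Pa.
- exists N; split => // x /= /not_implyP[Dx]; apply: contra_notP => Nx.
  by rewrite bB.
Qed.

(** * Integration by parts in space *)

Section compact_support.
Context {R : realType} {E : normedModType R}.
Implicit Types (f : E -> R) (K : set E).

Lemma derive_eq0_out_compact f K v x : compact K ->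
  (forall x, ~ K x -> f x = 0) -> ~ K x -> 'D_v f x = 0.
Proof.
move=> cK f0 Kx; rewrite (@near_eq_derive _ _ _ _ (cst 0)) ?derive_cst//.
have oK : open (~` K).
  by apply: closed_openC; apply: compact_closed => //; exact: norm_hausdorff.
by apply: filterS (open_nbhs_nbhs (conj oK Kx)) => y; exact: f0.
Qed.

Lemma continuous_compact_bounded f K : compact K -> continuous f ->
  (forall x, ~ K x -> f x = 0) -> exists2 M : R, 0 <= M & forall x, `|f x| <= M.
Proof.
move=> cK cf f0.
have [M [_ hM]] : bounded_set (f @` K).
  by apply/compact_bounded/continuous_compact => //; exact: continuous_subspaceT.
exists (`|M| + 1); first by rewrite addr_ge0.
move=> x; have [Kx|nKx] := pselect (K x); last by rewrite f0// normr0 addr_ge0.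
apply: (hM (`|M| + 1)); last by exists x.
by rewrite (le_lt_trans (ler_norm _))// ltrDl ltr01.
Qed.

(** Along a line of direction v, a directional derivative is an ordinary one;
this is how the one-dimensional theory applies to functions on R ^ n. *)
Lemma derive_along f (c : R -> E) v s :
  (forall h : R, c (h + s) = h *: v + c s) ->
  'D_1 (f \o c) s = 'D_v f (c s) /\
  (derivable (f \o c) s 1 <-> derivable f (c s) v).
Proof.
move=> hc; rewrite /derive /derivable.
have -> : (fun h : R => h^-1 *: ((f \o c \o shift s) (h *: (1 : R)) - (f \o c) s)) =
    (fun h : R => h^-1 *: ((f \o shift (c s)) (h *: v) - f (c s))).
  by apply/funext => h /=; rewrite -hc [h *: 1]mulr1.
by [].
Qed.

End compact_support.

Section integral_derivative.
Context {R : realType}.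
Local Notation lam := (@lebesgue_measure R).

Lemma Rintegral_derive_compact (g : R -> R) (A : R) : 0 <= A ->
  (forall s, derivable g s 1) -> continuous (fun s => 'D_1 g s) ->
  (forall s, A < `|s| -> g s = 0) -> \int[lam]_s ('D_1 g s) = 0.
Proof.
move=> A0 dg cg g0; pose B := A + 1.
have B0 : 0 < B by rewrite ltr_wpDl.
have AB : A < B by rewrite ltrDl ltr01.
have g'0 s : A < `|s| -> 'D_1 g s = 0.
  move=> As; rewrite (@near_eq_derive _ _ _ _ (cst 0)) ?derive_cst//.
  near=> t; apply: g0; near: t.
  by have := @norm_continuous _ R^o s _ (lt_nbhsr As).
transitivity (\int[lam]_(s in `[- B, B]) 'D_1 g s).
  rewrite [RHS]Rintegral_mkcond; apply: eq_Rintegral => s _; rewrite patchE.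
  case: ifPn => // /negP sB; apply: g'0; rewrite ltNge; apply/negP => sA; apply: sB.
  apply/mem_set; rewrite /= in_itv /=; move: sA; rewrite ler_norml => /andP[].
  by move=> s1 s2; apply/andP; split; rewrite /B; lra.
have gc s : {for s, continuous g}.
  by apply: differentiable_continuous; apply/derivable1_diffP; exact: dg.
rewrite /Rintegral (@continuous_FTC2 _ _ g).
- rewrite !g0 ?subee//; first by rewrite normrN ger0_norm// ltW.
  by rewrite ger0_norm// ltW.
- by rewrite gtrN.
- exact: continuous_subspaceT.
- split.
  + by move=> s _; exact: dg.
  + by apply: cvg_at_right_filter; exact: gc.
  + by apply: cvg_at_left_filter; exact: gc.
- by move=> s _; rewrite derive1E.
Unshelve. all: by end_near. Qed.

End integral_derivative.

Lemma sigma_finite_product d1 d2 (X : measurableType d1) (Y : measurableType d2)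
    (R : realType) (m1 : {sigma_finite_measure set X -> \bar R})
    (m2 : {sigma_finite_measure set Y -> \bar R}) :
  sigma_finite setT (m1 \x m2)%E.
Proof.
have /sigma_finiteP[F [TF ndF Foo]] := sigma_finiteT m1.
have /sigma_finiteP[G [TG ndG Goo]] := sigma_finiteT m2.
exists (fun n => F n `*` G n).
  apply/seteqP; split => // -[x y] _.
  have [n _ Fx] : (\bigcup_i F i) x by rewrite -TF.
  have [k _ Gy] : (\bigcup_i G i) y by rewrite -TG.
  exists (maxn n k) => //; split => /=.
  - by move: x Fx; exact/subsetPset/ndF/leq_maxl.
  - by move: y Gy; exact/subsetPset/ndG/leq_maxr.
move=> n; have [mF Ffin] := Foo n; have [mG Gfin] := Goo n.
split; first exact: measurableX.
by rewrite product_measure1E// lte_mul_pinfty// ge0_fin_numE.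
Qed.

(** Fubini's theorem, applied one variable at a time, needs sigma-finiteness of
the partial products. *)
Section leb_sigma_finite.
Context {R : realType}.

Definition leb2 := (@lebesgue_measure R \x @lebesgue_measure R)%E.
HB.instance Definition _ := Measure.on leb2.
HB.instance Definition _ := Measure_isSigmaFinite.Build _ _ _ leb2
  (sigma_finite_product lebesgue_measure lebesgue_measure).
HB.instance Definition _ := Measure_isSigmaFinite.Build _ _ _ (@leb3 R)
  (sigma_finite_product leb2 lebesgue_measure).

End leb_sigma_finite.

Lemma continuous_pair (T U V : topologicalType) (f : T -> U) (g : T -> V) :
  continuous f -> continuous g -> continuous (fun s => (f s, g s)).
Proof. by move=> cf cg s; exact: (cvg_pair (cf s) (cg s)). Qed.

Section integration_by_parts_space.
Context {R : realType}.
Local Notation space := (R * R * R)%type.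
Local Notation mR := (measurableTypeR R).
Local Notation lam := (@lebesgue_measure R).

Let box (A : R) : set mR := `[- A, A]%classic.

Let box_int A : lam.-integrable setT (EFin \o (\1_(box A) : mR -> R)).
Proof. exact: (integrable_indic_itv (- A) A true false). Qed.

Let norm3 (x : space) : [/\ `|x.1.1| <= `|x|, `|x.1.2| <= `|x| & `|x.2| <= `|x|].
Proof.
case: x => [[x y] z] /=; rewrite !prod_normE /= !le_max !lexx !orbT.
by split.
Qed.

Let in_box A (s : R) : `|s| <= A -> \1_(box A) s = 1 :> R.
Proof. by rewrite ler_norml => h; rewrite indicE mem_set//= in_itv. Qed.

Let indic_ge0 A (s : R) : 0 <= \1_(box A) s :> R.
Proof. by rewrite indicE. Qed.

Let box_bound3 (F : space -> R) (A M : R) : (forall x, `|F x| <= M) ->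
  (forall x, A < `|x| -> F x = 0) -> 0 <= M ->
  forall x, `|F x| <= M * (\1_(box A) x.1.1 * \1_(box A) x.1.2 * \1_(box A) x.2).
Proof.
move=> FM F0 M0 x; have [Ax|xA] := ltP A `|x|.
  by rewrite F0// normr0 !mulr_ge0.
have [h1 h2 h3] := norm3 x.
by rewrite !in_box ?mulr1 ?FM// (le_trans _ xA).
Qed.

Lemma box_integrable3 (F : space -> R) (A M : R) :
  measurable_fun (setT : set (mR * mR * mR)) F ->
  (forall x, `|F x| <= M) -> (forall x, A < `|x| -> F x = 0) -> 0 <= M ->
  leb3.-integrable setT (EFin \o (F : mR * mR * mR -> R)).
Proof.
move=> mF FM F0 M0; have b := @box_int A.
have := integrableZR M (integrable_tensor (m1 := leb2) (m2 := lebesgue_measure)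
  (integrable_tensor b b) b).
by apply: le_integrableR => //; exact: box_bound3.
Qed.

Lemma box_integrable2 (F : space -> R) (A M : R) (z : R) :
  measurable_fun (setT : set (mR * mR * mR)) F ->
  (forall x, `|F x| <= M) -> (forall x, A < `|x| -> F x = 0) -> 0 <= M ->
  leb2.-integrable setT (EFin \o (fun q : mR * mR => F (q, z))).
Proof.
move=> mF FM F0 M0; have b := @box_int A.
have := integrableZR M (integrable_tensor (m1 := lebesgue_measure)
  (m2 := lebesgue_measure) b b).
apply: le_integrableR; first exact: (measurableT_comp mF).
move=> q /=; apply: (le_trans (box_bound3 FM F0 M0 (q, z))) => /=.
by rewrite ler_wpM2l// ler_piMr ?mulr_ge0.
Qed.

(** Integrate first along the direction of the derivative: on each line the
function is C^1 with compact support, so the integral of its derivative is 0. *)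
Lemma integral_partial_eq0 (F : space -> R) (K : set space) (k : 'I_3) :
  compact K -> (forall x, ~ K x -> F x = 0) ->
  (forall x, derivable F x (unit_vec k)) ->
  continuous (fun x => 'D_(unit_vec k) F x) ->
  \int[leb3]_x 'D_(unit_vec k) F x = 0.
Proof.
move=> cK F0 dF cF; set v := unit_vec k in dF cF *.
have D0 x : ~ K x -> 'D_v F x = 0 by exact: derive_eq0_out_compact.
have [M M0 DM] := continuous_compact_bounded cK cF D0.
have [A' [_ hA']] := compact_bounded cK.
pose A := `|A'| + 1.
have A0 : 0 <= A by rewrite addr_ge0.
have KA x : A < `|x| -> ~ K x.
  move=> Ax Kx; have A'A : A' < A.
    by rewrite /A (le_lt_trans (ler_norm _))// ltrDl ltr01.
  by have := hA' A A'A x Kx; rewrite /= leNgt Ax.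
have mD := continuous_measurable3 cF.
have DA x : A < `|x| -> 'D_v F x = 0 by move=> /KA; exact: D0.
have Di := box_integrable3 mD DM DA M0.
have slice0 (c : R -> space) : (forall h s, c (h + s) = h *: v + c s) ->
    continuous c -> (forall s, `|s| <= `|c s|) -> \int[lam]_s 'D_v F (c s) = 0.
  move=> hc cc cs.
  transitivity (\int[lam]_s 'D_1 (F \o c) s).
    by apply: eq_Rintegral => s _; have [->] := derive_along F (hc ^~ s).
  apply: (Rintegral_derive_compact A0).
  - move=> s; have [_ [_ hd]] := derive_along F (hc ^~ s).
    by apply: hd; exact: dF.
  - have -> : (fun s : R => 'D_1 (F \o c) s) = (fun x => 'D_v F x) \o c.
      by apply/funext => s; have [] := derive_along F (hc ^~ s).
    by move=> s; apply: continuous_comp; [exact: cc|exact: cF].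
  - by move=> s As; apply: F0; apply: KA; exact: (lt_le_trans As).
have int_z z : (forall y, \int[lam]_x 'D_v F (x, y, z) = 0) \/
    (forall x, \int[lam]_y 'D_v F (x, y, z) = 0) ->
    \int[leb2]_q 'D_v F (q, z) = 0.
  have Dz := box_integrable2 z mD DM DA M0.
  case=> h.
    rewrite [LHS](Rintegral_prod21 (m1 := lebesgue_measure) (m2 := lebesgue_measure) Dz).
    by under eq_Rintegral do rewrite h; rewrite Rintegral_cst// mul0r.
  rewrite [LHS](Rintegral_prod12 (m1 := lebesgue_measure) (m2 := lebesgue_measure) Dz).
  by under eq_Rintegral do rewrite h; rewrite Rintegral_cst// mul0r.
have vE : v = (1, 0, 0) \/ v = (0, 1, 0) \/ v = (0, 0, 1).
  rewrite /v /unit_vec; case: k @v dF cF D0 DM mD DA Di slice0 int_z => -[|[|[|//]]] k3 *.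
  - by left.
  - by right; left.
  - by right; right.
have line0 (c : R -> space) : continuous c -> (forall s, `|s| <= `|c s|) ->
    (forall h s, c (h + s) = h *: v + c s) -> \int[lam]_s 'D_v F (c s) = 0.
  by move=> cc cs hc; exact: slice0.
have nle (c : R -> space) : (forall s, [\/ c s = (s, (c s).1.2, (c s).2), c s = ((c s).1.1, s, (c s).2) | c s = ((c s).1, s)]) -> forall s, `|s| <= `|c s|.
  by move=> hc s; have [h1 h2 h3] := norm3 (c s); case: (hc s) => E; rewrite E /= in h1 h2 h3 *.
have sv (h a b c' : R) : h *: ((a, b, c') : space) = (h * a, h * b, h * c') by [].
rewrite [LHS](Rintegral_prod21 (m1 := leb2) (m2 := lebesgue_measure) Di).
case: vE => [vE|[vE|vE]].
- transitivity (\int[lam]_z (cst 0 z : R)); last by rewrite Rintegral_cst// mul0r.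
  apply: eq_Rintegral => z _; apply: int_z; left => y.
  apply: (line0 (fun s => (s, y, z))).
  + by do 2! [apply: continuous_pair; last exact: cst_continuous]; move=> s; exact: cvg_id.
  + by apply: (nle (fun s => (s, y, z))) => s; constructor 1.
  + by move=> h s; rewrite vE sv !mulr0 mulr1; congr (_, _, _); rewrite add0r.
- transitivity (\int[lam]_z (cst 0 z : R)); last by rewrite Rintegral_cst// mul0r.
  apply: eq_Rintegral => z _; apply: int_z; right => x.
  apply: (line0 (fun s => (x, s, z))).
  + apply: continuous_pair; last exact: cst_continuous.
    by apply: continuous_pair; [exact: cst_continuous|move=> s; exact: cvg_id].
  + by apply: (nle (fun s => (x, s, z))) => s; constructor 2.
  + by move=> h s; rewrite vE sv !mulr0 mulr1; congr (_, _, _); rewrite add0r.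
(* In the last direction the order of integration must be exchanged first. *)
- rewrite -[LHS](Rintegral_prod21 (m1 := leb2) (m2 := lebesgue_measure) Di).
  rewrite [LHS](Rintegral_prod12 (m1 := leb2) (m2 := lebesgue_measure) Di).
  transitivity (\int[leb2]_z (cst 0 z : R)); last by rewrite Rintegral_cst// mul0r.
  apply: eq_Rintegral => -[x y] _.
  apply: (line0 (fun s => (x, y, s))).
  + by apply: continuous_pair; [exact: cst_continuous|move=> s; exact: cvg_id].
  + by apply: (nle (fun s => (x, y, s))) => s; constructor 3.
  + by move=> h s; rewrite vE sv !mulr0 mulr1; congr (_, _, _); rewrite add0r.
Qed.

End integration_by_parts_space.

(** * Test fields belong to V *)

Lemma continuous_mul (R : realType) (T : topologicalType) (f g : T -> R) :
  continuous f -> continuous g -> continuous (fun x => f x * g x).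
Proof. by move=> cf cg x; exact: (cvgM (cf x) (cg x)). Qed.

Lemma continuous_add (R : realType) (T : topologicalType) (f g : T -> R) :
  continuous f -> continuous g -> continuous (fun x => f x + g x).
Proof. by move=> cf cg x; exact: (cvgD (cf x) (cg x)). Qed.

Section L2_components.
Context d (S : measurableType d) {R : realType}.
Variable m : {measure set S -> \bar R}.
Local Notation vec := 'cV[R]_3.

Lemma dot_ge0 (u : vec) : 0 <= dot u u.
Proof. by apply: sumr_ge0 => i _; rewrite -expr2 sqr_ge0. Qed.

Lemma L2_square_integrable (D : set S) (u : S -> vec) : measurable D ->
  (forall i, square_integrable m (fun x => u x i 0)) -> L2 m D u.
Proof.
move=> mD su; split=> [i|]; first by apply: measurable_funTS; case: (su i).
have ui : m.-integrable setT (EFin \o (fun x => dot (u x) (u x))).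
  by apply: integrable_sumR => // i; case: (su i).
apply: le_lt_trans (integrable_lty measurableT ui).
apply: ge0_subset_integral => //; first exact: measurable_int ui.
by move=> x _; rewrite lee_fin dot_ge0.
Qed.

Lemma square_integrable_L2 (D : set S) (u : S -> vec) i : measurable D ->
  L2 m D u -> square_integrable m ((fun x => u x i 0) \_ D).
Proof.
move=> mD [mu Iu]; have mD' : measurable_fun setT ((fun x => u x i 0) \_ D).
  by apply/(measurable_restrictT _ mD); exact: mu.
have mD2 : measurable_fun setT (fun x => ((fun x => u x i 0) \_ D) x ^+ 2).
  exact: measurable_funX.
have mdot : measurable_fun D (fun x => (dot (u x) (u x))%:E).
  apply/measurable_EFinP; apply: measurable_sum => k.
  by apply: measurable_funM; exact: mu.
split => //; apply/integrableP; split; first exact/measurable_EFinP.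
apply: le_lt_trans Iu; rewrite [leRHS]integral_mkcond.
apply: ge0_le_integral => //.
- by apply: measurableT_comp => //; exact/measurable_EFinP.
- exact: ((measurable_restrictT _ mD).1 mdot).
- move=> x _ /=; rewrite !patchE; case: ifPn => _; last by rewrite expr0n normr0.
  rewrite lee_fin ger0_norm ?sqr_ge0// /dot (bigD1 i)//= expr2 lerDl.
  by apply: sumr_ge0 => k _; rewrite -expr2 sqr_ge0.
Qed.

End L2_components.

Section test_fields.
Context {R : realType}.
Local Notation space := (R * R * R)%type.
Local Notation mR := (measurableTypeR R).
Local Notation vec := 'cV[R]_3.
Implicit Types (f g : space -> R) (K Om : set space) (z : space -> vec).

Lemma smooth_continuous (E : normedModType R) (f : E -> R) : smooth f -> continuous f.
Proof. by move=> /(_ [::])[]. Qed.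

Lemma smooth_derivable (E : normedModType R) (f : E -> R) x v : smooth f -> derivable f x v.
Proof. by move=> /(_ [::])[_]. Qed.

Lemma smooth_derive_continuous (E : normedModType R) (f : E -> R) (v : E) :
  smooth f -> continuous (fun x => 'D_v f x).
Proof. by move=> /(_ [:: v])[]. Qed.

Lemma integrable_compact_support f K : compact K -> continuous f ->
  (forall x, ~ K x -> f x = 0) ->
  leb3.-integrable setT (EFin \o (f : mR * mR * mR -> R)).
Proof.
move=> cK cf f0; have [M M0 fM] := continuous_compact_bounded cK cf f0.
have [A' [_ hA']] := compact_bounded cK; pose A := `|A'| + 1.
apply: (box_integrable3 (A := A) _ fM _ M0); first exact: continuous_measurable3.
move=> x Ax; apply: f0 => Kx; have A'A : A' < A.
  by rewrite /A (le_lt_trans (ler_norm _))// ltrDl ltr01.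
by have := hA' A A'A x Kx; rewrite /= leNgt Ax.
Qed.

Lemma integral_by_parts_test Om f g (k : 'I_3) :
  test_function Om f -> test_function Om g ->
  [/\ leb3.-integrable setT (EFin \o ((fun x => f x * 'D_(unit_vec k) g x) : mR * mR * mR -> R)),
      leb3.-integrable setT (EFin \o ((fun x => 'D_(unit_vec k) f x * g x) : mR * mR * mR -> R)) &
  \int[leb3]_x (f x * 'D_(unit_vec k) g x) =
  - (\int[leb3]_x ('D_(unit_vec k) f x * g x))].
Proof.
move=> [sf [K [cK KO f0]]] [sg [L [cL LO g0]]]; set v := unit_vec k.
have i1 : leb3.-integrable setT (EFin \o ((fun x => f x * 'D_v g x) : mR * mR * mR -> R)).
  apply: (@integrable_compact_support _ K cK).
    by apply: continuous_mul; [exact: smooth_continuous|exact: smooth_derive_continuous].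
  by move=> x /f0 ->; rewrite mul0r.
have i2 : leb3.-integrable setT (EFin \o ((fun x => 'D_v f x * g x) : mR * mR * mR -> R)).
  apply: (@integrable_compact_support _ L cL).
    by apply: continuous_mul; [exact: smooth_derive_continuous|exact: smooth_continuous].
  by move=> x /g0 ->; rewrite mulr0.
split => //; apply/eqP; rewrite -addr_eq0 -RintegralD//; apply/eqP.
have DE x : 'D_v (f * g) x = f x * 'D_v g x + 'D_v f x * g x.
  rewrite deriveM; [|exact: smooth_derivable|exact: smooth_derivable].
  by rewrite [g x *: _]mulrC.
transitivity (\int[leb3]_x 'D_v (f * g) x).
  by apply: eq_Rintegral => x _; rewrite DE.
apply: (@integral_partial_eq0 _ (f * g) K) => //.
- by move=> x Kx; rewrite /GRing.mul /= f0// mul0r.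
- by move=> x; apply: derivableM; exact: smooth_derivable.
- rewrite (_ : (fun x => _) = (fun x => f x * 'D_v g x + 'D_v f x * g x)); last exact/funext.
  exact: (continuous_add
    (continuous_mul (smooth_continuous sf) (smooth_derive_continuous sg))
    (continuous_mul (smooth_derive_continuous sf) (smooth_continuous sg))).
Qed.

Lemma test_function_out Om f x : test_function Om f -> ~ Om x -> f x = 0.
Proof. by move=> [_ [K [_ KO f0]]] Ox; apply: f0 => /KO. Qed.

Lemma Rintegral_restrict (Om : set (mR * mR * mR)) (F : mR * mR * mR -> R) :
  (forall x, ~ Om x -> F x = 0) -> \int[leb3]_(x in Om) F x = \int[leb3]_x F x.
Proof.
move=> F0; rewrite Rintegral_mkcond; apply: eq_Rintegral => x _; rewrite patchE.
by case: ifPn => // /negP Ox; rewrite F0// => /mem_set.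
Qed.

(* The arithmetic of cyclic permutations of three indices. *)
Let ord3 (j : 'I_3) : j + 2%:R + 1 = j.
Proof. by apply/val_inj; case: j => -[|[|[|]]]. Qed.
Let ord3' (j : 'I_3) : j + 1 + 2%:R = j.
Proof. by apply/val_inj; case: j => -[|[|[|]]]. Qed.
Let ord22 (j : 'I_3) : j + 2%:R + 2%:R = j + 1.
Proof. by apply/val_inj; case: j => -[|[|[|]]]. Qed.
Let ord11 (j : 'I_3) : j + 1 + 1 = j + 2%:R.
Proof. by apply/val_inj; case: j => -[|[|[|]]]. Qed.

(** The classical curl is symmetric on compactly supported smooth fields: each
first derivative moves to the other factor with a sign, and a cyclic shift of
the indices restores the curl. *)
Lemma is_curl_test Om z : (forall i, test_function Om (fun x => z x i 0)) ->
  is_curl Om z (classical_curl z).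
Proof.
move=> tz w tw; pose D (k i : 'I_3) (u : space -> vec) x := 'D_(unit_vec k) (fun y => u y i 0) x.
have P i j k := integral_by_parts_test k (tz i) (tw j).
rewrite (Rintegral_restrict (Om := Om)); last first.
  by move=> x Ox; rewrite /dot big1// => i _; rewrite (test_function_out (tz i) Ox) mul0r.
rewrite (Rintegral_restrict (Om := Om)); last first.
  by move=> x Ox; rewrite /dot big1// => i _; rewrite (test_function_out (tw i) Ox) mulr0.
have Pz i j k : leb3.-integrable setT (EFin \o ((fun x => z x i 0 * D k j w x) : mR * mR * mR -> R)).
  by have [] := P i j k.
have Pw i j k : leb3.-integrable setT (EFin \o ((fun x => D k i z x * w x j 0) : mR * mR * mR -> R)).
  by have [] := P i j k.
transitivity (\sum_i (\int[leb3]_x (z x i 0 * D (i + 1) (i + 2%:R) w x)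
                    - \int[leb3]_x (z x i 0 * D (i + 2%:R) (i + 1) w x))).
  transitivity (\int[leb3]_x (\sum_i ((z x i 0 * D (i + 1) (i + 2%:R) w x) -
                                 (z x i 0 * D (i + 2%:R) (i + 1) w x)))).
    by apply: eq_Rintegral => x _; apply: eq_bigr => i _; rewrite mxE mulrBr.
  rewrite Rintegral_sum//; last first.
    by move=> i; exact: (integrableDR (Pz _ _ _) (integrableNR (Pz _ _ _))).
  by apply: eq_bigr => i _; rewrite RintegralB.
transitivity (\sum_i (\int[leb3]_x (D (i + 1) (i + 2%:R) z x * w x i 0)
                    - \int[leb3]_x (D (i + 2%:R) (i + 1) z x * w x i 0))); last first.
  symmetry; transitivity (\int[leb3]_x (\sum_i ((D (i + 1) (i + 2%:R) z x * w x i 0) -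
                                 (D (i + 2%:R) (i + 1) z x * w x i 0)))).
    by apply: eq_Rintegral => x _; apply: eq_bigr => i _; rewrite mxE mulrBl.
  rewrite Rintegral_sum//; last first.
    by move=> i; exact: (integrableDR (Pw _ _ _) (integrableNR (Pw _ _ _))).
  by apply: eq_bigr => i _; rewrite RintegralB.
have PE i j k : \int[leb3]_x (z x i 0 * D k j w x) = - \int[leb3]_x (D k i z x * w x j 0).
  by have [_ _ ->] := P i j k.
rewrite !sumrB addrC; congr (_ + _).
- rewrite -sumrN; rewrite (reindex_inj (addIr (2%:R : 'I_3))) /=; apply: eq_bigr => i _.
  by rewrite PE opprK ord22 ord3.
- rewrite (reindex_inj (addIr (1 : 'I_3))) /= -sumrN; apply: eq_bigr => i _.
  by rewrite PE ord11 ord3'.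
Qed.

Lemma square_integrable_compact_support f K : compact K -> continuous f ->
  (forall x, ~ K x -> f x = 0) -> square_integrable (@leb3 R) f.
Proof.
move=> cK cf f0; split; first exact: continuous_measurable3.
apply: (@integrable_compact_support (fun x => f x ^+ 2) K cK).
  exact: (continuous_mul cf cf).
by move=> x Kx; rewrite f0// expr0n.
Qed.

(** Being in V is tested against smooth fields, while the weak formulation takes
test fields in V; this lemma lets one pass from the second to the first. *)
Lemma V_test Om z : measurable (Om : set (mR * mR * mR)) ->
  (forall i, test_function Om (fun x => z x i 0)) -> V Om (z, classical_curl z).
Proof.
move=> mO tz; have Dsq i k :
    square_integrable (@leb3 R) (fun x => 'D_(unit_vec k) (fun y => z y i 0) x).
  have [sz [K [cK _ z0]]] := tz i.
  apply: (square_integrable_compact_support cK).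
    exact: smooth_derive_continuous.
  by move=> x Kx; exact: (derive_eq0_out_compact (unit_vec k) cK z0 Kx).
split => /=; last exact: is_curl_test.
- apply: L2_square_integrable => // i; have [sz [K [cK _ z0]]] := tz i.
  by apply: (square_integrable_compact_support cK) => //; exact: smooth_continuous.
- apply: L2_square_integrable => // i; rewrite /classical_curl.
  rewrite (_ : (fun x => _) = (fun x => 'D_(unit_vec (i + 1)) (fun y => z y (i + 2%:R) 0) x
    + (-1) * 'D_(unit_vec (i + 2%:R)) (fun y => z y (i + 1) 0) x)).
    by apply: square_integrableD => //; exact: square_integrableZ.
  by apply/funext => x; rewrite mxE mulN1r.
Qed.

End test_fields.

(** * Ramps in time *)

Section time_weights.
Context {R : realType}.
Local Notation lam := (@lebesgue_measure R).
Local Notation mR := (measurableTypeR R).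

(** The time factor of the test functions; [- time_step t] is its derivative. *)
Definition time_ramp (t s : R) : R := Num.max 0 (t - s).
Definition time_step (t s : R) : R := (s <= t)%R%:R.

Lemma measurable_time_ramp t : measurable_fun setT (time_ramp t : mR -> R).
Proof.
rewrite [X in measurable_fun _ X](_ : _ = (cst 0 : mR -> R) \max (fun s => t - s))//.
apply: measurable_maxr => //.
exact: measurable_funB.
Qed.

Lemma measurable_time_step t : measurable_fun setT (time_step t : mR -> R).
Proof.
rewrite (_ : time_step t = \1_(`]-oo, t]%classic : set mR)); last first.
  apply/funext => s; rewrite /time_step indicE; congr (nat_of_bool _)%:R.
  by apply/idP/idP => [st|/set_mem /=]; [apply/mem_set; rewrite /= in_itv|rewrite in_itv].
exact: measurable_indic.
Qed.

Lemma primitive_step (f : R -> R) (a : R) : (forall s, s <= 0 -> f s = 0) ->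
  primitive f a = \int[lam]_s (f s * time_step a s).
Proof.
move=> f0; rewrite /primitive [LHS]Rintegral_mkcond; apply: eq_Rintegral => s _.
rewrite patchE /time_step; case: ifPn => [/set_mem /=|/negP sa].
  by rewrite in_itv /= => /andP[_ ->]; rewrite mulr1.
have [s_le|s_gt] := leP s 0; first by rewrite f0// mul0r.
case: (boolP (s <= a)) => [s_a|]; last by rewrite mulr0.
by exfalso; apply: sa; apply/mem_set; rewrite /= in_itv /= (ltW s_gt).
Qed.

(** Cauchy's formula for repeated integration: exchange the order of integration
over the triangle 0 <= s <= a <= t. *)
Lemma primitive_primitive (f : R -> R) (t : R) : 0 <= t ->
  lam.-integrable setT (EFin \o (f : mR -> R)) -> (forall s, s <= 0 -> f s = 0) ->
  primitive (primitive f) t = \int[lam]_s (f s * time_ramp t s).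
Proof.
move=> t0 fi f0.
pose h (p : mR * mR) := \1_(`[0, t]%classic : set mR) p.1 * (f p.2 * time_step p.1 p.2) : R.
have mf : measurable_fun setT f by apply/measurable_EFinP; exact: measurable_int fi.
have ti := integrable_indic_itv 0 t true false.
have mstep : measurable_fun setT (fun p : mR * mR => time_step p.1 p.2).
  rewrite (_ : (fun p : mR * mR => time_step p.1 p.2) = \1_[set p : mR * mR | 0 <= p.1 - p.2]); last first.
    apply/funext => p; rewrite /time_step indicE; congr (nat_of_bool _)%:R.
    by apply/idP/idP => [st|/set_mem /=]; [apply/mem_set; rewrite /= subr_ge0|rewrite subr_ge0].
  by apply/measurable_indic/measurable_ge0_set; apply: measurable_funB; [exact: measurable_fst|exact: measurable_snd].
have mh : measurable_fun setT h.
  apply: measurable_funM.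
    have mI : measurable_fun (setT : set mR) (\1_(`[0, t]%classic : set mR) : _ -> R).
      exact: measurable_indic.
    exact: (measurableT_comp mI measurable_fst).
  apply: measurable_funM => //; exact: (measurableT_comp mf measurable_snd).
have hi : (lam \x lam)%E.-integrable setT (EFin \o h).
  apply: le_integrableR (integrable_tensor ti (integrable_norm fi)) => //.
  move=> [a s] /=; rewrite !normrM /= (@ger0_norm _ (\1_ _ a)); last by rewrite indicE.
  rewrite ler_wpM2l//.
  rewrite ler_piMr// /time_step; by case: (s <= a); rewrite ?normr1 ?normr0.
have := Rintegral_prod12 hi; rewrite (Rintegral_prod21 hi) /= => E.
transitivity (\int[lam]_a \int[lam]_s h (a, s)).
  rewrite /primitive Rintegral_mkcond; apply: eq_Rintegral => a _.
  rewrite patchE /h /= indicE; case: ifPn => at_; last first.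
    under eq_Rintegral do rewrite mul0r.
    by rewrite Rintegral_cst// mul0r.
  under [RHS]eq_Rintegral do rewrite mul1r.
  exact: primitive_step.
rewrite -E; apply: eq_Rintegral => s _; rewrite /h /=.
have [s_le|s_gt] := leP s 0.
  rewrite f0// mul0r; under eq_Rintegral do rewrite mul0r mulr0.
  by rewrite Rintegral_cst// mul0r.
transitivity (\int[lam]_(a in `[s, t]) f s).
  rewrite [RHS]Rintegral_mkcond; apply: eq_Rintegral => a _.
  rewrite patchE indicE /time_step; have [sa|sa] := leP s a; last first.
    rewrite mulr0 mulr0 memNset//= in_itv /= => /andP[].
    by rewrite leNgt sa.
  have [ta|ta] := leP a t.
    rewrite !mem_set ?mulr1 ?mul1r//= in_itv /= ?sa ?ta//.
    by rewrite (le_trans (ltW s_gt)).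
  by rewrite !memNset ?mul0r//= in_itv /= => /andP[_]; rewrite leNgt ta.
rewrite Rintegral_cst//= lebesgue_measure_itv /= lte_fin /time_ramp.
have [st|ts] := ltP s t => /=.
  by rewrite max_r// subr_ge0 ltW.
by rewrite max_l// subr_le0.
Qed.

End time_weights.

Section time_field_fubini.
Context d (X : measurableType d) {R : realType}.
Variable m : {sigma_finite_measure set X -> \bar R}.
Variable T : R.
Hypothesis T0 : 0 < T.
Local Notation lam := (@lebesgue_measure R).
Local Notation mR := (measurableTypeR R).
Local Notation mlam := (m \x lam)%E.
Implicit Types (f u : X * mR -> R) (b : X -> R) (k : R -> R).

Lemma time_field_weight f b k (C : R) : time_field m T f -> square_integrable m b ->
  measurable_fun setT (k : mR -> R) -> 0 <= C ->
  (forall s : R, 0 < s < T -> `|k s| <= C) ->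
  mlam.-integrable setT (EFin \o (fun p => f p * (b p.1 * k p.2))).
Proof.
move=> [mf f0 f2 fi] [mb bi] mk C0 kC.
have := integrableZR C (integrableDR fi (integrable_tensor bi (integrable_indic_time T))).
apply: le_integrableR.
  apply: measurable_funM => //; apply: measurable_funM.
    exact: (measurableT_comp mb measurable_fst).
  exact: (measurableT_comp mk measurable_snd).
move=> [x s] /=; have [sT|sT] := boolP (0 < s < T); last first.
  rewrite f0// mul0r normr0 expr0n add0r; apply: mulr_ge0 => //.
  by rewrite mulr_ge0 ?sqr_ge0// indicE.
rewrite indicE mem_set /=; last by case/andP: sT => ? ?; rewrite in_itv /= !ltW.
rewrite mulr1 mulrA normrM mulrC ler_pM//; first exact: kC.
rewrite ler_norml; have := sqr_ge0 (f (x, s) + b x); have := sqr_ge0 (f (x, s) - b x).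
by move=> ? ?; apply/andP; split; nra.
Qed.

Lemma time_step_le t s : `|time_step t s| <= 1 :> R.
Proof. by rewrite /time_step; case: (s <= t); rewrite ?normr1 ?normr0. Qed.

Lemma time_ramp_le (t s : R) : t <= T -> 0 < s -> `|time_ramp t s| <= T.
Proof.
move=> tT s0; rewrite /time_ramp ger0_norm ?le_max ?lexx//.
by rewrite ge_max (ltW T0) /=; lra.
Qed.

(** Together with the next lemma: pairing f with a separated test function of
step (resp. ramp) type evaluates its first (resp. second) primitive at the
time t, and pairs the result with the spatial factor. *)
Lemma Rintegral_time_step f b (t : R) : time_field m T f -> square_integrable m b ->
  \int[mlam]_p (f p * (b p.1 * time_step t p.2)) =
  \int[m]_x (time_primitive f (x, t) * b x).
Proof.
move=> tf sb; have [mf f0 f2 fi] := tf.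
rewrite [LHS](Rintegral_prod12 (m1 := m) (m2 := lebesgue_measure)); last first.
  apply: (time_field_weight tf sb (measurable_time_step t) ler01) => s _.
  exact: time_step_le.
apply: eq_Rintegral => x _ /=; rewrite /time_primitive primitive_step /=; last first.
  by move=> s s0; rewrite f0//; apply/negP => /andP[]; rewrite ltNge s0.
rewrite -RintegralZr//; first by apply: eq_Rintegral => s _; rewrite mulrCA mulrC.
apply: le_integrableR (integrable_norm (integrable_time_section x tf)).
  apply: measurable_funM; first exact: measurable_time_section.
  exact: measurable_time_step.
by move=> s; rewrite normrM ler_piMr// time_step_le.
Qed.

Lemma Rintegral_time_ramp f b (t : R) : time_field m T f -> square_integrable m b ->
  0 <= t <= T -> \int[mlam]_p (f p * (b p.1 * time_ramp t p.2)) =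
  \int[m]_x (time_primitive (time_primitive f) (x, t) * b x).
Proof.
move=> tf sb /andP[t0 tT]; have [mf f0 f2 fi] := tf.
have f0' x s : s <= 0 -> f (x, s) = 0.
  by move=> s0; rewrite f0//; apply/negP => /andP[]; rewrite ltNge s0.
rewrite [LHS](Rintegral_prod12 (m1 := m) (m2 := lebesgue_measure)); last first.
  apply: (time_field_weight tf sb (measurable_time_ramp t) (ltW T0)) => s /andP[s0 _].
  exact: time_ramp_le.
apply: eq_Rintegral => x _ /=.
have -> : time_primitive (time_primitive f) (x, t) =
    primitive (primitive (fun s => f (x, s))) t by [].
rewrite (primitive_primitive t0 (integrable_time_section x tf) (f0' x)).
rewrite -RintegralZr//; first by apply: eq_Rintegral => s _; rewrite mulrCA mulrC.
apply: le_integrableR (integrableZR T (integrable_norm (integrable_time_section x tf))).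
  apply: measurable_funM; first exact: measurable_time_section.
  exact: measurable_time_ramp.
move=> s /=; have [s0|s0] := leP s 0.
  by rewrite f0'// mul0r normr0 mulr0.
by rewrite normrM mulrC ler_wpM2r// time_ramp_le.
Qed.

(** By Fubini the set A of points x with a square integrable section has full
measure; f is u cut off outside A. *)
Lemma square_integrable_time_field u : square_integrable mlam u ->
  (forall x (s : R), ~~ (0 < s < T) -> u (x, s) = 0) ->
  exists f, [/\ time_field m T f, {ae mlam, forall p, u p = f p} &
                forall p, u p = 0 -> f p = 0].
Proof.
move=> [mu ui] u0; pose A := [set x | (\int[lam]_s (u (x, s) ^+ 2)%:E < +oo)%E].
have mu2 : measurable_fun setT (fun p => (u p ^+ 2)%:E).
  by apply/measurable_EFinP; exact: measurable_funX.
have mA : measurable A.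
  have := @measurable_integral_snd _ _ _ _ _ lam _ mu2.
  move=> mI; have := emeasurable_fun_infty_o measurableT mI +oo%E.
  by rewrite setTI.
have Aae : {ae m, forall x, A x}.
  have := ae_integrable1 ui; apply: filterS => x /integrable_lty; exact.
have mA1 : measurable_fun setT (fun p : X * mR => \1_A p.1 : R).
  have mI : measurable_fun setT (\1_A : X -> R) by exact: measurable_indic.
  exact: (measurableT_comp mI measurable_fst).
pose f p := \1_A p.1 * u p.
have f2E p : f p ^+ 2 = \1_A p.1 * u p ^+ 2.
  by rewrite /f exprMn indicE; case: (_ \in _); rewrite ?expr1n ?expr0n.
exists f; split; last by move=> p up; rewrite /f up mulr0.
- split.
  + exact: measurable_funM.
  + by move=> x s sT; rewrite /f u0// mulr0.
  + move=> x; have mux : measurable_fun setT (fun s => u (x, s)) by exact: measurable_time_section.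
    under eq_fun do rewrite f2E /=.
    have [xA|xA] := boolP (x \in A); last first.
      rewrite (_ : (fun s => _) = cst 0); last by apply/funext => s; rewrite indicE (negbTE xA) mul0r.
      exact: integrable0.
    apply: integrableZR; apply/integrableP; split; first exact/measurable_EFinP/measurable_funX.
    move: xA => /set_mem; apply: le_lt_trans; rewrite le_eqVlt; apply/orP; left; apply/eqP.
    by apply: eq_integral => s _; rewrite gee0_abs// lee_fin sqr_ge0.
  + apply: le_integrableR ui; first by apply: measurable_funX; exact: measurable_funM.
    move=> p; rewrite f2E normrM (ger0_norm (sqr_ge0 _)) ler_piMl ?sqr_ge0//.
    by rewrite indicE; case: (_ \in _); rewrite ?normr1 ?normr0.
- case: Aae => N [mN N0 NA]; exists (N `*` setT); split.
  + exact: measurableX.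
  + by rewrite /= product_measure1E// [X in (X * _)%E](_ : _ = 0%E) ?mul0e.
  + move=> [x s] /= h; split => //; apply: NA => Ax; apply: h.
    by rewrite /f indicE mem_set// mul1r.
Qed.

End time_field_fubini.

(** * Admissibility of the ramp test functions *)

Section scaled_fields.
Context {R : realType}.
Local Notation space := (R * R * R)%type.
Local Notation mR := (measurableTypeR R).
Local Notation vec := 'cV[R]_3.
Local Notation lam := (@lebesgue_measure R).
Local Notation field2 := ((space -> vec) * (space -> vec))%type.
Import HBNNSimple.
Variables (Om : set space) (T : R).
Hypothesis mO : measurable (Om : set (mR * mR * mR)).
Implicit Types (v : space -> vec) (p : field2) (k : R -> R).

Lemma measurable_QT : measurable (QT Om T : set (mR * mR * mR * mR)).
Proof. by apply: measurableX. Qed.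

Lemma measurable_field_scale k v : measurable_fun setT (k : mR -> R) ->
  measurable_field (Om : set (mR * mR * mR)) v ->
  measurable_field (QT Om T : set (mR * mR * mR * mR)) (fun q => k q.2 *: v q.1).
Proof.
move=> mk mv i.
have mvO : measurable_fun setT ((fun x => v x i 0) \_ Om : mR * mR * mR -> R).
  by apply/(measurable_restrictT _ mO); exact: mv.
apply: (@eq_measurable_fun _ _ _ _ _
  (fun q : mR * mR * mR * mR => k q.2 * ((fun x => v x i 0) \_ Om) q.1)).
  by move=> [x s] /set_mem[/= Ox _]; rewrite patchE mem_set// mxE.
apply: measurable_funTS; apply: measurable_funM.
- exact: (measurableT_comp mk measurable_snd).
- exact: (measurableT_comp mvO measurable_fst).
Qed.

Lemma measurable_dot v : measurable_field (Om : set (mR * mR * mR)) v ->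
  measurable_fun (Om : set (mR * mR * mR)) (fun x => dot (v x) (v x)).
Proof. by move=> mv; apply: measurable_sum => i; apply: measurable_funM; exact: mv. Qed.

Lemma dotZ (c : R) (u w : vec) : dot (c *: u) (c *: w) = c ^+ 2 * dot u w.
Proof.
by rewrite /dot mulr_sumr; apply: eq_bigr => i _; rewrite !mxE; ring.
Qed.

Lemma Vnorm2Z (c : R) p : V Om p ->
  (Vnorm2 Om (c *: p) = (c ^+ 2)%:E * Vnorm2 Om p)%E.
Proof.
move=> [[m1 _] [m2 _] _]; rewrite /Vnorm2 -ge0_integralZl_EFin ?sqr_ge0//.
- by apply: eq_integral => x _; rewrite -EFinM mulrDr -!dotZ.
- by move=> x _; rewrite lee_fin addr_ge0// dot_ge0.
- by apply/measurable_EFinP; apply: measurable_funD; exact: measurable_dot.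
Qed.

Lemma Vnorm2_fin p : V Om p -> Vnorm2 Om p \is a fin_num.
Proof.
move=> [[m1 i1] [m2 i2] _]; rewrite ge0_fin_numE; last first.
  by apply: integral_ge0 => x _; rewrite lee_fin addr_ge0// dot_ge0.
rewrite /Vnorm2; under eq_integral do rewrite EFinD.
rewrite ge0_integralD//; first by rewrite lte_add_pinfty.
- by move=> x _; rewrite lee_fin dot_ge0.
- by apply/measurable_EFinP; exact: measurable_dot.
- by move=> x _; rewrite lee_fin dot_ge0.
- by apply/measurable_EFinP; exact: measurable_dot.
Qed.

(** A real simple function times a fixed vector; the pieces are the level sets. *)
Lemma simple_fun_scale (W : set field2) p (f : {nnsfun mR >-> R}) :
  (forall c, W (c *: p)) -> simple_fun W (fun s => f s *: p).
Proof.
move=> Wp; pose l : seq R := finmap.enum_fset (fset_set (range f)).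
exists (size l), (fun i : 'I_(size l) => f @^-1` [set l`_i]), (fun i => l`_i *: p); split => //.
- move=> i; have mf : measurable_fun setT f by exact: measurable_funP.
  have := mf measurableT _ (measurable_set1 l`_i).
  by rewrite setTI.
- move=> s; rewrite [in LHS]fimfunE fsbig_finite//= -/l.
  rewrite (big_nth 0) big_mkord scaler_suml; apply: eq_bigr => i _.
  by rewrite scalerA mulrC.
Qed.

End scaled_fields.

Section time_by_parts.
Context {R : realType}.
Local Notation lam := (@lebesgue_measure R).
Local Notation mR := (measurableTypeR R).

(** The weak derivative of the ramp: on [0, t] the ramp is the smooth function
t - s, and no boundary term survives since z vanishes at 0 and the ramp at t. *)
Lemma Rintegral_time_by_parts (z : R -> R) (T t : R) : 0 <= t <= T ->
  (forall s, derivable z s 1) -> continuous (fun s => 'D_1 z s) ->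
  (forall s : R, ~~ (0 < s < T) -> z s = 0) ->
  (forall s : R, ~~ (0 < s < T) -> 'D_1 z s = 0) ->
  \int[lam]_s ('D_1 z s * time_ramp t s) = \int[lam]_s (z s * time_step t s).
Proof.
move=> /andP[t0 tT] dz cz z0 Dz0.
have neg (s : R) : s <= 0 -> ~~ (0 < s < T).
  by move=> s0; apply/negP => /andP[]; rewrite ltNge s0.
rewrite -primitive_step; last by move=> s s0; rewrite z0// neg.
rewrite /primitive.
transitivity (\int[lam]_(s in `[0, t]) ((t - s) * 'D_1 z s)).
  rewrite [RHS]Rintegral_mkcond; apply: eq_Rintegral => s _; rewrite patchE.
  have [s0|s0] := leP s 0.
    rewrite Dz0 ?neg// mul0r; case: ifPn => // _; by rewrite mulr0.
  rewrite /time_ramp; have [st|ts] := leP s t.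
    by rewrite max_r ?subr_ge0// mem_set 1?mulrC//= in_itv /= (ltW s0).
  rewrite max_l ?subr_le0 ?ltW// mulr0 memNset//= in_itv /= => /andP[_].
  by rewrite leNgt ts.
move: t0; rewrite le_eqVlt => /predU1P[<-|t0].
  by rewrite set_itv1 !Rintegral_set1.
have zc s : {for s, continuous z}.
  by apply: differentiable_continuous; apply/derivable1_diffP; exact: dz.
have dF (s : R) : is_derive s 1 (fun s : R => t - s) (-1).
  rewrite (_ : (fun s : R => t - s) = cst t - id)//; apply: is_derive_eq.
  by rewrite sub0r.
have Fc s : {for s, continuous (fun s : R => t - s)}.
  by apply: differentiable_continuous; apply/derivable1_diffP; have [] := dF s.
rewrite (@Rintegration_by_parts _ (fun s => t - s) z (fun=> -1) (fun s => 'D_1 z s)) //.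
- rewrite subrr mul0r z0 ?neg// mulr0 subrr sub0r.
  have zi : lam.-integrable `[0, t] (EFin \o z).
    apply: continuous_compact_integrable; first exact: segment_compact.
    exact: continuous_subspaceT.
  by rewrite RintegralZl// mulN1r opprK.
- by apply: continuous_subspaceT => s; exact: cvg_cst.
- split; [by move=> s _; have [] := dF s|..].
  + by apply: cvg_at_right_filter; exact: Fc.
  + by apply: cvg_at_left_filter; exact: Fc.
- by move=> s _; rewrite derive1E; have [_ ->] := dF s.
- exact: continuous_subspaceT.
- split; [by move=> s _; exact: dz|..].
  + by apply: cvg_at_right_filter; exact: zc.
  + by apply: cvg_at_left_filter; exact: zc.
- by move=> s _; rewrite derive1E.
Qed.

End time_by_parts.

Section bounded_domain.
Context {R : realType}.
Local Notation space := (R * R * R)%type.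
Local Notation mR := (measurableTypeR R).
Variable Om : set space.
Hypotheses (mO : measurable (Om : set (mR * mR * mR))) (bO : bounded_set Om).

Lemma integrable_indic_bounded :
  leb3.-integrable setT (EFin \o (\1_Om : mR * mR * mR -> R)).
Proof.
have [A' [_ hA']] := bO; pose A := `|A'| + 1.
apply: (box_integrable3 (A := A) (M := 1)) => //.
- by move=> x; rewrite indicE; case: (_ \in _); rewrite ?normr1 ?normr0.
- move=> x Ax; rewrite indicE memNset// => Ox; have A'A : A' < A.
    by rewrite /A (le_lt_trans (ler_norm _))// ltrDl ltr01.
  by have := hA' A A'A x Ox; rewrite /= leNgt Ax.
Qed.

(** On a bounded domain, |f| <= 1 + f ^ 2 with an integrable right-hand side. *)
Lemma square_integrable_integrable (f : space -> R) :
  square_integrable (@leb3 R) f -> (forall x, ~ Om x -> f x = 0) ->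
  leb3.-integrable setT (EFin \o (f : mR * mR * mR -> R)).
Proof.
move=> [mf fi] f0; have := integrableDR integrable_indic_bounded fi.
apply: le_integrableR => // x; rewrite indicE.
have [xO|xO] := boolP (x \in Om); last first.
  by rewrite f0 ?normr0 ?expr0n ?addr0// => /mem_set; exact/negP.
rewrite ler_norml (_ : true%:R = 1 :> R)//.
have := sqr_ge0 (f x + 1); have := sqr_ge0 (f x - 1).
by move=> ? ?; apply/andP; split; nra.
Qed.

End bounded_domain.

Section admissible_ramp.
Context {R : realType}.
Local Notation space := (R * R * R)%type.
Local Notation mR := (measurableTypeR R).
Local Notation vec := 'cV[R]_3.
Local Notation lam := (@lebesgue_measure R).
Local Notation field2 := ((space -> vec) * (space -> vec))%type.
Variables (Om : set space) (T t : R).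
Hypotheses (oO : open Om) (bO : bounded_set Om) (T0 : 0 < T) (tT : 0 <= t <= T).
Let mO : measurable (Om : set (mR * mR * mR)). Proof. exact: open_measurable3. Qed.
Implicit Types (v : space -> vec) (p : field2) (k : R -> R).

Let out v (i : 'I_3) : space -> R := (fun x => v x i 0) \_ Om.

Lemma Rintegral_restrict4 (D : set (mR * mR * mR * mR)) (F G : mR * mR * mR * mR -> R) :
  (forall q, D q -> F q = G q) -> (forall q, ~ D q -> G q = 0) ->
  \int[leb4]_(q in D) F q = \int[leb4]_q G q.
Proof.
move=> FG G0; rewrite Rintegral_mkcond; apply: eq_Rintegral => q _; rewrite patchE.
by case: ifPn => [/set_mem/FG//|/negP Dq]; rewrite G0// => /mem_set.
Qed.

(** Fubini reduces the definition of the weak time derivative to integration by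
parts on each line {x} x R. Integrability of the products with the spatial
factor v, which is only in L^2, relies on the boundedness of the domain. *)
Lemma is_dt_ramp v : L2 leb3 Om v ->
  is_dt Om T (fun q => time_ramp t q.2 *: v q.1) (fun q => - time_step t q.2 *: v q.1).
Proof.
move=> Lv z i tz; have [sz [K [cK KQ z0]]] := tz.
have zQ q : ~ QT Om T q -> z q = 0 by move=> nQ; apply: z0 => /KQ.
pose e : space * R := (0, 1).
have DzQ q : ~ QT Om T q -> 'D_e z q = 0.
  by move=> nQ; apply: (derive_eq0_out_compact (K := K)) => // /KQ.
have cz : continuous z := smooth_continuous sz.
have cDz : continuous (fun q => 'D_e z q) := smooth_derive_continuous sz.
have [M M0 zM] := continuous_compact_bounded cK cz z0.
have [N N0 DN] : exists2 N : R, 0 <= N & forall q, `|'D_e z q| <= N.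
  apply: (continuous_compact_bounded cK cDz) => q Kq.
  exact: (derive_eq0_out_compact _ cK z0 Kq).
have sv : square_integrable (@leb3 R) (out v i) by exact: square_integrable_L2.
have vi : leb3.-integrable setT (EFin \o (out v i : mR * mR * mR -> R)).
  apply: (square_integrable_integrable mO bO sv) => x Ox.
  by rewrite /out patchE memNset.
have mv : measurable_fun setT (out v i : mR * mR * mR -> R) by case: sv.
have outE x : Om x -> out v i x = v x i 0 by move=> Ox; rewrite /out patchE mem_set.
have nQx x s : ~~ (0 < s < T) -> ~ QT Om T (x, s).
  by move=> /negP sT [/= _]; rewrite in_itv.
have slice (c : space) (s h : R) : (c, h + s) = h *: e + (c, s).
  by congr pair; rewrite /= ?scaler0 ?add0r// [h *: 1]mulr1.
have gen (g : mR * mR * mR * mR -> R) (k : R -> R) (C B : R) :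
    measurable_fun setT g -> measurable_fun setT (k : mR -> R) -> 0 <= C -> 0 <= B ->
    (forall q, `|g q| <= B) -> (forall q, ~ QT Om T q -> g q = 0) ->
    (forall s : R, 0 < s < T -> `|k s| <= C) ->
    (leb3 \x lam)%E.-integrable setT (EFin \o (fun q => out v i q.1 * (g q * k q.2))).
  move=> mg mk C0 B0 gB g0 kC.
  have := integrableZR (B * C) (integrable_tensor (integrable_norm vi) (integrable_indic_time T)).
  apply: le_integrableR.
    apply: measurable_funM; first exact: (measurableT_comp mv measurable_fst).
    by apply: measurable_funM => //; exact: (measurableT_comp mk measurable_snd).
  move=> [x s] /=; have [sT|sT] := boolP (0 < s < T); last first.
    rewrite g0; last exact: nQx.
    by rewrite mul0r mulr0 normr0 !mulr_ge0// indicE.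
  rewrite indicE mem_set /=; last by case/andP: sT => ? ?; rewrite in_itv /= !ltW.
  rewrite mulr1 normrM mulrC ler_wpM2r// normrM ler_pM//.
  exact: kC.
have i1 := gen (fun q => 'D_e z q) (time_ramp t) T N (continuous_measurable4 cDz)
  (measurable_time_ramp t) (ltW T0) N0 DN DzQ.
have {}i1 := i1 (fun s sT => time_ramp_le T0 (proj2 (andP tT)) (proj1 (andP sT))).
have i2 := gen z (time_step t) 1 M (continuous_measurable4 cz)
  (measurable_time_step t) ler01 M0 zM zQ (fun s _ => time_step_le t s).
transitivity (\int[leb4]_q (out v i q.1 * ('D_e z q * time_ramp t q.2))).
  apply: Rintegral_restrict4 => [q [Oq _]|q nQ]; last by rewrite DzQ// mul0r mulr0.
  by rewrite mxE outE//; ring.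
rewrite [LHS](Rintegral_prod12 (m1 := leb3) (m2 := lebesgue_measure) i1).
transitivity (\int[leb4]_q (out v i q.1 * (z q * time_step t q.2))); last first.
  rewrite -[LHS]opprK; congr (- _).
  transitivity (\int[leb4]_q (- (out v i q.1 * (z q * time_step t q.2)))).
    transitivity (- (1 * \int[leb4]_q (out v i q.1 * (z q * time_step t q.2)))).
      by rewrite mul1r.
    rewrite -mulNr -RintegralZl//.
    by apply: eq_Rintegral => q _; rewrite mulN1r.
  symmetry; apply: Rintegral_restrict4 => [q [Oq _]|q nQ]; last by rewrite zQ// mul0r mulr0 oppr0.
  by rewrite mxE outE//; ring.
rewrite [RHS](Rintegral_prod12 (m1 := leb3) (m2 := lebesgue_measure) i2).
apply: eq_Rintegral => x _ /=.
have Dslice s := derive_along z (slice x s).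
have sl1 (s : R) : 'D_1 (z \o pair x) s = 'D_e z (x, s) by have [] := Dslice s.
have csl : continuous (pair x : R -> space * R).
  by apply: continuous_pair; [exact: cst_continuous|move=> s; exact: cvg_id].
have E : \int[lam]_s ('D_1 (z \o pair x) s * time_ramp t s) =
    \int[lam]_s ((z \o pair x) s * time_step t s).
  apply: (Rintegral_time_by_parts tT).
  - by move=> s; have [_ [_ h]] := Dslice s; apply: h; exact: smooth_derivable.
  - rewrite (_ : (fun s : R => 'D_1 (z \o pair x) s) = (fun q => 'D_e z q) \o pair x); last exact/funext.
    by move=> s; apply: continuous_comp; [exact: csl|exact: cDz].
  - by move=> s sT; rewrite /= zQ//; exact: nQx.
  - by move=> s sT; rewrite sl1 DzQ//; exact: nQx.
have zx_meas (g : space * R -> R) : measurable_fun setT (g : mR * mR * mR * mR -> R) ->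
    measurable_fun setT ((fun s => g (x, s)) : mR -> R).
  by move=> mg; exact: (@measurable_time_section _ _ _ g x mg).
have si (g : space * R -> R) (k : R -> R) (C B : R) :
    measurable_fun setT (g : mR * mR * mR * mR -> R) ->
    measurable_fun setT (k : mR -> R) -> 0 <= C -> 0 <= B ->
    (forall q, `|g q| <= B) -> (forall q, ~ QT Om T q -> g q = 0) ->
    (forall s : R, 0 < s < T -> `|k s| <= C) ->
    lam.-integrable setT (EFin \o (fun s => g (x, s) * k s)).
  move=> mg mk C0 B0 gB g0 kC; have := integrableZR (B * C) (integrable_indic_time T).
  apply: le_integrableR; first by apply: measurable_funM => //; exact: zx_meas.
  move=> s; have [sT|sT] := boolP (0 < s < T); last first.
    rewrite g0; last exact: nQx.
    by rewrite mul0r normr0 !mulr_ge0// indicE.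
  rewrite indicE mem_set /=; last by case/andP: sT => ? ?; rewrite in_itv /= !ltW.
  by rewrite mulr1 normrM ler_pM//; exact: kC.
rewrite !RintegralZl//; last first.
- apply: (si _ _ T N (continuous_measurable4 cDz) (measurable_time_ramp t) (ltW T0) N0 DN DzQ).
  by move=> s /andP[s0 _]; apply: time_ramp_le => //; case/andP: tT.
- apply: (si _ _ 1 M (continuous_measurable4 cz) (measurable_time_step t) ler01 M0 zM zQ).
  by move=> s _; exact: time_step_le.
congr (_ * _); rewrite -E; apply: eq_Rintegral => s _; by rewrite sl1.
Qed.

Import HBNNSimple.

Lemma L2_step v : L2 leb3 Om v ->
  L2 leb4 (QT Om T : set (mR * mR * mR * mR)) (fun q => - time_step t q.2 *: v q.1).
Proof.
move=> Lv; pose w (q : mR * mR * mR * mR) : vec :=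
  \col_i (out v i q.1 * (- time_step t q.2 * \1_(`[0, T]%classic : set mR) q.2)).
have mQ := @measurable_QT R Om T mO.
have wE q : QT Om T q -> w q = - time_step t q.2 *: v q.1.
  move=> [Oq]; rewrite /= in_itv /= => /andP[q0 qT]; apply/matrixP => i j.
  rewrite !mxE (ord1 j) /out patchE mem_set// indicE mem_set.
    by rewrite mulr1 mulrC.
  by rewrite /= in_itv /= !ltW.
have [mw Iw] : L2 leb4 (QT Om T : set (mR * mR * mR * mR)) w.
  apply: L2_square_integrable => // i.
  have [mv vi] := square_integrable_L2 i mO Lv.
  have mI : measurable_fun (setT : set mR) (\1_(`[0, T]%classic : set mR) : _ -> R).
    exact: measurable_indic.
  have mk : measurable_fun setT ((fun s => - time_step t s * \1_(`[0, T]%classic : set mR) s) : mR -> R).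
    apply: measurable_funM => //; apply: measurableT_comp => //.
    exact: measurable_time_step.
  have mwi : measurable_fun setT (fun q => w q i 0).
    under eq_fun do rewrite mxE; apply: measurable_funM.
      exact: (measurableT_comp mv measurable_fst).
    exact: (measurableT_comp mk measurable_snd).
  split => //.
  have := integrable_tensor (m1 := leb3) (m2 := lebesgue_measure) vi (integrable_indic_time T).
  apply: le_integrableR; first exact: measurable_funX.
  move=> [x s] /=; rewrite mxE /= exprMn normrM (ger0_norm (sqr_ge0 _)).
  rewrite ler_wpM2l ?sqr_ge0// exprMn sqrrN ger0_norm ?mulr_ge0 ?sqr_ge0//.
  rewrite indicE; case: (_ \in _); rewrite ?expr0n ?mulr0// expr1n mulr1.
  by rewrite /time_step; case: (s <= t); rewrite ?expr1n ?expr0n.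
split.
- apply: (@measurable_field_scale _ Om T mO (fun s => - time_step t s) v); last by case: Lv.
  by apply: measurableT_comp => //; exact: measurable_time_step.
- rewrite (eq_integral (fun q => (dot (w q) (w q))%:E))// => q /set_mem qQ.
  by rewrite wE.
Qed.

Lemma time_ramp_lip s s' : `|time_ramp t s - time_ramp t s'| <= `|s - s'|.
Proof.
have h1 := ler_norm (s - s').
have h2 : - (s - s') <= `|s - s'| by rewrite -normrN ler_norm.
rewrite /time_ramp ler_norml.
by case: (leP 0 (t - s)) => h; case: (leP 0 (t - s')) => h'; apply/andP; split; lra.
Qed.

Lemma cvg_sqr_dist (X : Type) (F : set_system X) (FF : Filter F) (f : X -> R) (a c : R) :
  f x @[x --> F] --> a -> ((f x - a) ^+ 2 * c)%:E @[x --> F] --> 0%E.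
Proof.
move=> fa; have h : (f x - a) ^+ 2 * c @[x --> F] --> (a - a) ^+ 2 * c.
  apply: cvgM; last exact: cvg_cst.
  by rewrite expr2; apply: cvgM; apply: cvgB => //; exact: cvg_cst.
rewrite subrr expr0n mul0r in h.
by apply: cvg_EFin => //; exact: nearW.
Qed.

(** The ramp is 1-Lipschitz in time, so the distance in L^2 between two of its
values is at most the time difference times the norm of v. *)
Lemma continuous_rep_ramp v : L2 leb3 Om v ->
  continuous_rep Om T (fun q => time_ramp t q.2 *: v q.1) (fun s x => time_ramp t s *: v x).
Proof.
move=> Lv; have [mv Iv] := Lv; have mdv := measurable_dot mv.
have dot_int (c : R) : (\int[leb3]_(x in Om) (dot (c *: v x) (c *: v x))%:E =
    (c ^+ 2)%:E * \int[leb3]_(x in Om) (dot (v x) (v x))%:E)%E.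
  rewrite -ge0_integralZl_EFin ?sqr_ge0//.
  - by apply: eq_integral => x _; rewrite dotZ.
  - by move=> x _; rewrite lee_fin dot_ge0.
  - exact/measurable_EFinP.
have I_fin : (\int[leb3]_(x in Om) (dot (v x) (v x))%:E)%E \is a fin_num.
  by rewrite ge0_fin_numE//; apply: integral_ge0 => x _; rewrite lee_fin dot_ge0.
split.
- move=> s _; split.
    move=> i; rewrite (_ : (fun x => _) = (fun x => time_ramp t s * v x i 0)).
      exact: measurable_funM.
    by apply/funext => x; rewrite mxE.
  by rewrite dot_int lte_mul_pinfty// ?lee_fin ?sqr_ge0.
- move=> s0 _; set I := (\int[leb3]_(x in Om) (dot (v x) (v x))%:E)%E in dot_int I_fin *.
  have -> : (fun s => dist2 Om (fun x => time_ramp t s *: v x) (fun x => time_ramp t s0 *: v x)) =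
      (fun s => ((time_ramp t s - time_ramp t s0) ^+ 2 * fine I)%:E).
    apply/funext => s; rewrite /dist2 EFinM fineK// -dot_int.
    by apply: eq_integral => x _; rewrite -scalerBl.
  have rc : time_ramp t s @[s --> s0] --> time_ramp t s0.
    apply/cvgrPdist_le => e e0; near=> s; apply: le_trans (time_ramp_lip _ _) _.
    by near: s; apply: filterS (nbhsx_ballx s0 e e0) => y /ltW.
  apply: cvg_within_filter.
  exact: cvg_sqr_dist rc.
- by apply: aeW => s _; apply: aeW => x _.
Unshelve. all: by end_near. Qed.

(** Strong measurability: the ramp, a nonnegative measurable real function, is
the pointwise limit of simple functions, and multiplying these by p gives
simple functions with values in W, as W is closed under scaling. *)
Lemma L2_time_ramp (W : set field2) p : W p -> (forall c p, W p -> W (c *: p)) ->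
  W `<=` V Om ->
  L2_time W Om T (fun q => time_ramp t q.2 *: p.1 q.1) (fun q => time_ramp t q.2 *: p.2 q.1).
Proof.
move=> Wp WZ WV; have Vp := WV _ Wp; have [[m1 I1] [m2 I2] _] := Vp.
have mk := @measurable_time_ramp R t.
have N_fin := Vnorm2_fin mO Vp.
have sliceE (s : R) : (slice (fun q => time_ramp t q.2 *: p.1 q.1) s,
    slice (fun q => time_ramp t q.2 *: p.2 q.1) s) = time_ramp t s *: p by case: p {Wp Vp m1 I1 m2 I2 N_fin}.
split.
- split; [exact: (measurable_field_scale mO mk m1)|exact: (measurable_field_scale mO mk m2)].
- by apply: aeW => s _; rewrite sliceE; exact: WZ.
- have mEk : measurable_fun setT (EFin \o (time_ramp t : mR -> R)) by exact/measurable_EFinP.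
  pose f := nnsfun_approx measurableT mEk.
  exists (fun n s => f n s *: p); split.
    by move=> n; apply: simple_fun_scale => c; exact: WZ.
  apply: aeW => s _; rewrite sliceE.
  have fs : f n s @[n --> \oo] --> time_ramp t s.
    suff h : (EFin \o f^~ s) @ \oo --> (time_ramp t s)%:E by exact: fine_cvg h.
    apply: (cvg_nnsfun_approx measurableT mEk) => // y _.
    by rewrite lee_fin /time_ramp le_max lexx.
  have -> : (fun n => Vnorm2 Om (time_ramp t s *: p - f n s *: p)) =
      (fun n => ((time_ramp t s - f n s) ^+ 2 * fine (Vnorm2 Om p))%:E).
    by apply/funext => n; rewrite -scalerBl Vnorm2Z// [RHS]EFinM fineK.
  rewrite (_ : (fun n => _) = (fun n => ((f n s - time_ramp t s) ^+ 2 * fine (Vnorm2 Om p))%:E)).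
    exact: cvg_sqr_dist fs.
  by apply/funext => n; rewrite -sqrrN opprB.
- have -> : (\int[lam]_(s in `]0%R, T[) Vnorm2 Om (slice (fun q => (time_ramp t q.2 *: p.1 q.1)%R) s,
      slice (fun q => (time_ramp t q.2 *: p.2 q.1)%R) s) =
      \int[lam]_(s in `]0%R, T[) (time_ramp t s ^+ 2 * fine (Vnorm2 Om p))%:E)%E.
    by apply: eq_integral => s _; rewrite sliceE Vnorm2Z// [RHS]EFinM fineK.
  apply: integrable_lty => //; apply: measurable_bounded_integrable => //.
  + by rewrite /= lebesgue_measure_itv /=; case: ifPn => // _; rewrite -EFinB ltry.
  + apply: measurable_funTS; apply: measurable_funM => //; exact: measurable_funX.
  + exists (T ^+ 2 * fine (Vnorm2 Om p)); split; first exact: num_real.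
    move=> y hy s /=; rewrite in_itv /= => /andP[s0 _]; apply: le_trans (ltW hy).
    have N0 : 0 <= fine (Vnorm2 Om p).
      by apply: fine_ge0; apply: integral_ge0 => x _; rewrite lee_fin addr_ge0// dot_ge0.
    rewrite normrM (ger0_norm N0) ler_wpM2r// ger0_norm ?sqr_ge0//.
    have := time_ramp_le T0 (proj2 (andP tT)) s0.
    by rewrite ler_norml => /andP[]; nra.
Qed.

(** The condition at the final time holds because the ramp vanishes from time t
on, and t <= T. *)
Lemma admissible_ramp (W : set field2) p : W p -> (forall c p, W p -> W (c *: p)) ->
  W `<=` V Om ->
  admissible W Om T (fun q => time_ramp t q.2 *: p.1 q.1) (fun q => time_ramp t q.2 *: p.2 q.1)
    (fun q => - time_step t q.2 *: p.1 q.1) (fun s x => time_ramp t s *: p.1 x).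
Proof.
move=> Wp WZ WV; have [L1 L2 _] := WV _ Wp; split.
- exact: L2_time_ramp.
- exact: L2_step.
- exact: is_dt_ramp.
- exact: continuous_rep_ramp.
- apply: aeW => x _; rewrite /time_ramp max_l ?scale0r// subr_le0.
  by case/andP: tT.
Qed.

End admissible_ramp.

(** * The spaces V and V0 *)

Section L2_operations.
Context d (S : measurableType d) {R : realType}.
Variable m : {measure set S -> \bar R}.
Variable D : set S.
Hypothesis mD : measurable D.
Local Notation vec := 'cV[R]_3.
Implicit Types u v : S -> vec.

(** Extending by zero reduces fields on D to real functions on the whole space. *)
Lemma L2P u : L2 m D u <-> forall i, square_integrable m ((fun x => u x i 0) \_ D).
Proof.
split=> [Lu i|su]; first exact: square_integrable_L2.
have [mu Iu] : L2 m D (fun x => \col_i ((fun x => u x i 0) \_ D) x).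
  by apply: L2_square_integrable => // i; under eq_fun do rewrite mxE.
split=> [i|].
  by apply/(measurable_restrictT _ mD); case: (su i).
rewrite (eq_integral (fun x => (dot (\col_i ((fun x => u x i 0) \_ D) x)
   (\col_i ((fun x => u x i 0) \_ D) x))%:E))// => x xD.
by congr (_%:E); apply: eq_bigr => i _; rewrite !mxE patchE xD.
Qed.

Lemma integrable_dot u v : L2 m D u -> L2 m D v ->
  m.-integrable D (EFin \o (fun x => dot (u x) (v x))).
Proof.
move=> /L2P su /L2P sv.
have := integrable_sumR (index_enum 'I_3) measurableT (fun i => square_integrable_mul (su i) (sv i)).
move=> /(integrableS measurableT mD (@subsetT _ D)); apply: eq_integrable => // x xD /=.
by congr (_%:E); apply: eq_bigr => i _; rewrite !patchE xD.
Qed.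

Lemma L2_add u v : L2 m D u -> L2 m D v -> L2 m D (fun x => u x + v x).
Proof.
move=> /L2P su /L2P sv; apply/L2P => i.
have := square_integrableD (su i) (sv i); congr square_integrable.
by apply/funext => x; rewrite !patchE; case: ifP; rewrite ?addr0// mxE.
Qed.

Lemma L2_scale (c : R) u : L2 m D u -> L2 m D (fun x => c *: u x).
Proof.
move=> /L2P su; apply/L2P => i.
have := square_integrableZ c (su i); congr square_integrable.
by apply/funext => x; rewrite !patchE; case: ifP; rewrite ?mulr0// mxE.
Qed.

Lemma L2_mulmx (a : S -> 'M[R]_3) (M : R) u :
  (forall k l, measurable_fun setT (fun x => a x k l)) ->
  (forall k l x, `|a x k l| <= M) -> L2 m D u -> L2 m D (fun x => a x *m u x).
Proof.
move=> ma aM /L2P su; apply/L2P => i.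
have := square_integrable_sum (index_enum 'I_3)
  (fun j => square_integrable_bounded (ma i j) (aM i j) (su j)).
congr square_integrable; apply/funext => x; rewrite !patchE.
case: ifP => xD; last by rewrite big1// => j _; rewrite patchE xD mulr0.
by rewrite mxE; apply: eq_bigr => j _; rewrite patchE xD.
Qed.

Lemma L2_0 : L2 m D (fun=> 0).
Proof.
apply/L2P => i; have := square_integrable0 m; congr square_integrable.
by apply/funext => x; rewrite patchE mxE; case: ifP.
Qed.

End L2_operations.

Section curl_spaces.
Context {R : realType}.
Local Notation space := (R * R * R)%type.
Local Notation mR := (measurableTypeR R).
Local Notation vec := 'cV[R]_3.
Local Notation field2 := ((space -> vec) * (space -> vec))%type.
Variable Om : set space.
Hypothesis mO : measurable (Om : set (mR * mR * mR)).

Lemma dotC (u v : vec) : dot u v = dot v u.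
Proof. by apply: eq_bigr => i _; rewrite mulrC. Qed.

Lemma dotDl (u v w : vec) : dot (u + v) w = dot u w + dot v w.
Proof. by rewrite -big_split; apply: eq_bigr => i _; rewrite mxE mulrDl. Qed.

Lemma dotZl (c : R) (u v : vec) : dot (c *: u) v = c * dot u v.
Proof. by rewrite mulr_sumr; apply: eq_bigr => i _; rewrite mxE mulrA. Qed.

Lemma dotZr (c : R) (u v : vec) : dot u (c *: v) = c * dot u v.
Proof. by rewrite dotC dotZl dotC. Qed.

Lemma dot0l (u : vec) : dot 0 u = 0.
Proof. by rewrite -(scale0r 0) dotZl mul0r. Qed.

Lemma dot0r (u : vec) : dot u 0 = 0.
Proof. by rewrite dotC dot0l. Qed.

Lemma dotNl (u v : vec) : dot (- u) v = - dot u v.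
Proof. by rewrite -scaleN1r dotZl mulN1r. Qed.

Lemma dot_mulmxl (a : 'M[R]_3) (u v : vec) : dot (a *m u) v = dot u (a^T *m v).
Proof.
rewrite /dot; under eq_bigr do rewrite mxE mulr_suml.
rewrite exchange_big; apply: eq_bigr => j _; rewrite mxE mulr_sumr.
by apply: eq_bigr => i _; rewrite mxE [_ * u j 0]mulrC mulrA.
Qed.

Lemma Rintegral_dotZl (c : R) u v : L2 leb3 Om u -> L2 leb3 Om v ->
  \int[leb3]_(x in Om) dot (c *: u x) (v x) = c * \int[leb3]_(x in Om) dot (u x) (v x).
Proof.
move=> Lu Lv; rewrite -RintegralZl//; last exact: (integrable_dot mO Lu Lv).
by apply: eq_Rintegral => x _; rewrite dotZl.
Qed.

Lemma V_scale (c : R) p : V Om p -> V Om (c *: p).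
Proof.
move=> [L1 L2 cp]; split; [exact: (L2_scale mO c L1)|exact: (L2_scale mO c L2)|].
move=> z tz; have [Lz Lcz _] := V_test mO tz.
by rewrite !Rintegral_dotZl// cp.
Qed.

Lemma V0_scale (c : R) p : V0 Om p -> V0 Om (c *: p).
Proof.
move=> [Vp p0]; split=> [|z Vz]; first exact: V_scale.
have [L1 L2 _] := Vp; have [Lz Lcz _] := Vz.
by rewrite !Rintegral_dotZl// p0.
Qed.

Lemma V0_zero : V0 Om 0.
Proof.
split=> [|z _]; last by under eq_Rintegral do rewrite dot0l;
  under [RHS]eq_Rintegral do rewrite dot0l.
split; [exact: L2_0|exact: L2_0|move=> z _].
by under eq_Rintegral do rewrite dot0l; under [RHS]eq_Rintegral do rewrite dot0l.
Qed.

(** Test fields are in V0 by the very definition of the distributional curl of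
the elements of V. *)
Lemma V0_test (z : space -> vec) : (forall i, test_function Om (fun x => z x i 0)) ->
  V0 Om (z, classical_curl z).
Proof.
move=> tz; split=> [|w [_ _ cw]]; first exact: V_test.
under eq_Rintegral do rewrite dotC; under [RHS]eq_Rintegral do rewrite dotC.
exact: cw.
Qed.

End curl_spaces.

(** * Pairing time fields with ramp test functions *)

Section field_primitives.
Context {R : realType}.
Local Notation space := (R * R * R)%type.
Local Notation mR := (measurableTypeR R).
Local Notation spacetime := (mR * mR * mR * mR)%type.
Local Notation vec := 'cV[R]_3.
Local Notation lam := (@lebesgue_measure R).
Variables (Om : set space) (T : R).
Hypotheses (mO : measurable (Om : set (mR * mR * mR))) (T0 : 0 < T).
Implicit Types (u : space * R -> vec) (c : space -> vec).

Definition time_vfield u : Prop :=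
  forall i, time_field leb3 T (fun q : spacetime => u q i 0).

Definition vprimitive u (t : R) (x : space) : vec :=
  \col_i time_primitive (fun q : spacetime => u q i 0) (x, t).

Definition vprimitive2 u (t : R) (x : space) : vec :=
  \col_i time_primitive (time_primitive (fun q : spacetime => u q i 0)) (x, t).

Lemma L2_vprimitive u (t : R) : time_vfield u -> L2 leb3 Om (vprimitive u t).
Proof.
move=> tu; apply: L2_square_integrable => // i; under eq_fun do rewrite mxE.
exact: (square_integrable_primitive T0 t (tu i)).
Qed.

Lemma L2_vprimitive2 u (t : R) : time_vfield u -> 0 <= t <= T ->
  L2 leb3 Om (vprimitive2 u t).
Proof.
move=> tu tT; apply: L2_square_integrable => // i; under eq_fun do rewrite mxE.
exact: (square_integrable_primitive2 T0 (tu i) tT).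
Qed.

Lemma time_primitive_eq0 (f : spacetime -> R) (t : R) x :
  (forall s : R, f (x, s) = 0) -> time_primitive f (x, t) = 0.
Proof.
move=> f0; rewrite /time_primitive /primitive /=.
by under eq_Rintegral do rewrite f0; rewrite /Rintegral integral0.
Qed.

Lemma vprimitive_eq0 u (t : R) x : (forall s, u (x, s) = 0) -> vprimitive u t x = 0.
Proof.
move=> u0; apply/matrixP => i j; rewrite !mxE time_primitive_eq0// => s.
by rewrite u0 mxE.
Qed.

Lemma vprimitive2_eq0 u (t : R) x : (forall s, u (x, s) = 0) -> vprimitive2 u t x = 0.
Proof.
move=> u0; apply/matrixP => i j; rewrite !mxE time_primitive_eq0// => s.
by rewrite time_primitive_eq0// => r; rewrite u0 mxE.
Qed.

(** The common part of the step and ramp cases: J f is the primitive, first or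
second, that the weight k extracts from f. Integrability is part of the
conclusion since the terms of the weak formulation must be separated. *)
Lemma Rintegral_dot_weight u c (k : mR -> R) (C : R)
    (J : (spacetime -> R) -> mR * mR * mR -> R) :
  measurable_fun setT k -> 0 <= C -> (forall s : R, 0 < s < T -> `|k s| <= C) ->
  (forall f, time_field leb3 T f -> square_integrable leb3 (J f)) ->
  (forall f b, time_field leb3 T f -> square_integrable leb3 b ->
    \int[(leb3 \x lam)%E]_q (f q * (b q.1 * k q.2)) = \int[leb3]_x (J f x * b x)) ->
  time_vfield u -> L2 leb3 Om c ->
  leb4.-integrable (QT Om T : set spacetime)
     (EFin \o (fun q => dot (u q) (k q.2 *: c q.1))) /\
  \int[leb4]_(q in QT Om T) dot (u q) (k q.2 *: c q.1) =
  \int[leb3]_(x in Om) dot (\col_i J (fun q => u q i 0) x) (c x).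
Proof.
move=> mk C0 kC JL J_eq tu /(L2P _ mO) sc.
pose F i (q : spacetime) := u q i 0 * (((fun x => c x i 0) \_ Om) q.1 * k q.2).
have Fi i : leb4.-integrable setT (EFin \o F i).
  exact: (time_field_weight (m := leb3) (tu i) (sc i) mk C0 kC).
have FE (q : spacetime) : QT Om T q -> dot (u q) (k q.2 *: c q.1) = \sum_i F i q.
  move=> [Oq _]; apply: eq_bigr => i _.
  by rewrite /F patchE mem_set// mxE [k _ * _]mulrC.
have F0 (q : spacetime) : ~ QT Om T q -> \sum_i F i q = 0.
  case: q => x s nQ; rewrite big1// => i _; rewrite /F patchE; case: ifPn => [/set_mem Ox|_].
    have [_ u0 _ _] := tu i; rewrite u0 ?mul0r//.
    by apply/negP => sT; apply: nQ; split => //=; rewrite in_itv.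
  by rewrite mul0r mulr0.
have mQ := @measurable_QT R Om T mO.
split.
  have := integrable_sumR (index_enum 'I_3) measurableT Fi.
  move=> /(integrableS measurableT mQ (@subsetT _ _)); apply: eq_integrable => // q /set_mem Qq /=.
  by rewrite FE.
rewrite (Rintegral_restrict4 FE F0) Rintegral_sum//.
have FJ i : \int[leb4]_q F i q =
    \int[leb3]_x (J (fun q => u q i 0) x * ((fun x => c x i 0) \_ Om) x).
  exact: (J_eq _ _ (tu i) (sc i)).
under eq_bigr => i _ do rewrite FJ.
have Ji i : leb3.-integrable setT
    (EFin \o (fun x => J (fun q => u q i 0) x * ((fun x => c x i 0) \_ Om) x)).
  by apply: square_integrable_mul => //; exact: JL.
rewrite -Rintegral_sum// [RHS]Rintegral_mkcond; apply: eq_Rintegral => x _; rewrite patchE.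
case: ifP => xO; last by rewrite big1// => i _; rewrite patchE xO mulr0.
by apply: eq_bigr => i _; rewrite patchE xO mxE.
Qed.

Lemma Rintegral_dot_step u c (t : R) : time_vfield u -> L2 leb3 Om c ->
  leb4.-integrable (QT Om T : set spacetime)
     (EFin \o (fun q => dot (u q) (time_step t q.2 *: c q.1))) /\
  \int[leb4]_(q in QT Om T) dot (u q) (time_step t q.2 *: c q.1) =
  \int[leb3]_(x in Om) dot (vprimitive u t x) (c x).
Proof.
apply: (Rintegral_dot_weight (J := fun f x => time_primitive f (x, t))
  (measurable_time_step t) ler01).
- by move=> s _; exact: time_step_le.
- by move=> f tf; exact: (square_integrable_primitive T0 t tf).
- by move=> f b tf sb; exact: (Rintegral_time_step t tf sb).
Qed.

Lemma Rintegral_dot_ramp u c (t : R) : 0 <= t <= T -> time_vfield u -> L2 leb3 Om c ->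
  leb4.-integrable (QT Om T : set spacetime)
     (EFin \o (fun q => dot (u q) (time_ramp t q.2 *: c q.1))) /\
  \int[leb4]_(q in QT Om T) dot (u q) (time_ramp t q.2 *: c q.1) =
  \int[leb3]_(x in Om) dot (vprimitive2 u t x) (c x).
Proof.
move=> tT.
apply: (Rintegral_dot_weight (J := fun f x => time_primitive (time_primitive f) (x, t))
  (measurable_time_ramp t) (ltW T0)).
- by move=> s /andP[s0 _]; apply: time_ramp_le => //; case/andP: tT.
- by move=> f tf; exact: (square_integrable_primitive2 T0 tf tT).
- by move=> f b tf sb; exact: (Rintegral_time_ramp T0 tf sb tT).
Qed.

(** The representative is zero outside Q_T, so that its primitives vanish outside
the domain. *)
Lemma L2_time_vfield u : L2 leb4 (QT Om T : set spacetime) u ->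
  exists u' : space * R -> vec,
    [/\ time_vfield u', {ae leb4, forall q : spacetime, QT Om T q -> u q = u' q} &
        forall q, ~ QT Om T q -> u' q = 0].
Proof.
move=> Lu; have mQ := @measurable_QT R Om T mO.
have /choice[f hf] : forall i, exists f : spacetime -> R, [/\ time_field leb3 T f,
    {ae (leb3 \x lam)%E, forall q, ((fun q => u q i 0) \_ (QT Om T : set spacetime)) q = f q} &
    forall q, ((fun q => u q i 0) \_ (QT Om T : set spacetime)) q = 0 -> f q = 0].
  move=> i; have sg := square_integrable_L2 i mQ Lu.
  apply: (square_integrable_time_field (m := leb3) sg).
  move=> x s sT; rewrite patchE memNset// => -[_ /=]; rewrite in_itv /= => sT'.
  by rewrite sT' in sT.
exists (fun q => \col_i f i q); split.
- move=> i; have [tf _ _] := hf i; congr time_field: tf.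
  by apply/funext => q; rewrite mxE.
- have : {ae leb4, forall q : spacetime, forall i,
      ((fun q => u q i 0) \_ (QT Om T : set spacetime)) q = f i q}.
    by apply: filter_forall => i; have [_ h _] := hf i.
  apply: filterS => q h Qq; apply/matrixP => i j; rewrite mxE -h patchE mem_set//.
  by rewrite (ord1 j).
- move=> q nQ; apply/matrixP => i j; rewrite !mxE; have [_ _ ->//] := hf i.
  by rewrite patchE memNset.
Qed.

End field_primitives.

(** * The equation at a fixed time *)

Section ae_combination.
Context d (X : measurableType d) {R : realType}.
Variable m : {measure set X -> \bar R}.
Implicit Types P Q S U : X -> Prop.

Lemma ae_imply2 P Q S : (forall x, P x -> Q x -> S x) ->
  {ae m, forall x, P x} -> {ae m, forall x, Q x} -> {ae m, forall x, S x}.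
Proof. by move=> PQS; apply: filterS2. Qed.

Lemma ae_imply3 P Q S U : (forall x, P x -> Q x -> S x -> U x) ->
  {ae m, forall x, P x} -> {ae m, forall x, Q x} -> {ae m, forall x, S x} ->
  {ae m, forall x, U x}.
Proof. by move=> PQSU; apply: filterS3. Qed.

End ae_combination.

(** The linear algebra of the energy balance: a, b, c stand for its three terms,
each of which occurs twice among the five terms of the tested equation. *)
Lemma doubled_sum_eq0 (R : realFieldType) (a b c x1 x2 x3 x4 x5 : R) :
  x1 = a -> x2 = b -> x3 = - b -> x4 = a + c -> x5 = c ->
  x1 + x2 - x3 + x4 + x5 = 0 -> a + b + c = 0.
Proof. by move=> -> -> -> -> ->; lra. Qed.

Section tested_equation.
Context {R : realType}.
Local Notation space := (R * R * R)%type.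
Local Notation mR := (measurableTypeR R).
Local Notation spacetime := (mR * mR * mR * mR)%type.
Local Notation vec := 'cV[R]_3.
Local Notation lam := (@lebesgue_measure R).
Variables (Om : set space) (T : R).
Hypotheses (oO : open Om) (bO : bounded_set Om) (T0 : 0 < T).
Let mO : measurable (Om : set (mR * mR * mR)). Proof. exact: open_measurable3. Qed.

Lemma ae_leb4_fst (P : mR * mR * mR -> Prop) : {ae leb3, forall x, P x} ->
  {ae leb4, forall q : spacetime, P q.1}.
Proof.
move=> [N [mN N0 PN]]; exists (N `*` setT); split.
- exact: measurableX.
- have -> : leb4 (N `*` setT) = (leb3 N * lam setT)%E by exact: product_measure1E.
  by rewrite [leb3 N]N0 mul0e.
- by move=> [x s] /= nP; split => //; apply: PN.
Qed.

Lemma RintegralN d (X : measurableType d) (m : {measure set X -> \bar R}) (D : set X)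
    (f : X -> R) : measurable D -> m.-integrable D (EFin \o f) ->
  \int[m]_(x in D) (- f x) = - \int[m]_(x in D) f x.
Proof.
move=> mD fi; rewrite -mulN1r -RintegralZl//.
by apply: eq_Rintegral => x _; rewrite mulN1r.
Qed.

Lemma L2_coefficient (a : mR * mR * mR -> 'M[R]_3) (u : mR * mR * mR -> vec) (M : R) :
  (forall k l, measurable_fun setT (fun x => a x k l)) ->
  (forall k l x, `|a x k l| <= M) -> L2 leb3 Om u -> L2 leb3 Om (fun x => a x *m u x).
Proof. exact: L2_mulmx. Qed.

(* [ep], [m], [sg] are the Borel coefficients and [e'], [h'] the representatives
whose sections in time are square integrable. *)
Variables (eps mu sigma ep m sg : space -> 'M[R]_3) (e h e' h' : space * R -> vec).
Variables (e0 h0 : space -> vec) (M : R).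
Hypotheses (mep : forall k l, measurable_fun setT (fun x : mR * mR * mR => ep x k l))
  (mm : forall k l, measurable_fun setT (fun x : mR * mR * mR => m x k l))
  (msg : forall k l, measurable_fun setT (fun x : mR * mR * mR => sg x k l)).
Hypotheses (epM : forall k l x, `|ep x k l| <= M) (mM : forall k l x, `|m x k l| <= M)
  (sgM : forall k l x, `|sg x k l| <= M).
Hypotheses (ep_sym : forall x, (ep x)^T = ep x) (m_sym : forall x, (m x)^T = m x).
Hypotheses (epE : {ae leb3, forall x, Om x -> eps x = ep x})
  (mE : {ae leb3, forall x, Om x -> mu x = m x})
  (sgE : {ae leb3, forall x, Om x -> sigma x = sg x}).
Hypotheses (te : time_vfield T e') (th : time_vfield T h').
Hypotheses (eE : {ae leb4, forall q : spacetime, QT Om T q -> e q = e' q})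
  (hE : {ae leb4, forall q : spacetime, QT Om T q -> h q = h' q}).
Hypotheses (e0_eq0 : {ae leb3, forall x, Om x -> e0 x = 0})
  (h0_eq0 : {ae leb3, forall x, Om x -> h0 x = 0}).
Hypothesis sol : weak_solution Om T eps mu (fun p => sigma p.1 *m e p) e0 h0 e h.
Implicit Types (v w : (space -> vec) * (space -> vec)).

(** The weak formulation for ramp test functions. The coefficients are moved onto
the spatial factors, which leaves scalar products of e and h with separated
fields; steps and ramps then produce first and second primitives. *)
Lemma tested_equation v w (t : R) : V0 Om v -> V Om w -> 0 <= t <= T ->
  \int[leb3]_(x in Om) dot (vprimitive e' t x) (ep x *m v.1 x) +
  \int[leb3]_(x in Om) dot (vprimitive h' t x) (m x *m w.1 x) -
  \int[leb3]_(x in Om) dot (vprimitive2 h' t x) (v.2 x) +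
  \int[leb3]_(x in Om) dot (vprimitive2 e' t x) (w.2 x) +
  \int[leb3]_(x in Om) dot (vprimitive2 e' t x) ((sg x)^T *m v.1 x) = 0.
Proof.
move=> v0 Vw tT; have [Vv _] := v0; have [Lv1 Lv2 _] := Vv; have [Lw1 Lw2 _] := Vw.
have [_ _ weak] := sol.
have subV : V0 Om `<=` V Om by move=> p [].
have adm_v := admissible_ramp oO bO T0 tT v0 (V0_scale mO) subV.
have adm_w := admissible_ramp oO bO T0 tT Vw (V_scale mO) (@subset_refl _ _).
have := weak _ _ _ _ _ _ _ _ adm_v adm_w.
have emE : {ae leb3, forall x, Om x -> eps x = ep x /\ mu x = m x}.
  by apply: ae_imply2 epE mE => x epx mx Ox; rewrite epx// mx.
have emE4 := ae_leb4_fst emE; have sgE4 := ae_leb4_fst sgE.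
have mQ := @measurable_QT R Om T mO.
have Lep : L2 leb3 Om (fun x => ep x *m v.1 x) by exact: (L2_coefficient mep epM).
have Lm : L2 leb3 Om (fun x => m x *m w.1 x) by exact: (L2_coefficient mm mM).
have Lsg : L2 leb3 Om (fun x => (sg x)^T *m v.1 x).
  have msgT k l : measurable_fun setT (fun x : mR * mR * mR => (sg x)^T k l).
    rewrite (_ : (fun x => _) = (fun x => sg x l k)); first exact: msg.
    by apply/funext => x; rewrite mxE.
  have sgTM k l x : `|(sg x)^T k l| <= M by rewrite mxE.
  exact: (L2_coefficient msgT sgTM).
have [i1 E1] := Rintegral_dot_step mO T0 t te Lep.
have [i2 E2] := Rintegral_dot_step mO T0 t th Lm.
have [i3 E3] := Rintegral_dot_ramp mO T0 tT th Lv2.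
have [i4 E4] := Rintegral_dot_ramp mO T0 tT te Lw2.
have [i5 E5] := Rintegral_dot_ramp mO T0 tT te Lsg.
have -> : \int[leb4]_(p in QT Om T) (dot (eps p.1 *m e p) (- time_step t p.2 *: v.1 p.1) +
      dot (mu p.1 *m h p) (- time_step t p.2 *: w.1 p.1)) =
    - (\int[leb3]_(x in Om) dot (vprimitive e' t x) (ep x *m v.1 x) +
       \int[leb3]_(x in Om) dot (vprimitive h' t x) (m x *m w.1 x)).
  rewrite -E1 -E2 -RintegralD// -RintegralN//; last first.
    have := integrableD mQ i1 i2.
    by apply: eq_integrable => // q _; rewrite /= EFinD.
  apply: ae_eq_Rintegral_in.
  apply: ae_imply3 emE4 eE hE => q emq Eq Hq Qq.
  have [Oq _] := Qq; have [-> ->] := emq Oq; rewrite Eq// Hq//.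
  by rewrite !dot_mulmxl ep_sym m_sym -!scalemxAr !dotZr; ring.
have -> : \int[leb4]_(p in QT Om T) (- dot (h p) (time_ramp t p.2 *: v.2 p.1) +
      dot (e p) (time_ramp t p.2 *: w.2 p.1)) =
    - (\int[leb3]_(x in Om) dot (vprimitive2 h' t x) (v.2 x)) +
    \int[leb3]_(x in Om) dot (vprimitive2 e' t x) (w.2 x).
  rewrite -E3 -E4 -RintegralN// -RintegralD//; last first.
    have := integrableN i3.
    by apply: eq_integrable => // q _; rewrite /= EFinN.
  apply: ae_eq_Rintegral_in.
  by apply: ae_imply2 eE hE => q Eq Hq Qq; rewrite Eq// Hq.
have -> : \int[leb4]_(p in QT Om T) dot (sigma p.1 *m e p) (time_ramp t p.2 *: v.1 p.1) =
    \int[leb3]_(x in Om) dot (vprimitive2 e' t x) ((sg x)^T *m v.1 x).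
  rewrite -E5; apply: ae_eq_Rintegral_in.
  apply: ae_imply2 eE sgE4 => q Eq sq Qq.
  by rewrite Eq// sq ?dot_mulmxl ?scalemxAr//; case: Qq.
have -> : \int[leb3]_(x in Om) (dot (eps x *m e0 x) (time_ramp t 0 *: v.1 x) +
    dot (mu x *m h0 x) (time_ramp t 0 *: w.1 x)) = \int[leb3]_(x in Om) (0 : R).
  apply: ae_eq_Rintegral_in.
  apply: ae_imply2 e0_eq0 h0_eq0 => x E0 H0 Ox.
  by rewrite E0// H0// !mulmx0 !dot0l addr0.
rewrite /Rintegral integral0 /= => E; rewrite -[RHS]E; ring.
Qed.

Let A t x := vprimitive e' t x.
Let B t x := vprimitive h' t x.
Let A2 t x := vprimitive2 e' t x.
Let B2 t x := vprimitive2 h' t x.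

Let L2A t : L2 leb3 Om (A t). Proof. exact: (L2_vprimitive mO T0 t te). Qed.
Let L2B t : L2 leb3 Om (B t). Proof. exact: (L2_vprimitive mO T0 t th). Qed.
Let L2A2 (t : R) : 0 <= t <= T -> L2 leb3 Om (A2 t).
Proof. exact: (L2_vprimitive2 mO T0 te). Qed.
Let L2B2 (t : R) : 0 <= t <= T -> L2 leb3 Om (B2 t).
Proof. exact: (L2_vprimitive2 mO T0 th). Qed.

Let Rintegral_dot0 (u : space -> vec) :
  \int[leb3]_(x in Om) dot (u x) ((0 : space -> vec) x) = 0.
Proof. by under eq_Rintegral do rewrite dot0r; rewrite /Rintegral integral0. Qed.

Let Rintegral_dot_mx0 (u : space -> vec) (a : space -> 'M[R]_3) :
  \int[leb3]_(x in Om) dot (u x) (a x *m (0 : space -> vec) x) = 0.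
Proof.
by under eq_Rintegral do rewrite mulmx0 dot0r; rewrite /Rintegral integral0.
Qed.

(* The case v = 0. *)
Let electric_curl_in (t : R) w : V Om w -> 0 <= t <= T ->
  \int[leb3]_(x in Om) dot (A2 t x) (w.2 x) =
  \int[leb3]_(x in Om) dot (- (m x *m B t x)) (w.1 x).
Proof.
move=> Vw tT; have := tested_equation (V0_zero mO) Vw tT.
rewrite !Rintegral_dot_mx0 Rintegral_dot0 add0r subr0 addr0 => /eqP.
rewrite addrC addr_eq0 => /eqP ->.
have [Lw _ _] := Vw; have LmB := L2_coefficient mm mM (L2B t).
rewrite -RintegralN//; last exact: (integrable_dot mO (L2B t) (L2_coefficient mm mM Lw)).
by apply: eq_Rintegral => x _; rewrite dotNl dot_mulmxl m_sym.
Qed.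

(** The tested equation with v = 0 holds for every w in V, which is the boundary
condition that defines V0; for test fields w it is the definition of the
distributional curl. *)
Lemma V0_electric_primitive (t : R) : 0 <= t <= T ->
  V0 Om (A2 t, fun x => - (m x *m B t x)).
Proof.
move=> tT; split=> [|w Vw]; last by rewrite electric_curl_in.
split; first exact: L2A2.
  have := L2_scale mO (-1) (L2_coefficient mm mM (L2B t)); congr L2.
  by apply/funext => x; rewrite scaleN1r.
by move=> z tz; rewrite (electric_curl_in (V_test mO tz) tT).
Qed.

(** Here w = 0 and v runs over test fields, which are in V0. *)
Lemma V_magnetic_primitive (t : R) : 0 <= t <= T ->
  V Om (B2 t, fun x => ep x *m A t x + sg x *m A2 t x).
Proof.
move=> tT; have LeA := L2_coefficient mep epM (L2A t).
have LsA := L2_coefficient msg sgM (L2A2 tT).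
split; [exact: L2B2|exact: (L2_add mO LeA LsA)|move=> z tz].
have [[Lz _ _] _] := V0_test mO tz.
have := tested_equation (V0_test mO tz) (V0_zero mO).1 tT.
rewrite Rintegral_dot_mx0 Rintegral_dot0 !addr0 => /eqP.
rewrite addrAC subr_eq0 => /eqP /= <-.
transitivity (\int[leb3]_(x in Om) (dot (ep x *m A t x) (z x) + dot (sg x *m A2 t x) (z x))); last first.
  by apply: eq_Rintegral => x _; rewrite dotDl.
rewrite RintegralD//; [|exact: (integrable_dot mO LeA Lz)|exact: (integrable_dot mO LsA Lz)].
congr (_ + _); apply: eq_Rintegral => x _; by rewrite dot_mulmxl ?ep_sym.
Qed.

(** The tested equation with v = J E and w = J H, the fields of the two preceding
lemmas. The term of curl v = - mu H repeats the one in mu; the term of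
curl w = eps E + sigma J E repeats those in eps and sigma. *)
Lemma energy_balance (t : R) : 0 <= t <= T ->
  \int[leb3]_(x in Om) (dot (ep x *m A t x) (A2 t x) + dot (m x *m B t x) (B2 t x)
                        + dot (sg x *m A2 t x) (A2 t x)) = 0.
Proof.
move=> tT.
have tested := tested_equation (V0_electric_primitive tT) (V_magnetic_primitive tT) tT.
have LeA := L2_coefficient mep epM (L2A t); have LmB := L2_coefficient mm mM (L2B t).
have LsA := L2_coefficient msg sgM (L2A2 tT).
have i1 := integrable_dot mO LeA (L2A2 tT).
have i2 := integrable_dot mO LmB (L2B2 tT).
have i3 := integrable_dot mO LsA (L2A2 tT).
have i12 : leb3.-integrable (Om : set (mR * mR * mR)) (EFin \o (fun x =>
    dot (ep x *m A t x) (A2 t x) + dot (m x *m B t x) (B2 t x))).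
  by have := integrableD mO i1 i2; apply: eq_integrable => // x _; rewrite /= EFinD.
pose a := \int[leb3]_(x in Om) dot (ep x *m A t x) (A2 t x).
pose b := \int[leb3]_(x in Om) dot (m x *m B t x) (B2 t x).
pose c := \int[leb3]_(x in Om) dot (sg x *m A2 t x) (A2 t x).
have E1 : \int[leb3]_(x in Om) dot (A t x) (ep x *m A2 t x) = a.
  by apply: eq_Rintegral => x _; rewrite dot_mulmxl ep_sym.
have E2 : \int[leb3]_(x in Om) dot (B t x) (m x *m B2 t x) = b.
  by apply: eq_Rintegral => x _; rewrite dot_mulmxl m_sym.
have E3 : \int[leb3]_(x in Om) dot (B2 t x) (- (m x *m B t x)) = - b.
  by apply: etrans (RintegralN mO i2); apply: eq_Rintegral => x _; rewrite dotC dotNl.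
have E4 : \int[leb3]_(x in Om) dot (A2 t x) (ep x *m A t x + sg x *m A2 t x) = a + c.
  by apply: etrans (RintegralD mO i1 i3); apply: eq_Rintegral => x _; rewrite dotC dotDl.
have E5 : \int[leb3]_(x in Om) dot (A2 t x) ((sg x)^T *m A2 t x) = c.
  by apply: eq_Rintegral => x _; rewrite dot_mulmxl.
have -> : \int[leb3]_(x in Om) (dot (ep x *m A t x) (A2 t x) + dot (m x *m B t x) (B2 t x)
    + dot (sg x *m A2 t x) (A2 t x)) = a + b + c.
  apply: etrans (RintegralD mO i12 i3) _; congr (_ + _).
  exact: (RintegralD mO i1 i2).
exact: (doubled_sum_eq0 E1 E2 E3 E4 E5 tested).
Qed.

End tested_equation.

(** * Uniqueness *)

Section block_forms.
Context {R : realType}.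
Implicit Types (p q : 'M[R]_3) (f g : 'I_3 + 'I_3 -> R).

(** The pair (e, h) is treated as one vector with six components; this is the
block diagonal matrix of the coefficients. *)
Definition block_entry p q (i j : 'I_3 + 'I_3) : R :=
  match i, j with
  | inl k, inl l => p k l
  | inr k, inr l => q k l
  | _, _ => 0
  end.

Lemma block_formE p q f g :
  \sum_i \sum_j block_entry p q i j * f j * g i =
  dot (p *m \col_k f (inl k)) (\col_k g (inl k)) +
  dot (q *m \col_k f (inr k)) (\col_k g (inr k)).
Proof.
rewrite big_sumType /=; congr (_ + _); apply: eq_bigr => k _; rewrite big_sumType /=.
- rewrite [X in _ + X]big1 ?addr0 => [|l _]; last by rewrite !mul0r.
  by rewrite !mxE mulr_suml; apply: eq_bigr => l _; rewrite mxE.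
- rewrite [X in X + _]big1 ?add0r => [|l _]; last by rewrite !mul0r.
  by rewrite !mxE mulr_suml; apply: eq_bigr => l _; rewrite mxE.
Qed.

Lemma block_entry_le p q (M : R) i j : 0 <= M -> (forall k l, `|p k l| <= M) ->
  (forall k l, `|q k l| <= M) -> `|block_entry p q i j| <= M.
Proof. by move=> M0 pM qM; case: i j => [k|k] [l|l] //=; rewrite normr0. Qed.

Lemma block_coercive p q (c d : R) f :
  (forall xi, c * dot xi xi <= dot (p *m xi) xi) ->
  (forall xi, d * dot xi xi <= dot (q *m xi) xi) ->
  Num.min c d * \sum_i f i ^+ 2 <= \sum_i \sum_j block_entry p q i j * f j * f i.
Proof.
move=> pc qd; rewrite block_formE big_sumType /= mulrDr.
have fE (s : 'I_3 -> 'I_3 + 'I_3) :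
    \sum_k f (s k) ^+ 2 = dot (\col_k f (s k)) (\col_k f (s k)).
  by apply: eq_bigr => k _; rewrite !mxE expr2.
rewrite (fE inl) (fE inr); apply: lerD.
- by apply: le_trans (pc _); rewrite ler_wpM2r ?dot_ge0// ge_min lexx.
- by apply: le_trans (qd _); rewrite ler_wpM2r ?dot_ge0// ge_min lexx orbT.
Qed.

End block_forms.

Lemma borel_coefficient (R : realType) (Om : set (R * R * R))
    (a : R * R * R -> 'M[R]_3) (P : 'M[R]_3 -> Prop) (a0 : 'M[R]_3) :
  open Om -> bounded_measurable_mx Om a -> P a0 -> (forall x, Om x -> P (a x)) ->
  exists b : R * R * R -> 'M[R]_3,
    [/\ forall k l, measurable_fun setT
          (fun x : measurableTypeR R * measurableTypeR R * measurableTypeR R => b x k l),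
        exists2 M : R, 0 <= M & forall k l x, `|b x k l| <= M,
        forall x, P (b x) &
        {ae leb3, forall x, Om x -> a x = b x}].
Proof.
move=> oO abm Pa0 Pa; have mO := open_measurable3 oO.
exact: (@borel_version_mx _ _ R leb3 Om 3 a P a0 mO abm Pa0 Pa).
Qed.

Theorem theorem3 (R : realType) (Om : set (R * R * R)) (T : R)
  (eps mu sigma : R * R * R -> 'M[R]_3) (eps_star mu_star : R)
  (e0 h0 : R * R * R -> 'cV[R]_3) (e h : R * R * R * R -> 'cV[R]_3)
  (Om_domain : is_domain Om) (Om_bounded : bounded_set Om)
  (T_gt0 : 0 < T)
  (sepV : V_separable Om)
  (eps_bm : bounded_measurable_mx Om eps)
  (mu_bm : bounded_measurable_mx Om mu)
  (eps_sym : forall x, Om x -> (eps x)^T = eps x)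
  (mu_sym : forall x, Om x -> (mu x)^T = mu x)
  (eps_nonneg : forall x, Om x -> forall xi, 0 <= dot (eps x *m xi) xi)
  (mu_nonneg : forall x, Om x -> forall xi, 0 <= dot (mu x *m xi) xi)
  (eps_star_gt0 : 0 < eps_star) (mu_star_gt0 : 0 < mu_star)
  (eps_coercive : forall x, Om x -> forall xi,
     eps_star * dot xi xi <= dot (eps x *m xi) xi)
  (mu_coercive : forall x, Om x -> forall xi,
     mu_star * dot xi xi <= dot (mu x *m xi) xi)
  (sigma_bm : bounded_measurable_mx Om sigma)
  (e0_L2 : L2 leb3 Om e0) (h0_L2 : L2 leb3 Om h0)
  (e0_eq0 : {ae leb3, forall x, Om x -> e0 x = 0})
  (h0_eq0 : {ae leb3, forall x, Om x -> h0 x = 0})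
  (sol : weak_solution Om T eps mu (fun p => sigma p.1 *m e p) e0 h0 e h) :
  {ae leb4, forall p, QT Om T p -> e p = 0 /\ h p = 0}.
Proof.
have [oO _ _] := Om_domain; have mO := open_measurable3 oO.
(* Outside the domain a scalar matrix stands in for the coefficient, so that the
Borel coefficients are symmetric and coercive everywhere. *)
pose elliptic (c : R) (a : 'M[R]_3) := a^T = a /\ forall xi, c * dot xi xi <= dot (a *m xi) xi.
have scalar_elliptic c : elliptic c c%:M.
  by split=> [|xi]; [exact: tr_scalar_mx|rewrite mul_scalar_mx dotZl].
have eps_P x : Om x -> elliptic eps_star (eps x).
  by move=> Ox; split; [exact: eps_sym|exact: eps_coercive].
have mu_P x : Om x -> elliptic mu_star (mu x).
  by move=> Ox; split; [exact: mu_sym|exact: mu_coercive].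
have [ep [mep [M1 M1_ge0 epM] ep_P epE]] :=
  borel_coefficient oO eps_bm (scalar_elliptic eps_star) eps_P.
have [m [mm [M2 M2_ge0 mM] m_P mE]] :=
  borel_coefficient oO mu_bm (scalar_elliptic mu_star) mu_P.
have [sg [msg [M3 M3_ge0 sgM] _ sgE]] :=
  borel_coefficient (P := fun=> True) (a0 := 0) oO sigma_bm I (fun _ _ => I).
pose M := M1 + M2 + M3; have M_ge0 : 0 <= M by rewrite !addr_ge0.
have {}epM k l x : `|ep x k l| <= M.
  by apply: le_trans (epM k l x) _; rewrite /M -addrA lerDl addr_ge0.
have {}mM k l x : `|m x k l| <= M.
  by apply: le_trans (mM k l x) _; rewrite /M addrAC lerDr addr_ge0.
have {}sgM k l x : `|sg x k l| <= M.
  by apply: le_trans (sgM k l x) _; rewrite /M lerDr addr_ge0.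
have [Le Lh _] := sol.
have [e' [te eE e'_out]] := L2_time_vfield mO Le.
have [h' [th hE h'_out]] := L2_time_vfield mO Lh.
have balance (t : R) := energy_balance oO Om_bounded T_gt0 mep mm msg epM mM sgM
  (fun x => (ep_P x).1) (fun x => (m_P x).1) epE mE sgE te th eE hE e0_eq0 h0_eq0 sol (t := t).
pose u (i : 'I_3 + 'I_3) := match i with
  | inl k => fun q : R * R * R * R => e' q k 0
  | inr k => fun q : R * R * R * R => h' q k 0 end.
have u_eq0 i : {ae leb4, forall q, u i q = 0}.
  apply: (@energy_eq0 _ _ R leb3 T T_gt0 ('I_3 + 'I_3)%type
    (fun i j x => block_entry (ep x) (m x) i j) (fun i j x => block_entry (sg x) 0 i j)
    u M (Num.min eps_star mu_star)) => //.
  - by rewrite lt_min eps_star_gt0.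
  - by move=> [k|k] [l|l] //=; exact: measurable_cst.
  - by move=> [k|k] [l|l] //=; (under eq_fun do rewrite mxE); exact: measurable_cst.
  - by move=> i' j x; apply: block_entry_le.
  - by move=> i' j x; apply: block_entry_le => // k l; rewrite mxE normr0.
  - move=> [k|k] [l|l] x //=; [rewrite -[in LHS](ep_P x).1|rewrite -[in LHS](m_P x).1];
      by rewrite mxE.
  - by move=> x xi; apply: block_coercive; [exact: (ep_P x).2|exact: (m_P x).2].
  - by move=> [k|k]; [exact: te|exact: th].
  - move=> t tT; rewrite -[RHS](balance t tT).
    rewrite (Rintegral_restrict (Om := Om)); last first.
      move=> x Ox.
      have e'0 s : e' (x, s) = 0 by apply: e'_out => -[].
      have h'0 s : h' (x, s) = 0 by apply: h'_out => -[].
      rewrite (vprimitive_eq0 t e'0) (vprimitive_eq0 t h'0) (vprimitive2_eq0 t e'0).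
      by rewrite !mulmx0 !dot0l !addr0.
    apply: eq_Rintegral => x _.
    under eq_bigr do rewrite big_split; rewrite big_split /= !block_formE.
    by rewrite mul0mx dot0l addr0.
have uA : {ae leb4, forall q, forall i, u i q = 0} by apply: filter_forall.
apply: ae_imply3 uA eE hE => q uq Eq Hq Qq; rewrite Eq// Hq//.
split; apply/matrixP => i j; rewrite (ord1 j) mxE.
- exact: (uq (inl i)).
- exact: (uq (inr i)).
Qed.
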